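(* Let $\varphi\in L^\infty(\mathbb{R})$ be a non-negative function, not identically equal to zero (as an element of $L^\infty(\mathbb{R})$), satisfying $\int_{-\infty}^\infty \varphi(t)(\log(2+|t|))^\delta dt<\infty$ for some $\delta>2$. For $\alpha>0$ let $$\varphi_\alpha(t)=\frac{1}{\alpha}\varphi(t/\alpha).$$ Then for every $\lambda>0$ there exists $\alpha_0=\alpha_0(\lambda)>0$ such that for all $\alpha\ge\alpha_0$, $$n(\lambda;K(\varphi_\alpha))\ge \#\left\{j\in\mathbb{N}: \tfrac{1}{j}\widehat\varphi(0)>\lambda\right\}.$$ In particular, the number of eigenvalues (counted with multiplicities) of $K(\varphi_\alpha)$ above its essential spectrum tends to infinity as $\alpha\to\infty$.
   Context: The Fourier transform is $\widehat\varphi(u)=\frac{1}{2\pi}\int_{-\infty}^\infty \varphi(t)e^{-itu}\,dt$. For a symbol $\varphi$ as in the claim, $K(\varphi)$ is the bounded positive semi-definite operator on $\ell^2(\mathbb{N})$ given by the infinite matrix $\{k(n,m)\}_{n,m=1}^\infty$, $k(n,m)=\frac{1}{\sqrt{nm}}\widehat\varphi(\log\frac{n}{m})$ (defined on finitely supported sequences and extended by continuity); the symbols $\varphi_\alpha$ satisfy the same hypotheses as $\varphi$. For a self-adjoint operator $A$, $n(\lambda;A)$ denotes the rank of the spectral projection $E_A(\lambda,\infty)$ of $A$ corresponding to the interval $(\lambda,\infty)$; that is, the number of eigenvalues of $A$ in $(\lambda,\infty)$ counted with multiplicities, with $n(\lambda;A)=\infty$ if $A$ has some essential spectrum in $(\lambda,\infty)$.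 $\#$ denotes the number of elements of a set. *)

(* Defs.v *)
From HB Require Import structures.
From mathcomp Require Import all_boot all_order all_algebra.
From mathcomp Require Import complex.
From mathcomp Require Import all_classical all_reals all_analysis.
From mathcomp Require Import lra.

Set Implicit Arguments.
Unset Strict Implicit.
Unset Printing Implicit Defensive.

Import Order.TTheory GRing.Theory Num.Theory.
Import numFieldNormedType.Exports.

Local Open Scope classical_set_scope.
Local Open Scope ring_scope.
Local Open Scope complex_scope.

Local Notation normc := Normc.normc.

Definition fourier (R : realType) (phi : R -> R) (u : R) : R[i] :=
  ((2 * pi)^-1)%:C *
  ((\int[lebesgue_measure]_t (phi t * cos (t * u))) -i*
   (\int[lebesgue_measure]_t (phi t * sin (t * u)))).

Definition dilation (R : realType) (phi : R -> R) (alpha t : R) : R :=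
  alpha^-1 * phi (t / alpha).

(* The Hilbert space l^2 over the complex numbers.  The coordinate x n, for
   n : nat starting at 0, stands for the coordinate of index n.+1 of a sequence
   indexed by the positive integers. *)

Section L2.
Variable R : realType.

Definition sqnorm (x : nat -> R[i]) : \bar R :=
  (\sum_(0 <= n <oo) (normc (x n) ^+ 2)%:E)%E.

Definition l2_pred : {pred (nat -> R[i])} := fun x => (sqnorm x < +oo)%E.

Let sqn_ge0 (x : nat -> R[i]) n : (0 <= (normc (x n) ^+ 2)%:E)%E.
Proof. by rewrite lee_fin sqr_ge0. Qed.

Let sqnormD_le (a x y : R[i]) :
  normc (a * x + y) ^+ 2 <= 2 * normc a ^+ 2 * normc x ^+ 2 + 2 * normc y ^+ 2.
Proof.
have n0 (z : R[i]) : 0 <= normc z by case: z => ? ?; rewrite sqrtr_ge0.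
have h : normc (a * x + y) <= normc a * normc x + normc y.
  by rewrite -Normc.normcM; exact: le_normcD.
apply: (@le_trans _ _ ((normc a * normc x + normc y) ^+ 2)).
  by rewrite lerXn2r ?nnegrE// addr_ge0// mulr_ge0.
have := sqr_ge0 (normc a * normc x - normc y); lra.
Qed.

Lemma l2_submod_closed : submod_closed l2_pred.
Proof.
split=> [|a x y]; rewrite !unfold_in /l2_pred /sqnorm.
  rewrite eseries0 ?ltry// => n _ _ /=.
  by rewrite expr0n addr0 sqrtr0 expr0n.
move=> xoo yoo; have c0 : 0 <= 2 * normc a ^+ 2 by rewrite mulr_ge0// sqr_ge0.
apply: (@le_lt_trans _ _ (\sum_(0 <= n <oo)
    ((2 * normc a ^+ 2)%:E * (normc (x n) ^+ 2)%:E
     + 2%:E * (normc (y n) ^+ 2)%:E))%E).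
  apply: lee_nneseries => n _; first by move=> _; exact: sqn_ge0.
  by rewrite -!EFinM -EFinD lee_fin; exact: sqnormD_le.
rewrite nneseriesD; [|by move=> *; rewrite mule_ge0..].
rewrite !nneseriesZl//.
by rewrite lte_add_pinfty// lte_mul_pinfty// ?lee_fin// ltry.
Qed.

HB.instance Definition _ :=
  GRing.isSubmodClosed.Build R[i] (nat -> R[i]) l2_pred l2_submod_closed.

Record l2 := L2 { l2val :> nat -> R[i]; _ : l2val \in l2_pred }.
HB.instance Definition _ := [isSub for l2val].
HB.instance Definition _ := [Choice of l2 by <:].
HB.instance Definition _ := [SubChoice_isSubLmodule of l2 by <:].

Definition l2norm (x : l2) : R := Num.sqrt (fine (sqnorm x)).

Definition bounded_op (A : l2 -> l2) : Prop :=
  exists M : R, forall x, l2norm (A x) <= M * l2norm x.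

End L2.

Section Kop.
Variables (R : realType) (phi : R -> R).

Definition kmat (n m : nat) : R[i] :=
  ((Num.sqrt (n%:R * m%:R))^-1)%:C * fourier phi (ln (n%:R / m%:R)).

Definition is_K (A : {linear l2 R -> l2 R}) : Prop :=
  bounded_op A /\
  forall (x : l2 R) (N : nat), (forall m, (N <= m)%N -> x m = 0) ->
    forall n, A x n = \sum_(m < N) kmat n.+1 m.+1 * x m.

(* The bounded operator extending the matrix from the finitely supported
   sequences; such an extension is unique.  The value \0 is only used when no
   bounded extension exists. *)
Definition K : {linear l2 R -> l2 R} :=
  if pselect (exists A, is_K A) is left h then projT1 (cid h)
  else [the {linear l2 R -> l2 R} of \0].

End Kop.

Section Dimension.
Variables (R : realType) (V : lmodType R[i]).

Definition free_mod (S : set V) (k : nat) (v : 'I_k -> V) : Prop :=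
  forall c : 'I_k -> R[i], S (\sum_i c i *: v i) -> forall i, c i = 0.

(* Dimensions are extended reals, equal to +oo for infinite-dimensional spaces;
   S is meant to be a linear subspace of V. *)
Definition edim (S : set V) : \bar R :=
  ereal_sup [set k%:R%:E | k in
    [set k | exists2 v : 'I_k -> V, (forall i, S (v i)) & free_mod [set 0] v]].

Definition ecodim (S : set V) : \bar R :=
  ereal_sup [set k%:R%:E | k in [set k | exists v : 'I_k -> V, free_mod S v]].

End Dimension.

(* A is meant to be bounded and self-adjoint, so that its spectrum is real and
   the usual definitions of the essential spectrum agree with the one below
   (A - mu not Fredholm). *)
Section Spectrum.
Variables (R : realType) (A : l2 R -> l2 R).

Definition shift_op (mu : R) (x : l2 R) : l2 R := A x - mu%:C *: x.

Definition kernel (T : l2 R -> l2 R) : set (l2 R) := [set x | T x = 0].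

Definition l2_closed (S : set (l2 R)) : Prop :=
  forall y, (forall e : R, 0 < e -> exists2 x, S x & l2norm (x - y) < e) -> S y.

Definition fredholm (T : l2 R -> l2 R) : Prop :=
  [/\ (edim (kernel T) < +oo)%E, l2_closed (range T)
    & (ecodim (range T) < +oo)%E].

Definition ess_spectrum : set R := [set mu | ~ fredholm (shift_op mu)].

Definition eigenvalues : set R :=
  [set mu | exists2 x : l2 R, x != 0 & A x = mu%:C *: x].

Definition multiplicity (mu : R) : \bar R := edim (kernel (shift_op mu)).

Definition count_eigen (D : set R) : \bar R :=
  \esum_(mu in eigenvalues `&` D) multiplicity mu.

Definition above_ess : set R := [set mu | forall s, ess_spectrum s -> s < mu].

(* n(lam; A), the rank of the spectral projection of a self-adjoint A for the
   interval (lam, oo), expressed by counting eigenvalues. *)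
Definition nfun (lam : R) : \bar R :=
  if `[< exists2 s, ess_spectrum s & lam < s >] then +oo%E
  else count_eigen [set mu | lam < mu].

End Spectrum.

(* Main.v *)
(* The quadratic form of K(phi_alpha) at x is
   (2 pi)^-1 \int phi(t) |\sum_n x_n n^(-1/2) e^(i alpha t ln n)|^2 dt.
   Multiply the n-th summand by the damping factor e^(- alpha |t| / n).  The
   damped sums have the explicit Gram matrix
   alpha^-1 (n m)^(-1/2) 2 a / (a^2 + l^2), a = 1/n + 1/m, l = ln n - ln m,
   which Schur's test bounds by C / alpha; as phi is bounded, so is the damped
   form.  If x vanishes at the indices <= N, then by Cauchy-Schwarz the damping
   changes the sum by at most a multiple of ln(1 + alpha |t| / N) |x|^2 in
   square; this is integrable against phi and its integral tends to 0 as N tends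
   to infinity.  Hence for alpha large (depending on lambda only) the form is
   <= lambda / 2 on a coordinate subspace of finite codimension, and
   K(phi_alpha) - mu is Fredholm for every mu > lambda / 2.  On the first J
   coordinates, on the other hand, the Riemann-Lebesgue lemma makes the matrix
   tend to diag(phi^(0) / j) as alpha tends to infinity, and the variational
   principle produces J orthonormal eigenvectors with eigenvalues > lambda as
   soon as phi^(0) / J > lambda. *)

Require Import Defs.
From HB Require Import structures.
From mathcomp Require Import all_boot all_order all_algebra.
From mathcomp Require Import complex.
From mathcomp Require Import all_classical all_reals all_analysis.
From mathcomp Require Import measurable_realfun ess_sup_inf.
From mathcomp Require Import ring lra.

Set Implicit Arguments.
Unset Strict Implicit.
Unset Printing Implicit Defensive.

Import Order.TTheory GRing.Theory Num.Theory.
Import numFieldNormedType.Exports.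

Local Open Scope classical_set_scope.
Local Open Scope ring_scope.
Local Open Scope complex_scope.

Local Notation Re := complex.Re.
Local Notation Im := complex.Im.

(** The damping cuts the n-th oscillation off at |t| of order n / alpha because two regimes meet
    there. Up to that scale its squared weight 1 / n leaves a mass of order 1 / alpha, so a bounded
    phi contributes little, however many terms there are. Beyond it the mass |t| / n is unbounded
    and only the decay of phi helps; the indices between N and alpha |t| cost the sum of 1 / n,
    which is the logarithm. The cut-off is exponential because the Gram entries are then nonnegative
    and decay quadratically in the frequency gap, so that Schur's test needs no cancellation. The
    order of choices matters: alpha is fixed from lambda alone, through the damped part, and only
    then N from alpha. This is harmless since any finite codimension will do. No spectral theorem is
    invoked: the Fredholm property comes from a finite Schur complement, and the eigenvectors are
    found one at a time as maximisers of the form. *)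

(** The Cauchy-Schwarz inequalities below, for [ip], for positive matrix forms, for finite sums and
    for a semi-definite operator, are read off from this discriminant bound. Such forms may
    degenerate, hence the case [a = 0]. *)
Lemma quad_disc (R : realType) (a b c : R) :
  (forall t, 0 <= a * t ^+ 2 + 2 * b * t + c) -> b ^+ 2 <= a * c.
Proof.
move=> h; have c0 : 0 <= c by have := h 0; rewrite expr0n/= !mulr0 !add0r.
have a0 : 0 <= a.
  rewrite leNgt; apply/negP => a0.
  (* For [a < 0] the values at these opposite arguments add up to a negative number, as the linear
     terms cancel. *)
  have h1 := h (1 + c / - a); have h2 := h (- (1 + c / - a)).
  have : a * (1 + c / - a) ^+ 2 + c = a - c + c ^+ 2 / a by field; lra.
  have : c ^+ 2 / a <= 0 by rewrite mulr_ge0_le0 ?sqr_ge0// invr_le0 ltW.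
  lra.
have [a0'|a1] := ltrP 0 a.
  have := h (- b / a).
  have -> : a * (- b / a) ^+ 2 + 2 * b * (- b / a) + c = (a * c - b ^+ 2) / a.
    by field; lra.
  by rewrite pmulr_lge0 ?invr_gt0// subr_ge0.
have {a0 a1} a0 : a = 0 by lra.
subst a; rewrite mul0r; have [->|b0] := eqVneq b 0; first by rewrite expr0n.
have := h (- (c + 1) / (2 * b)).
have -> : 0 * (- (c + 1) / (2 * b)) ^+ 2 + 2 * b * (- (c + 1) / (2 * b)) + c = -1.
  by field.
lra.
Qed.

Section dotc.
Variable R : realType.
Implicit Types a b c : R[i].

(* The real part of a * conjc b; l2 is mostly treated as a real Hilbert space. *)
Definition dotc a b : R := Re a * Re b + Im a * Im b.

Lemma dotcC a b : dotc a b = dotc b a.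
Proof. by rewrite /dotc; ring. Qed.

Lemma dotcDl a b c : dotc (a + b) c = dotc a c + dotc b c.
Proof. by case: a b c => [? ?] [? ?] [? ?]; rewrite /dotc/=; ring. Qed.

Lemma dotcZl (k : R) a c : dotc (k%:C * a) c = k * dotc a c.
Proof. by case: a c => [? ?] [? ?]; rewrite /dotc/=; ring. Qed.

Lemma dotcMJ a b c : dotc (a * b) c = dotc b (conjc a * c).
Proof. by case: a b c => [? ?] [? ?] [? ?]; rewrite /dotc/=; ring. Qed.

Lemma dotcc_ge0 a : 0 <= dotc a a.
Proof. by rewrite /dotc addr_ge0// -expr2 sqr_ge0. Qed.

Lemma dotccE a : Normc.normc a ^+ 2 = dotc a a.
Proof.
case: a => x y; rewrite /dotc/= sqr_sqrtr ?addr_ge0 ?sqr_ge0//.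
Qed.

Lemma dotcc_eq0 a : dotc a a = 0 -> a = 0.
Proof. by rewrite -dotccE => /eqP; rewrite sqrf_eq0 => /eqP /Normc.eq0_normc. Qed.

Lemma dotcM a b : dotc (a * b) (a * b) = dotc a a * dotc b b.
Proof. by case: a b => [? ?] [? ?]; rewrite /dotc/=; ring. Qed.

Lemma dotc0l a : dotc 0 a = 0.
Proof. by rewrite /dotc/= !mul0r addr0. Qed.

Lemma dotc_le a b : `|dotc a b| <= dotc a a + dotc b b.
Proof.
case: a b => [p q] [r s]; rewrite /dotc/= ler_norml.
have := sqr_ge0 (p + r); have := sqr_ge0 (p - r); have := sqr_ge0 (q - s).
have := sqr_ge0 (q + s); have := sqr_ge0 p; have := sqr_ge0 q.
have := sqr_ge0 r; have := sqr_ge0 s.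
by move=> *; apply/andP; split; nra.
Qed.

End dotc.

(** * The Hilbert space l2 *)

Section l2_hilbert.
Variable R : realType.
Implicit Types x y z : l2 R.

Let sqnormE (u : nat -> R[i]) N : \sum_(0 <= n < N) (Normc.normc (u n) ^+ 2)%:E =
  (\sum_(0 <= n < N) dotc (u n) (u n))%:E :> \bar R.
Proof. by rewrite -sumEFin; apply: eq_bigr => i _; rewrite dotccE. Qed.

Lemma l2_predP (u : nat -> R[i]) :
  (exists M, forall N, \sum_(0 <= n < N) dotc (u n) (u n) <= M) -> u \in @l2_pred R.
Proof.
move=> [M hM]; rewrite unfold_in /l2_pred /sqnorm.
apply: (@le_lt_trans _ _ M%:E); last exact: ltry.
apply: lime_le; first by apply: is_cvg_nneseries => n _ _; rewrite lee_fin sqr_ge0.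
by apply: nearW => N; rewrite sqnormE lee_fin.
Qed.

Lemma l2_coord_bounded x : exists M, forall N, \sum_(0 <= n < N) dotc (x n) (x n) <= M.
Proof.
case: x => u /= hu; move: (hu); rewrite unfold_in /l2_pred /sqnorm => uoo.
have u0 : (0 <= sqnorm u)%E by apply: nneseries_ge0 => n _ _; rewrite lee_fin sqr_ge0.
exists (fine (sqnorm u)) => N.
rewrite -lee_fin fineK ?ge0_fin_numE// -sqnormE.
by apply: nneseries_lim_ge => n _ _; rewrite lee_fin sqr_ge0.
Qed.

Definition ip x y : R := limn (series (fun n => dotc (x n) (y n))).

Lemma ip_cvgxx x : cvgn (series (fun n => dotc (x n) (x n))).
Proof.
have [M hM] := l2_coord_bounded x.
apply: nondecreasing_is_cvgn; first exact/nondecreasing_series/(fun n _ _ => dotcc_ge0 _).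
by exists M => _ [n _ <-]; rewrite /series/=.
Qed.

Lemma ip_cvg x y : series (fun n => dotc (x n) (y n)) @ \oo --> ip x y.
Proof.
apply/cvg_ex; exists (ip x y); rewrite -/(cvgn _).
suff: cvgn (series (fun n => dotc (x n) (y n))) by [].
apply: normed_cvg; apply: (@series_le_cvg _ _ (fun n => dotc (x n) (x n) + dotc (y n) (y n))).
- by move=> n; exact: normr_ge0.
- by move=> n; rewrite addr_ge0// dotcc_ge0.
- by move=> n; exact: dotc_le.
- rewrite -[X in series X]/((fun n => dotc (x n) (x n)) + (fun n => dotc (y n) (y n))).
  by rewrite seriesD; apply: is_cvgD; exact: ip_cvgxx.
Qed.

Lemma ipC x y : ip x y = ip y x.
Proof. by rewrite /ip; congr (limn (series _)); apply/funext => n; rewrite dotcC. Qed.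

Lemma ipDl x y z : ip (x + y) z = ip x z + ip y z.
Proof.
apply: cvg_lim => //; rewrite [X in series X](_ : _ =
  (fun n => dotc (x n) (z n)) + (fun n => dotc (y n) (z n))).
  by rewrite seriesD; apply: cvgD; exact: ip_cvg.
by apply/funext => n; rewrite -[RHS]dotcDl.
Qed.

Lemma ipZl (k : R) x z : ip (k%:C *: x) z = k * ip x z.
Proof.
apply: cvg_lim => //; rewrite [X in series X](_ : _ = k *: (fun n => dotc (x n) (z n))).
  rewrite seriesZ; apply: cvgZl_tmp; exact: ip_cvg.
by apply/funext => n; rewrite -[RHS]dotcZl.
Qed.

Lemma ipMJ (c : R[i]) x y : ip (c *: x) y = ip x (conjc c *: y).
Proof.
by rewrite /ip; congr (limn (series _)); apply/funext => n; rewrite -[RHS]dotcMJ.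
Qed.

Lemma ipNl x z : ip (- x) z = - ip x z.
Proof. by rewrite -scaleN1r (_ : -1 = (- 1 : R)%:C) ?ipZl ?mulN1r// rmorphN rmorph1. Qed.

Lemma ip0l z : ip 0 z = 0.
Proof. by rewrite -{1}(scale0r z) (_ : 0 = (0 : R)%:C) ?ipZl ?mul0r. Qed.

Lemma ipDr x y z : ip z (x + y) = ip z x + ip z y.
Proof. by rewrite ipC ipDl !(ipC z). Qed.

Lemma ipZr (k : R) x z : ip z (k%:C *: x) = k * ip z x.
Proof. by rewrite ipC ipZl (ipC z). Qed.

Lemma ipNr x z : ip z (- x) = - ip z x.
Proof. by rewrite ipC ipNl (ipC z). Qed.

Lemma ip0r z : ip z 0 = 0.
Proof. by rewrite ipC ip0l. Qed.

Lemma ip_suml I (r : seq I) (f : I -> l2 R) z : ip (\sum_(i <- r) f i) z = \sum_(i <- r) ip (f i) z.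
Proof. by elim/big_rec2 : _ => [|i u v _ <-]; rewrite ?ip0l ?ipDl. Qed.

Lemma ip_sumr I (r : seq I) (f : I -> l2 R) z : ip z (\sum_(i <- r) f i) = \sum_(i <- r) ip z (f i).
Proof. by rewrite ipC ip_suml; apply: eq_bigr => i _; rewrite ipC. Qed.

Lemma ip_ge_partial x N : \sum_(0 <= n < N) dotc (x n) (x n) <= ip x x.
Proof.
apply: (nondecreasing_cvgn_le _ (@ip_cvgxx x) N).
exact/nondecreasing_series/(fun n _ _ => dotcc_ge0 _).
Qed.

Lemma ip_le x M : (forall N, \sum_(0 <= n < N) dotc (x n) (x n) <= M) -> ip x x <= M.
Proof. by move=> h; apply: limr_le; [exact: ip_cvgxx|exact: nearW]. Qed.

Lemma ip_ge0 x : 0 <= ip x x.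
Proof. by apply: le_trans (ip_ge_partial x 0); rewrite big_geq. Qed.

Lemma ip_coord x n : dotc (x n) (x n) <= ip x x.
Proof.
apply: le_trans (ip_ge_partial x n.+1); rewrite big_nat_recr//= lerDr.
by apply: sumr_ge0 => i _; exact: dotcc_ge0.
Qed.

Lemma l2_ext x y : (forall n, x n = y n) -> x = y.
Proof. by move=> h; apply: val_inj; exact/funext. Qed.

Lemma ip_eq0 x : ip x x = 0 -> x = 0.
Proof.
move=> x0; apply: l2_ext => n; apply: dotcc_eq0; apply/eqP.
by rewrite eq_le dotcc_ge0 andbT -x0 ip_coord.
Qed.

Lemma ip_finite_support N x y : (forall n, (N <= n)%N -> x n = 0) ->
  ip x y = \sum_(n < N) dotc (x n) (y n).
Proof.
move=> x0; apply: cvg_lim => //; apply: (@cvg_near_cst _ _ _ _ _) => //.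
near=> M; rewrite /series/=.
have NM : (N <= M)%N by near: M; exact: nbhs_infty_ge.
rewrite (big_cat_nat (leq0n N) NM)/= [X in _ + X]big_nat_cond [X in _ + X]big1 ?addr0 ?big_mkord//.
by move=> i; rewrite andbT => /andP[Ni _]; rewrite x0// dotc0l.
Unshelve. all: by end_near. Qed.

Lemma l2normE x : l2norm x ^+ 2 = ip x x.
Proof.
suff -> : l2norm x = Num.sqrt (ip x x) by rewrite sqr_sqrtr// ip_ge0.
rewrite /l2norm; congr Num.sqrt; rewrite /sqnorm.
rewrite (_ : (fun _ => _) = EFin \o series (fun n => dotc (x n) (x n))).
  by rewrite EFin_lim//; exact: ip_cvgxx.
by apply/funext => n; rewrite sqnormE.
Qed.

Lemma l2norm_ge0 x : 0 <= l2norm x.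
Proof. exact: sqrtr_ge0. Qed.

Lemma l2norm_le x M : 0 <= M -> ip x x <= M ^+ 2 -> l2norm x <= M.
Proof. by move=> M0; rewrite -l2normE ler_sqr// nnegrE l2norm_ge0. Qed.

Lemma ip_CS x y : ip x y ^+ 2 <= ip x x * ip y y.
Proof.
apply: quad_disc => t; have := ip_ge0 (t%:C *: x + y).
by rewrite !(ipDl, ipDr, ipZl, ipZr) (ipC y x); congr (_ <= _); ring.
Qed.

Lemma ip_le_norm x y : `|ip x y| <= l2norm x * l2norm y.
Proof.
rewrite -ler_sqr ?nnegrE ?mulr_ge0 ?l2norm_ge0//.
by rewrite real_normK ?num_real// exprMn !l2normE ip_CS.
Qed.

Lemma l2normD x y : l2norm (x + y) <= l2norm x + l2norm y.
Proof.
apply: l2norm_le; first by rewrite addr_ge0 ?l2norm_ge0.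
have := ip_le_norm x y; rewrite ler_norml => /andP[_ h].
rewrite !(ipDl, ipDr) sqrrD !l2normE (ipC y x); lra.
Qed.

Lemma l2normZ (c : R[i]) x : l2norm (c *: x) = Normc.normc c * l2norm x.
Proof.
have nc0 : 0 <= Normc.normc c by case: (c) => ? ?; rewrite sqrtr_ge0.
apply/eqP; rewrite -(@eqrXn2 _ 2) ?mulr_ge0 ?l2norm_ge0//; apply/eqP.
rewrite exprMn !l2normE ipMJ scalerA ipC.
have -> : conjc c * c = (Normc.normc c ^+ 2)%:C.
  by rewrite dotccE; case: (c) => p q; apply/eqP; rewrite eq_complex /dotc/=; apply/andP; split; apply/eqP; ring.
by rewrite ipZl.
Qed.

Lemma l2normN x : l2norm (- x) = l2norm x.
Proof.
apply/eqP; rewrite -(@eqrXn2 _ 2) ?l2norm_ge0//.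
by rewrite !l2normE ipNl ipNr opprK.
Qed.

Lemma l2norm0 : l2norm (0 : l2 R) = 0.
Proof. by apply/eqP; rewrite -sqrf_eq0 l2normE ip0l. Qed.

Lemma l2norm_eq0 x : l2norm x = 0 -> x = 0.
Proof. by move=> x0; apply: ip_eq0; rewrite -l2normE x0 expr0n. Qed.

End l2_hilbert.

Lemma ReB (R : realType) (a b : R[i]) : Re (a - b) = Re a - Re b.
Proof. by case: a b => [? ?] [? ?]. Qed.

Lemma ImB (R : realType) (a b : R[i]) : Im (a - b) = Im a - Im b.
Proof. by case: a b => [? ?] [? ?]. Qed.

Lemma cvg_sumr (R : realType) (T : Type) (F : set_system T) {FF : Filter F} (I : Type)
    (r : seq I) (f : I -> T -> R) (l : I -> R) :
  (forall i, f i @ F --> l i) ->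
  (fun t => \sum_(i <- r) f i t) @ F --> \sum_(i <- r) l i.
Proof.
move=> h; elim: r => [|i r ih].
  by rewrite big_nil; under eq_fun do rewrite big_nil; exact: cvg_cst.
by rewrite big_cons; under eq_fun do rewrite big_cons; apply: cvgD.
Qed.

(** * Truncation to finitely many coordinates, and completeness of l2 *)

Section l2_trunc.
Variable R : realType.
Implicit Types x y z : l2 R.

Definition truncseq N (u : nat -> R[i]) n : R[i] := if (n < N)%N then u n else 0.

Lemma truncseq_l2 N (u : nat -> R[i]) : truncseq N u \in @l2_pred R.
Proof.
apply: l2_predP; exists (\sum_(0 <= n < N) dotc (truncseq N u n) (truncseq N u n)) => M.
have [MN|/ltnW NM] := leqP M N.
  rewrite [leRHS](big_cat_nat (leq0n M) MN)/= lerDl.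
  by apply: sumr_ge0 => i _; exact: dotcc_ge0.
rewrite (big_cat_nat (leq0n N) NM)/= [X in _ + X]big_nat_cond [X in _ + X]big1 ?addr0//.
by move=> i; rewrite andbT => /andP[Ni _]; rewrite /truncseq ltnNge Ni dotc0l.
Qed.

Definition truncate N u : l2 R := L2 (truncseq_l2 N u).

Lemma truncateE N u n : truncate N u n = if (n < N)%N then u n else 0.
Proof. by []. Qed.

Lemma truncate_ge N u n : (N <= n)%N -> truncate N u n = 0.
Proof. by rewrite truncateE leqNgt => /negbTE ->. Qed.

Lemma ip_truncatel N u y : ip (truncate N u) y = \sum_(n < N) dotc (u n) (y n).
Proof.
rewrite (@ip_finite_support _ N); last by move=> n; exact: truncate_ge.
by apply: eq_bigr => i _; rewrite truncateE ltn_ord.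
Qed.

Lemma ip_truncateC N x y : ip (truncate N x) y = ip x (truncate N y).
Proof.
rewrite (ipC x) !ip_truncatel.
by apply: eq_bigr => i _; rewrite dotcC.
Qed.

Lemma truncate_id N x : (forall n, (N <= n)%N -> x n = 0) -> truncate N x = x.
Proof.
by move=> x0; apply: l2_ext => n; rewrite truncateE; case: ltnP => // /x0.
Qed.

Lemma truncate_funD N u v : truncate N (fun n => u n + v n) = truncate N u + truncate N v.
Proof.
by apply: l2_ext => n; rewrite -[RHS]/(truncate N u n + truncate N v n) !truncateE; case: ifP; rewrite ?addr0.
Qed.

Lemma truncate_funZ N c u : truncate N (fun n => c * u n) = c *: truncate N u.
Proof.
by apply: l2_ext => n; rewrite -[RHS]/(c * truncate N u n) !truncateE; case: ifP; rewrite ?mulr0.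
Qed.

Lemma truncateK N x : truncate N (truncate N x) = truncate N x.
Proof. by apply: truncate_id => n; exact: truncate_ge. Qed.

Lemma ip_decomp N x : ip x x = ip (truncate N x) (truncate N x) + ip (x - truncate N x) (x - truncate N x).
Proof.
have -> : ip (x - truncate N x) (x - truncate N x) = ip x x - 2 * ip (truncate N x) x + ip (truncate N x) (truncate N x).
  by rewrite !(ipDl, ipDr, ipNl, ipNr) (ipC x (truncate N x)); ring.
have -> : ip (truncate N x) x = ip (truncate N x) (truncate N x) by rewrite -{1}truncateK ip_truncateC.
ring.
Qed.

Lemma l2norm_truncate N x : l2norm (truncate N x) <= l2norm x.
Proof.
apply: l2norm_le; first exact: l2norm_ge0.
by rewrite l2normE (ip_decomp N x) lerDl ip_ge0.
Qed.

Lemma l2norm_tail N x : l2norm (x - truncate N x) <= l2norm x.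
Proof.
apply: l2norm_le; first exact: l2norm_ge0.
by rewrite l2normE (ip_decomp N x) lerDr ip_ge0.
Qed.

Lemma truncate_cvg x (e : R) : 0 < e ->
  exists N0, forall N, (N0 <= N)%N -> l2norm (x - truncate N x) <= e.
Proof.
move=> e0; have e20 : 0 < e ^+ 2 by rewrite exprn_gt0.
have /cvgrPdist_le /(_ _ e20) [N0 _ h] := @ip_cvg _ x x.
exists N0 => N /h /=; rewrite /series/= big_mkord ler_norml => /andP[_ hN].
apply: l2norm_le; first exact: ltW.
apply: le_trans hN; rewrite (ip_decomp N x) ip_truncatel lerBrDr addrC.
rewrite lerD2r; apply: ler_sum => i _.
by rewrite truncateE ltn_ord.
Qed.

Lemma geometric_cauchy_cvg (s : nat -> R) (C r : R) : 0 <= C -> 0 <= r < 1 ->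
  (forall k, `|s k.+1 - s k| <= C * r ^+ k) -> cvgn s.
Proof.
move=> C0 /andP[r0 r1] h; rewrite (_ : s = cst (s 0) + series (telescope s)).
  2: by apply/funext => n; rewrite [LHS]eq_sum_telescope.
apply: is_cvgD; first exact: is_cvg_cst.
apply: normed_cvg; apply: (@series_le_cvg _ _ (geometric C r)) => //.
- by move=> n; exact: normr_ge0.
- by move=> n; rewrite /geometric/= mulr_ge0 ?exprn_ge0.
- by apply/cvg_ex; eexists; apply: cvg_geometric_series; rewrite ger0_norm.
Qed.

(** Coordinatewise limits suffice: the bound on each partial sum of squares passes to the limit and
    then bounds the norm. The geometric rate is the one that the iteration in [lax_milgram]
    delivers. *)
Lemma l2_complete (x_ : nat -> l2 R) (C r : R) : 0 <= C -> 0 <= r < 1 ->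
  (forall k, l2norm (x_ k.+1 - x_ k) <= C * r ^+ k) ->
  exists x, forall k, l2norm (x - x_ k) <= C / (1 - r) * r ^+ k.
Proof.
move=> C0 /[dup] r01 /andP[r0 r1] h.
have hj k j : l2norm (x_ (k + j)%N - x_ k) <= C / (1 - r) * (r ^+ k - r ^+ (k + j)).
  elim: j => [|j ih]; first by rewrite addn0 !subrr mulr0 l2norm0.
  have -> : x_ (k + j.+1)%N - x_ k = (x_ (k + j).+1 - x_ (k + j)%N) + (x_ (k + j)%N - x_ k).
    by rewrite addnS addrA subrK.
  apply: (le_trans (l2normD _ _)); apply: (le_trans (lerD (h _) ih)).
  rewrite addnS exprS le_eqVlt; apply/orP; left; apply/eqP; field; lra.
have {}hj k l : (k <= l)%N -> l2norm (x_ l - x_ k) <= C / (1 - r) * r ^+ k.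
  move=> kl; rewrite -(subnKC kl); apply: (le_trans (hj _ _)).
  by rewrite ler_wpM2l ?divr_ge0 ?subr_ge0 ?(ltW r1)// gerBl exprn_ge0.
have hc (x : l2 R) n : `|Re (x n)| <= l2norm x /\ `|Im (x n)| <= l2norm x.
  have := ip_coord x n; rewrite -l2normE /dotc -!expr2 => hx.
  split; rewrite -ler_sqr ?nnegrE ?l2norm_ge0// real_normK ?num_real//.
    by apply: le_trans hx; rewrite lerDl sqr_ge0.
  by apply: le_trans hx; rewrite lerDr sqr_ge0.
have cRe n : cvgn (fun k => Re (x_ k n)).
  apply: (@geometric_cauchy_cvg _ C r) => // k; apply: le_trans (h k).
  by rewrite -ReB; exact: (hc (_ - _) n).1.
have cIm n : cvgn (fun k => Im (x_ k n)).
  apply: (@geometric_cauchy_cvg _ C r) => // k; apply: le_trans (h k).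
  by rewrite -ImB; exact: (hc (_ - _) n).2.
pose a n : R[i] := limn (fun k => Re (x_ k n)) +i* limn (fun k => Im (x_ k n)).
have bnd k N : \sum_(0 <= n < N) dotc (a n - x_ k n) (a n - x_ k n) <= (C / (1 - r) * r ^+ k) ^+ 2.
  pose f (l : nat) : R := \sum_(0 <= n < N) dotc (x_ l n - x_ k n) (x_ l n - x_ k n).
  have hf : f @ \oo --> \sum_(0 <= n < N) dotc (a n - x_ k n) (a n - x_ k n).
    apply: (@cvg_sumr R nat \oo _ nat (index_iota 0 N)
      (fun n l => dotc (x_ l n - x_ k n) (x_ l n - x_ k n))
      (fun n => dotc (a n - x_ k n) (a n - x_ k n))) => n.
    rewrite /dotc !(ReB, ImB)/=; under eq_fun do rewrite !(ReB, ImB)/=.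
    have hR : (fun l => Re (x_ l n) - Re (x_ k n)) @ \oo --> Re (a n) - Re (x_ k n).
      by apply: cvgB; [exact: cRe|exact: cvg_cst].
    have hI : (fun l => Im (x_ l n) - Im (x_ k n)) @ \oo --> Im (a n) - Im (x_ k n).
      by apply: cvgB; [exact: cIm|exact: cvg_cst].
    exact: cvgD (cvgM hR hR) (cvgM hI hI).
  apply: (cvgr_to_le hf).
  near=> l; have kl : (k <= l)%N by near: l; exact: nbhs_infty_ge.
  apply: le_trans (ip_ge_partial (x_ l - x_ k) N) _.
  rewrite -l2normE ler_sqr ?nnegrE ?l2norm_ge0 ?hj//.
  by apply: le_trans (hj k l kl); exact: l2norm_ge0.
(* [bnd] gives square-summability of differences only, so the limit is assembled as [x_ 0] plus a
   difference. *)
have a2 : (fun n => a n - x_ 0 n) \in @l2_pred R.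
  by apply: l2_predP; eexists => N; exact: bnd.
exists (L2 a2 + x_ 0) => k.
apply: l2norm_le.
  by apply: le_trans (hj k k (leqnn k)); exact: l2norm_ge0.
apply: ip_le => N; apply: le_trans (bnd k N).
rewrite le_eqVlt; apply/orP; left; apply/eqP; apply: eq_bigr => n _.
rewrite -[l2val _ n]/(a n - x_ 0 n + x_ 0 n - x_ k n).
by rewrite subrK.
Unshelve. all: by end_near. Qed.

End l2_trunc.

Lemma geometric_le0 (R : realType) (a C r : R) : 0 <= r < 1 -> (forall k, a <= C * r ^+ k) -> a <= 0.
Proof.
move=> /andP[r0 r1] h.
have : geometric C r @ \oo --> (0 : R) by apply: cvg_geometric; rewrite ger0_norm.
by move=> /cvgr_to_ge; apply; exact: nearW.
Qed.

(** The dimension count behind the bounds on kernel and cokernel, and behind the choice of a vector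
    orthogonal to fewer than [J] others. *)
Lemma left_kernel (F : fieldType) (k N : nat) (A : 'M[F]_(k, N)) : (N < k)%N ->
  exists2 c : 'rV[F]_k, c != 0 & c *m A = 0.
Proof.
move=> Nk; have : kermx A != 0.
  by rewrite -mxrank_eq0 mxrank_ker subn_eq0 -ltnNge (leq_ltn_trans (rank_leq_col A)).
move=> /rowV0Pn[c /sub_kermxP cA c0]; by exists c.
Qed.

Lemma normc_ge0 (R : realType) (c : R[i]) : 0 <= Normc.normc c.
Proof. by case: c => a b; exact: sqrtr_ge0. Qed.

Lemma normc_sum (R : realType) I (r : seq I) (f : I -> R[i]) :
  Normc.normc (\sum_(i <- r) f i) <= \sum_(i <- r) Normc.normc (f i).
Proof.
elim/big_rec2 : _ => [|i u v _ h]; first by rewrite Normc.normc0.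
by apply: (le_trans (le_normcD _ _)); rewrite lerD2l.
Qed.

Lemma l2norm_sum (R : realType) I (r : seq I) (f : I -> l2 R) :
  l2norm (\sum_(i <- r) f i) <= \sum_(i <- r) l2norm (f i).
Proof.
elim/big_rec2 : _ => [|i u v _ h]; first by rewrite l2norm0.
by apply: (le_trans (l2normD _ _)); rewrite lerD2l.
Qed.

Section trunc_linear.
Variable R : realType.
Implicit Types (x y : l2 R).

Lemma truncateD N x y : truncate N (x + y) = truncate N x + truncate N y.
Proof. exact: truncate_funD. Qed.

Lemma truncateZ N (c : R[i]) x : truncate N (c *: x) = c *: truncate N x.
Proof. exact: truncate_funZ. Qed.

Lemma truncateN N x : truncate N (- x) = - truncate N x.
Proof. by rewrite -scaleN1r truncateZ scaleN1r. Qed.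

Lemma truncateB N x y : truncate N (x - y) = truncate N x - truncate N y.
Proof. by rewrite truncateD truncateN. Qed.

Lemma truncate0 N : truncate N (0 : l2 R) = 0.
Proof. by rewrite -[X in truncate N (l2val X)](scale0r 0) truncateZ scale0r. Qed.

Definition unitv (i : nat) : l2 R := truncate i.+1 (fun n => (n == i)%:R).

Lemma unitvE i n : unitv i n = (n == i)%:R.
Proof. by rewrite /unitv truncateE ltnS; case: eqP => [->|_]; rewrite ?leqnn ?if_same. Qed.

Lemma l2_sumE I (r : seq I) (f : I -> l2 R) n : (\sum_(i <- r) f i) n = \sum_(i <- r) f i n.
Proof. by elim/big_rec2 : _ => // i u v _ <-. Qed.

Lemma truncate_unitv N x : truncate N x = \sum_(i < N) x i *: unitv i.
Proof.
apply: l2_ext => n; rewrite l2_sumE truncateE; case: ltnP => nN.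
  rewrite (bigD1 (Ordinal nN))//= big1 ?addr0.
    by rewrite -[RHS]/(x n * unitv n n) unitvE eqxx mulr1.
  move=> i /eqP ni; rewrite -[LHS]/(x i * unitv i n) unitvE.
  case: eqP => [ein|]; last by rewrite mulr0.
  by case: ni; apply: val_inj; rewrite /= ein.
rewrite big1// => i _; rewrite -[LHS]/(x i * unitv i n) unitvE gtn_eqF ?mulr0//.
exact: leq_trans nN.
Qed.

End trunc_linear.

(** * Operators that are negative definite on a coordinate subspace of finite codimension *)

Section coercive.
Variables (R : realType) (T : {linear l2 R -> l2 R}) (M c : R) (N : nat).
Implicit Types (x y w d : l2 R).
Hypothesis TM : forall x, l2norm (T x) <= M * l2norm x.
Hypothesis c0 : 0 < c.
Hypothesis Tc : forall w, truncate N w = 0 -> ip (T w) w <= - c * ip w w.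

(** Projection onto the coordinates of index at least [N], the coercive block. *)
Let Q (x : l2 R) := x - truncate N x.

Let QB x y : Q (x - y) = Q x - Q y.
Proof. by rewrite /Q truncateB !opprB [LHS]addrACA [RHS]addrACA; congr (_ + _); rewrite addrC. Qed.

Let QZ a x : Q (a *: x) = a *: Q x.
Proof. by rewrite /Q truncateZ scalerBr. Qed.

Let QD x y : Q (x + y) = Q x + Q y.
Proof. by rewrite /Q truncateD opprD addrACA. Qed.

Let finQ x : truncate N (Q x) = 0.
Proof. by rewrite truncateB truncateK subrr. Qed.

Let ipQ x w : truncate N w = 0 -> ip (Q x) w = ip x w.
Proof. by move=> w0; rewrite /Q ipDl ipNl ip_truncateC w0 ip0r subr0. Qed.

Let coercive_inj w : truncate N w = 0 -> Q (T w) = 0 -> w = 0.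
Proof.
move=> w0 qw; apply: ip_eq0; apply/eqP; rewrite eq_le ip_ge0 andbT.
have := Tc w0; rewrite -ipQ// qw ip0l mulNr oppr_ge0.
by rewrite pmulr_rle0.
Qed.

(** Enlarging the norm bound makes it positive and greater than [c], so that [c / K] lies strictly
    between 0 and 1. *)
Let K := Num.max `|M| c + 1.
Let K0 : 0 < K. Proof. by rewrite /K ltr_wpDl// le_max normr_ge0. Qed.
Let cK : c < K. Proof. by rewrite /K ltr_pwDr// le_max lexx orbT. Qed.
Let TK x : l2norm (T x) <= K * l2norm x.
Proof.
apply: (le_trans (TM x)); rewrite ler_wpM2r ?l2norm_ge0//.
apply: (le_trans (ler_norm _)); rewrite /K.
by rewrite (@le_trans _ _ (Num.max `|M| c))// ?le_max ?lexx// lerDl.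
Qed.

(** This step minimises 1 - 2 tau c + tau^2 K^2, which bounds the squared contraction factor; the
    minimum is [r ^+ 2]. *)
Let tau := c / K ^+ 2.
Let r := Num.sqrt (1 - (c / K) ^+ 2).

Let cK1 : 0 < (c / K) ^+ 2 < 1.
Proof.
have h : 0 < c / K < 1 by rewrite divr_gt0//= ltr_pdivrMr// mul1r.
by case/andP: h => h1 h2; rewrite exprn_gt0//= expr_lt1 // ltW.
Qed.

Let r01 : 0 <= r < 1.
Proof.
rewrite /r sqrtr_ge0 /= -[ltRHS]sqrtr1 ltr_sqrt//.
by case/andP: cK1 => h1 h2; rewrite ltrBlDr ltrDl.
Qed.

Let r2 : r ^+ 2 = 1 - (c / K) ^+ 2.
Proof. by rewrite /r sqr_sqrtr// subr_ge0; case/andP: cK1 => _ /ltW. Qed.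

Let contract d : truncate N d = 0 -> l2norm (d + tau%:C *: Q (T d)) <= r * l2norm d.
Proof.
move=> d0; apply: l2norm_le; first by rewrite mulr_ge0 ?l2norm_ge0//; case/andP: r01.
have h1 := Tc d0; have hq := ipQ (T d) d0.
have h2 : ip (Q (T d)) (Q (T d)) <= K ^+ 2 * ip d d.
  rewrite -!l2normE -exprMn ler_sqr ?nnegrE ?mulr_ge0 ?l2norm_ge0 ?(ltW K0)//.
  exact: le_trans (l2norm_tail _ _) (TK _).
rewrite exprMn r2 l2normE; move: (Q (T d)) hq h2 => q hq h2.
rewrite !(ipDl, ipDr, ipZl, ipZr) (ipC d q) hq.
have t0 : 0 < tau by rewrite divr_gt0// exprn_gt0.
have h3 : tau * ip (T d) d <= tau * (- c * ip d d) by rewrite ler_wpM2l// ltW.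
have h4 : tau * (tau * ip q q) <= tau * (tau * (K ^+ 2 * ip d d)).
  by do 2!(rewrite ler_wpM2l//; try exact: ltW).
have e1 : (1 - (c / K) ^+ 2) * ip d d = ip d d + 2 * (tau * (- c * ip d d)) + tau * (tau * (K ^+ 2 * ip d d)).
  by rewrite /tau; have K1 := lt0r_neq0 K0; move: K K1 => k K1; field.
rewrite e1; lra.
Qed.

(* Fixed-point iteration w <- w + tau Q (T w - y), a contraction by coercivity. *)
Lemma lax_milgram y : exists2 w : l2 R, truncate N w = 0 & Q (T w) = Q y.
Proof.
pose w_ := fix w_ k : l2 R := if k is k'.+1 then w_ k' + tau%:C *: Q (T (w_ k') - y) else 0.
have tau0 : tau%:C != 0 :> R[i].
  rewrite eq_complex/= eqxx andbT; apply: lt0r_neq0; rewrite divr_gt0// exprn_gt0//.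
have wS k : w_ k.+1 = w_ k + tau%:C *: Q (T (w_ k) - y) by [].
have wW k : truncate N (w_ k) = 0.
  elim: k => [|k ih]; first exact: truncate0.
  by rewrite wS truncateD ih truncateZ finQ scaler0 addr0.
pose d k := w_ k.+1 - w_ k.
have dE k : d k = tau%:C *: Q (T (w_ k) - y) by rewrite /d wS addrC addKr.
have dW k : truncate N (d k) = 0 by rewrite dE truncateZ finQ scaler0.
have dS k : d k.+1 = d k + tau%:C *: Q (T (d k)).
  have e : w_ k.+1 = w_ k + d k by rewrite /d addrCA subrr addr0.
  by rewrite [LHS]dE [X in _ = X + _]dE -scalerDr -QD e (linearD T) addrAC.
have dr k : l2norm (d k) <= l2norm (d 0) * r ^+ k.
  elim: k => [|k ih]; first by rewrite expr0 mulr1.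
  rewrite dS; apply: (le_trans (contract (dW k))).
  rewrite exprS mulrCA ler_wpM2l//; by case/andP: r01.
have [w hw] := l2_complete (l2norm_ge0 (d 0)) r01 dr.
have w0 : truncate N w = 0.
  apply: l2norm_eq0; apply/eqP; rewrite eq_le l2norm_ge0 andbT.
  apply: (geometric_le0 r01) => k; apply: le_trans (hw k).
  by rewrite -[truncate N w](subr0) -(wW k) -truncateB l2norm_truncate.
exists w => //; apply/eqP; rewrite -subr_eq0 -QB; apply/eqP.
apply: l2norm_eq0; apply/eqP; rewrite eq_le l2norm_ge0 andbT.
pose C := K * (l2norm (d 0) / (1 - r)) + Normc.normc (tau%:C^-1) * l2norm (d 0).
apply: (@geometric_le0 _ _ C _ r01) => k.
(* The projected residual at the limit is the image of the error of [w_ k] plus the rescaled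
   increment [d k]; both decay like r^k. *)
have -> : Q (T w - y) = Q (T (w - w_ k)) + tau%:C^-1 *: d k.
  rewrite dE scalerA mulVf// scale1r linearB/= !QB addrA subrK//.
rewrite /C mulrDl; apply: (le_trans (l2normD _ _)); apply: lerD.
  apply: (le_trans (l2norm_tail _ _)); apply: (le_trans (TK _)).
  by rewrite -mulrA ler_wpM2l ?(ltW K0).
by rewrite l2normZ -mulrA ler_wpM2l ?normc_ge0.
Qed.

Definition block_sol y : l2 R := s2val (cid2 (lax_milgram y)).

Lemma block_sol_supp y : truncate N (block_sol y) = 0.
Proof. by rewrite /block_sol; case: cid2. Qed.

Lemma block_sol_eq y : T (block_sol y) - truncate N (T (block_sol y)) = y - truncate N y.
Proof. by rewrite /block_sol; case: cid2. Qed.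

(** Uniqueness, which comes from coercivity, turns the choice made in [block_sol] into a linear
    map. *)
Lemma block_sol_unique y w : truncate N w = 0 -> T w - truncate N (T w) = y - truncate N y -> block_sol y = w.
Proof.
move=> w0 wy; apply/eqP; rewrite -subr_eq0; apply/eqP; apply: coercive_inj.
  by rewrite truncateB block_sol_supp w0 subrr.
by rewrite linearB QB; apply/eqP; rewrite subr_eq0 /Q wy; apply/eqP/block_sol_eq.
Qed.

Lemma block_solP a x y : block_sol (a *: x + y) = a *: block_sol x + block_sol y.
Proof.
apply: block_sol_unique; first by rewrite truncateD truncateZ !block_sol_supp scaler0 addr0.
change (Q (T (a *: block_sol x + block_sol y)) = Q (a *: x + y)).
by rewrite linearP !QD !QZ; congr (_ *: _ + _); exact: block_sol_eq.
Qed.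

(** Testing the block equation against its solution w gives c |w|^2 <= - ip y w <= |y| |w|. *)
Lemma block_sol_norm y : l2norm (block_sol y) <= c^-1 * l2norm y.
Proof.
have [->|s0] := eqVneq (l2norm (block_sol y)) 0.
  by rewrite mulr_ge0 ?l2norm_ge0// invr_ge0 ltW.
have {}s0 : 0 < l2norm (block_sol y) by rewrite lt_neqAle eq_sym s0 l2norm_ge0.
rewrite ler_pdivlMl// -(ler_pM2r s0).
have := Tc (block_sol_supp y); rewrite -(ipQ _ (block_sol_supp y)) /Q block_sol_eq (ipQ _ (block_sol_supp y)) -l2normE.
have := ip_le_norm y (block_sol y); rewrite ler_norml => /andP[h _].
by move=> h2; rewrite -mulrA -expr2; lra.
Qed.

(** Once the coercive block is solved, the defect lives on the coordinates below [N]; this row is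
    the whole obstruction to [y] being the image of a vector supported on the block. *)
Definition block_residue y : 'rV[R[i]]_N := \row_j (y - T (block_sol y)) j.

Lemma block_residueP a x y : block_residue (a *: x + y) = a *: block_residue x + block_residue y.
Proof.
apply/rowP => j; rewrite !mxE block_solP linearP opprD addrACA -scalerBr.
by [].
Qed.

Lemma block_residue_sum I (s : seq I) (a : I -> R[i]) (f : I -> l2 R) :
  block_residue (\sum_(i <- s) a i *: f i) = \sum_(i <- s) a i *: block_residue (f i).
Proof.
elim: s => [|i s ih]; last by rewrite !big_cons block_residueP ih.
rewrite !big_nil; have := block_residueP (-1) 0 0.
by rewrite scaler0 addr0 scaleN1r addNr.
Qed.

Lemma block_residue_eq0 y : block_residue y = 0 -> y = T (block_sol y).
Proof.
move=> y0; apply/eqP; rewrite -subr_eq0; apply/eqP.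
rewrite -[LHS](subrK (truncate N (y - T (block_sol y)))) -/(Q _) QB /Q block_sol_eq subrr add0r.
apply: l2_ext => n; rewrite truncateE; case: ltnP => // nN.
by have /rowP/(_ (Ordinal nN)) := y0; rewrite !mxE.
Qed.

Lemma block_residueT w : truncate N w = 0 -> block_residue (T w) = 0.
Proof.
move=> w0; apply/rowP => j; rewrite !mxE (_ : block_sol (T w) = w) ?subrr//.
exact: block_sol_unique.
Qed.

Lemma block_residue_coord_le y j : Normc.normc (block_residue y 0 j) <= (1 + K / c) * l2norm y.
Proof.
rewrite mxE; set z := y - _.
have : Normc.normc (z j) <= l2norm z.
  by rewrite -ler_sqr ?nnegrE ?normc_ge0 ?l2norm_ge0// dotccE l2normE ip_coord.
move/le_trans; apply; apply: (le_trans (l2normD _ _)); rewrite l2normN mulrDl mul1r lerD2l.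
by apply: (le_trans (TK _)); rewrite -mulrA ler_wpM2l ?(ltW K0)// block_sol_norm.
Qed.

(* The Schur complement of the coercive block of T.  The vector y lies in the
   range of T iff block_residue y lies in the row space of this finite matrix,
   so the Fredholm property of T reduces to linear algebra in dimension N. *)
Definition schur : 'M[R[i]]_N := \matrix_(i < N) block_residue (T (unitv R i)).

Lemma block_residue_comb (p : 'rV[R[i]]_N) : block_residue (T (\sum_i p 0 i *: unitv R i)) = p *m schur.
Proof.
rewrite linear_sum; under eq_bigr do rewrite linearZ.
rewrite block_residue_sum mulmx_sum_row; apply: eq_bigr => i _.
by rewrite rowK.
Qed.

(** The tail of [x] leaves no residue ([block_residueT]), so only its first [N] coordinates
    enter. *)
Lemma block_residue_range x : block_residue (T x) = (\row_(i < N) x i) *m schur.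
Proof.
rewrite -block_residue_comb -[x in LHS](subrK (truncate N x)) linearD -[X in block_residue X]addr0.
have := block_residueP 1 (T (x - truncate N x)) (T (truncate N x)).
rewrite !scale1r addr0 => ->; rewrite block_residueT ?finQ// add0r truncate_unitv.
by congr (block_residue (T _)); apply: eq_bigr => i _; rewrite mxE.
Qed.

(** [pinvmx] solves the finite system for the head of a preimage, and [block_sol] then supplies the
    tail. *)
Lemma range_block_residue y : (block_residue y <= schur)%MS ->
  y = T (\sum_i (block_residue y *m pinvmx schur) 0 i *: unitv R i
        + block_sol (y - T (\sum_i (block_residue y *m pinvmx schur) 0 i *: unitv R i))).
Proof.
move=> h; set b := \sum_i _; rewrite linearD -[LHS](subrK (T b)) addrC; congr (_ + _).
apply: block_residue_eq0; have := block_residueP (-1) (T b) y.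
by rewrite !scaleN1r addrC => ->; rewrite block_residue_comb mulmxKpV// addNr.
Qed.

(** In the preimage of [range_block_residue] the head depends on finitely many bounded functionals
    of [T x], and the tail is controlled by [block_sol_norm]. This takes the place of the open
    mapping theorem: [T] is bounded below modulo its kernel. *)
Lemma bounded_preimage : exists2 C, 0 <= C & forall x, exists2 x', T x' = T x & l2norm x' <= C * l2norm (T x).
Proof.
pose g (j : 'I_N) : l2 R := \sum_i (pinvmx schur) j i *: unitv R i.
pose G := \sum_j l2norm (g j).
have G0 : 0 <= G by apply: sumr_ge0 => j _; exact: l2norm_ge0.
pose C1 := (1 + K / c) * G.
have C10 : 0 <= C1 by rewrite mulr_ge0// addr_ge0// divr_ge0 ?ltW.
exists (C1 + c^-1 * (1 + K * C1)) => [|x].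
  by rewrite addr_ge0// mulr_ge0 ?invr_ge0 ?(ltW c0)// addr_ge0// mulr_ge0// ltW.
have := @range_block_residue (T x); rewrite block_residue_range => /(_ (submxMl _ _)).
rewrite -block_residue_range; set b := \sum_i _ => e.
exists (b + block_sol (T x - T b)); first by [].
have bE : b = \sum_j block_residue (T x) 0 j *: g j.
  rewrite /b /g; under [RHS]eq_bigr do rewrite scaler_sumr.
  rewrite exchange_big; apply: eq_bigr => i _; rewrite mxE scaler_suml.
  by apply: eq_bigr => j _; rewrite scalerA.
have bn : l2norm b <= C1 * l2norm (T x).
  rewrite bE; apply: (le_trans (l2norm_sum _ _)); rewrite /C1 mulrAC mulr_sumr.
  by apply: ler_sum => j _; rewrite l2normZ ler_wpM2r ?l2norm_ge0// block_residue_coord_le.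
apply: (le_trans (l2normD _ _)); rewrite mulrDl; apply: lerD => //.
apply: (le_trans (block_sol_norm _)); rewrite -mulrA ler_wpM2l ?invr_ge0 ?(ltW c0)//.
apply: (le_trans (l2normD _ _)); rewrite l2normN mulrDl mul1r lerD2l.
by apply: (le_trans (TK _)); rewrite -mulrA ler_wpM2l ?(ltW K0).
Qed.

(** The range is the common zero set of finitely many bounded functionals, the entries of
    [block_residue z *m cokermx schur]. *)
Lemma coercive_closed_range : l2_closed (range T).
Proof.
move=> y hy; suff h : (block_residue y <= schur)%MS by eexists; [|exact: (esym (range_block_residue h))].
rewrite submxE; apply/eqP/rowP => j; rewrite [RHS]mxE.
pose k (z : l2 R) : R[i] := (block_residue z *m cokermx schur) 0 j.
rewrite -/(k y); apply: Normc.eq0_normc; apply/eqP; rewrite eq_le normc_ge0 andbT.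
pose C := \sum_i (1 + K / c) * Normc.normc (cokermx schur i j).
have C0 : 0 <= C.
  by apply: sumr_ge0 => i _; rewrite mulr_ge0 ?normc_ge0// addr_ge0// divr_ge0 ?ltW.
have kn z : Normc.normc (k z) <= C * l2norm z.
  rewrite /k mxE; apply: (le_trans (normc_sum _ _)); rewrite mulr_suml.
  apply: ler_sum => i _; rewrite Normc.normcM mulrAC ler_wpM2r ?normc_ge0//.
  exact: block_residue_coord_le.
rewrite leNgt; apply/negP => ky0.
have [|x [x' _ <-]] := hy (Normc.normc (k y) / (C + 1)); first by rewrite divr_gt0// ltr_wpDl.
rewrite ltr_pdivlMr ?ltr_wpDl// => hx.
have e : k (T x' - y) = - k y.
  have := block_residueP (-1) y (T x'); rewrite !scaleN1r (addrC (- y)) /k => ->.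
  have e0 : block_residue (T x') *m cokermx schur = 0.
    by rewrite block_residue_range -mulmxA mulmx_coker mulmx0.
  by rewrite mulmxDl e0 addr0 mulNmx mxE.
have := kn (T x' - y); rewrite e normcN leNgt => /negP; apply.
by apply: le_lt_trans hx; rewrite mulrC ler_wpM2l ?l2norm_ge0// lerDl.
Qed.

(** Among more than [N] kernel vectors some nontrivial combination vanishes below [N], and [T] is
    injective on such vectors. *)
Lemma coercive_kernel : (edim (Defs.kernel T) < +oo)%E.
Proof.
apply: (@le_lt_trans _ _ N%:R%:E); last exact: ltry.
apply: ub_ereal_sup => _ [k [v vK vfree] <-]; rewrite lee_fin ler_nat leqNgt.
apply/negP => Nk; have [a a0 aA] := left_kernel (\matrix_(i < k, j < N) (v i j)) Nk.
case/eqP: a0; apply/rowP => i; rewrite mxE; apply: (vfree (fun i => a 0 i)).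
rewrite /=; set z := \sum_i _.
have Tz : T z = 0.
  rewrite linear_sum big1// => j _; rewrite linearZ.
  by move: (vK j); rewrite /Defs.kernel/= => ->; rewrite scaler0.
have z0 : truncate N z = 0.
  apply: l2_ext => n; rewrite truncateE; case: ltnP => // nN.
  have /rowP/(_ (Ordinal nN)) := aA; rewrite mxE [RHS]mxE => e; apply: etrans e.
  by rewrite l2_sumE; apply: eq_bigr => j _; rewrite mxE.
by apply: coercive_inj => //; rewrite Tz /Q truncate0 subrr.
Qed.

(** Among more than [N] vectors some nontrivial combination has zero residue, hence lies in the
    range. *)
Lemma coercive_cokernel : (ecodim (range T) < +oo)%E.
Proof.
apply: (@le_lt_trans _ _ N%:R%:E); last exact: ltry.
apply: ub_ereal_sup => _ [k [v vfree] <-]; rewrite lee_fin ler_nat leqNgt.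
apply/negP => Nk; have [a a0 aA] := left_kernel (\matrix_(i < k) block_residue (v i)) Nk.
case/eqP: a0; apply/rowP => i; rewrite mxE; apply: (vfree (fun i => a 0 i)).
have : block_residue (\sum_i a 0 i *: v i) = 0.
  rewrite block_residue_sum -[RHS]aA mulmx_sum_row; apply: eq_bigr => j _.
  by rewrite rowK.
by move/block_residue_eq0 => ->; exists (block_sol (\sum_i a 0 i *: v i)).
Qed.

Lemma coercive_fredholm : fredholm T.
Proof.
by split; [exact: coercive_kernel|exact: coercive_closed_range|exact: coercive_cokernel].
Qed.

End coercive.

Lemma sum_count_undup (T : eqType) (s : seq T) : (\sum_(x <- undup s) count_mem x s = size s)%N.
Proof.
under eq_bigr do rewrite -sum1_count big_mkcond.
rewrite exchange_big -sum1_size /=; apply: eq_big_seq => y ys.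
rewrite -big_mkcond/= sum1_count (@eq_count _ _ (pred1 y)) => [|i]; last by rewrite /= eq_sym.
by rewrite count_uniq_mem ?undup_uniq// mem_undup ys.
Qed.

Lemma conjc_i (R : realType) : conjc (Complex 0 1 : R[i]) = - Complex 0 1.
Proof. by apply/eqP; rewrite eq_complex/= oppr0 !eqxx. Qed.

Lemma conjc_iM (R : realType) : conjc (Complex 0 1 : R[i]) * Complex 0 1 = 1.
Proof. by rewrite conjc_i mulNr -expr2 sqr_i opprK. Qed.

(** * Eigenvalues above the essential spectrum *)

Section complex_ip.
Variable R : realType.
Implicit Types x y z : l2 R.

(** The Hermitian product, linear in the first argument: the imaginary part of <x, y> is the real
    part of <x, i y>. Multiplicities are complex dimensions, so eigenvectors have to be orthogonal
    in this sense. *)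
Definition cip x y : R[i] := ip x y +i* ip x ((0 +i* 1 : R[i]) *: y).

Lemma cipD x y z : cip (x + y) z = cip x z + cip y z.
Proof. by rewrite /cip !ipDl. Qed.

Lemma cipZ (a : R[i]) x z : cip (a *: x) z = a * cip x z.
Proof.
case: a => p q; have e : p +i* q = p%:C + q%:C * (0 +i* 1) :> R[i].
  by apply/eqP; rewrite eq_complex/=; apply/andP; split; apply/eqP; ring.
rewrite e scalerDl -scalerA cipD /cip !ipZl !ipMJ scalerA.
rewrite conjc_iM conjc_i scale1r scaleNr ipNr -e; move: (ip x z) (ip x _) => u v.
by apply/eqP; rewrite eq_complex/=; apply/andP; split; apply/eqP; ring.
Qed.

Lemma cip0 z : cip 0 z = 0.
Proof. by rewrite /cip !ip0l. Qed.

Lemma cipN x z : cip (- x) z = - cip x z.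
Proof. by rewrite -scaleN1r cipZ mulN1r. Qed.

Lemma cip_sum I (r : seq I) (f : I -> l2 R) z :
  cip (\sum_(i <- r) f i) z = \sum_(i <- r) cip (f i) z.
Proof. by elim/big_rec2 : _ => [|i u v _ <-]; rewrite ?cip0 ?cipD. Qed.

Lemma cipC x y : cip y x = conjc (cip x y).
Proof.
have e : ip y (Complex 0 1 *: x) = - ip x (Complex 0 1 *: y).
  by rewrite ipC ipMJ conjc_i scaleNr ipNr.
by rewrite /cip /conjc e (ipC y x).
Qed.

Lemma cip_eq0C x y : cip x y = 0 -> cip y x = 0.
Proof. by move=> h; rewrite cipC h conjc0. Qed.

Lemma cip_ip x y : cip x y = 0 -> ip x y = 0.
Proof. by case. Qed.

Lemma cipxx x : cip x x = (ip x x)%:C.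
Proof.
rewrite /cip; congr (_ +i* _).
have : ip x (Complex 0 1 *: x) = - ip x (Complex 0 1 *: x).
  by rewrite {1}ipC ipMJ conjc_i scaleNr ipNr.
lra.
Qed.

End complex_ip.

Section shift.
Variables (R : realType) (A : {linear l2 R -> l2 R}) (mu : R).

Lemma shift_op_is_linear : linear (shift_op A mu).
Proof.
move=> a x y; rewrite /shift_op linearP scalerDr scalerBr opprD addrACA.
by rewrite !scalerA (mulrC a).
Qed.
HB.instance Definition _ := GRing.isLinear.Build R[i] (l2 R) (l2 R) _ (shift_op A mu)
  shift_op_is_linear.

Lemma shift_op_norm (M : R) : (forall x, l2norm (A x) <= M * l2norm x) ->
  forall x, l2norm (shift_op A mu x) <= (M + `|mu|) * l2norm x.
Proof.
move=> AM x; apply: (le_trans (l2normD _ _)); rewrite l2normN mulrDl lerD// l2normZ.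
by rewrite /= expr0n addr0 sqrtr_sqr.
Qed.

Lemma shift_op_form x : ip (shift_op A mu x) x = ip (A x) x - mu * ip x x.
Proof. by rewrite ipDl ipNl ipZl. Qed.

End shift.

Section spectral.
Variables (R : realType) (A : {linear l2 R -> l2 R}) (M l : R) (N : nat).
Hypothesis AM : forall x, l2norm (A x) <= M * l2norm x.
Hypothesis Al : forall w : l2 R, truncate N w = 0 -> ip (A w) w <= l * ip w w.

Let shift_coercive mu : l < mu -> forall w : l2 R, truncate N w = 0 ->
  ip (shift_op A mu w) w <= - (mu - l) * ip w w.
Proof. by move=> lmu w w0; rewrite shift_op_form opprB mulrBl lerD2r Al. Qed.

Lemma ess_spectrum_le mu : ess_spectrum A mu -> mu <= l.
Proof.
move=> h; rewrite leNgt; apply/negP => lmu; apply: h.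
apply: (@coercive_fredholm _ (shift_op A mu) _ _ N (shift_op_norm mu AM)); last exact: shift_coercive.
by rewrite subr_gt0.
Qed.

Hypothesis Asym : forall x y, ip (A x) y = ip x (A y).
Variable lam : R.
Hypothesis llam : l < lam.

Let cipA x y : cip (A x) y = cip x (A y).
Proof. by rewrite /cip !Asym linearZ. Qed.

Definition eigenfamily k (v : nat -> l2 R) (mu : nat -> R) := forall i, (i < k)%N ->
  [/\ ip (v i) (v i) = 1, A (v i) = (mu i)%:C *: v i, lam < mu i &
   forall j, (j < k)%N -> j != i -> cip (v i) (v j) = 0].

(* Let m be the supremum of the form of A on unit vectors x orthogonal to the
   v j.  If m were not an eigenvalue there, bounded_preimage would give
   |x|^2 <= C^2 |(A - m) x|^2, while Cauchy-Schwarz for the form of m - A gives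
   |(A - m) x|^2 <= K (m |x|^2 - ip (A x) x), which is arbitrarily small. *)
Lemma eigenfamily_extend k v mu J : eigenfamily k v mu -> (k < J)%N ->
  (forall x : l2 R, truncate J x = x -> x != 0 -> lam * ip x x < ip (A x) x) ->
  exists w m, [/\ ip w w = 1, A w = m%:C *: w, lam < m &
    forall j, (j < k)%N -> cip w (v j) = 0].
Proof.
move=> vmu kJ hJ.
pose H (x : l2 R) := forall i, (i < k)%N -> cip x (v i) = 0.
have HZD (a : R[i]) x y : H x -> H y -> H (a *: x + y).
  by move=> Hx Hy i ik; rewrite cipD cipZ Hx// Hy// mulr0 addr0.
have HA x : H x -> H (A x).
  move=> Hx i ik; have [_ Av _ _] := vmu i ik.
  by rewrite cipA Av; apply: cip_eq0C; rewrite cipZ (cip_eq0C (Hx i ik)) mulr0.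
have Hunit x : H x -> x != 0 -> H ((l2norm x)^-1%:C *: x) /\ ip ((l2norm x)^-1%:C *: x) ((l2norm x)^-1%:C *: x) = 1.
  move=> Hx x0; split.
    by rewrite -[X in H X]addr0; apply: HZD => // i _; rewrite cip0.
  rewrite ipZl ipZr -l2normE; field; apply: contra_neq x0; exact: l2norm_eq0.
(* The projection onto the span of the eigenvectors already found; [H] describes its kernel. *)
pose P (x : l2 R) : l2 R := \sum_(i < k) cip x (v i) *: v i.
have cvv i j : (i < k)%N -> (j < k)%N -> cip (v i) (v j) = (i == j)%:R.
  move=> ik jk; have [<-|ij] := eqVneq i j.
    by have [h _ _ _] := vmu i ik; rewrite cipxx h.
  by have [_ _ _ ->] := vmu i ik; rewrite 1?eq_sym.
have HP x : H (x - P x).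
  move=> i ik; rewrite cipD cipN cip_sum (bigD1 (Ordinal ik))//= cipZ cvv// eqxx mulr1.
  rewrite big1 ?addr0 ?subrr// => j ji; rewrite cipZ cvv// (_ : (j == i :> nat) = false) ?mulr0//.
  exact: negbTE.
have ipHP x y : H x -> ip x (P y) = 0.
  move=> Hx; apply/cip_ip/cip_eq0C; rewrite /P cip_sum big1// => j _.
  by rewrite cipZ (cip_eq0C (Hx _ _)) ?mulr0.
(* Fewer than [J] orthogonality conditions on the first [J] coordinates leave a nonzero vector of
   [H], and [hJ] at this vector puts [m] above [lam]. *)
have [x0 [Hx0 x00 fx0]] : exists x0, [/\ H x0, x0 != 0 & truncate J x0 = x0].
  have [a a0 aG] := left_kernel (\matrix_(i < J, j < k) cip (unitv R i) (v j)) kJ.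
  pose z : l2 R := \sum_i a 0 i *: unitv R i.
  have zi (i : 'I_J) : z i = a 0 i.
    rewrite /z l2_sumE (bigD1 i)//= big1 ?addr0.
      by rewrite -[LHS]/(a 0 i * unitv R i i) unitvE eqxx mulr1.
    move=> j ji; rewrite -[LHS]/(a 0 j * unitv R j i) unitvE.
    by rewrite (_ : (i == j :> nat) = false) ?mulr0// -[LHS]/(i == j) eq_sym (negbTE ji).
  exists z; split.
  - move=> j jk; have /rowP/(_ (Ordinal jk)) := aG; rewrite !mxE => e.
    by rewrite cip_sum -[RHS]e; apply: eq_bigr => i _; rewrite cipZ mxE.
  - apply: contra_neq a0 => z0; apply/rowP => i; rewrite -zi z0 mxE.
    by [].
  - apply: truncate_id => n Jn; rewrite /z l2_sumE big1// => i _.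
    rewrite -[LHS]/(a 0 i * unitv R i n) unitvE gtn_eqF ?mulr0//.
    exact: leq_trans (ltn_ord i) Jn.
pose S := [set ip (A x) x | x in [set x | H x /\ ip x x = 1]].
have Sub : has_ubound S.
  exists M => _ [x [_ x1] <-]; apply: (le_trans (ler_norm _)).
  apply: (le_trans (ip_le_norm _ _)).
  have -> : l2norm x = 1.
    by apply/eqP; rewrite -(@eqrXn2 _ 2) ?l2norm_ge0// l2normE x1 expr1n.
  rewrite mulr1; apply: (le_trans (AM x)).
  rewrite (_ : l2norm x = 1) ?mulr1//.
  by apply/eqP; rewrite -(@eqrXn2 _ 2) ?l2norm_ge0// l2normE x1 expr1n.
have [Hu u1] := Hunit x0 Hx0 x00.
have S0 : S !=set0 by eexists; eexists; first by split; [exact: Hu|exact: u1].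
pose m := sup S.
have lm : lam < m.
  apply: (@lt_le_trans _ _ (ip (A ((l2norm x0)^-1%:C *: x0)) ((l2norm x0)^-1%:C *: x0))).
    rewrite -[ltLHS]mulr1 -u1; apply: hJ; first by rewrite truncateZ fx0.
    by apply/eqP => e; move: u1; rewrite e ip0l => /esym/eqP; rewrite oner_eq0.
  by apply: ub_le_sup => //; eexists; first by split; [exact: Hu|exact: u1].
have Hm x : H x -> ip (A x) x <= m * ip x x.
  move=> Hx; have [->|xn0] := eqVneq x 0; first by rewrite linear0 !ip0l mulr0.
  have [Hx' x1] := Hunit x Hx xn0.
  have : ip (A ((l2norm x)^-1%:C *: x)) ((l2norm x)^-1%:C *: x) <= m.
    by apply: ub_le_sup => //; eexists; first by split; [exact: Hx'|exact: x1].
  rewrite linearZ ipZl ipZr mulrA -expr2 exprVn l2normE mulrC ler_pdivrMr// lt_neqAle ip_ge0 andbT eq_sym.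
  by apply: contra_neq xn0 => /ip_eq0.
have [[w [Hw w0 Aw]]|noev] := pselect (exists w, [/\ H w, w != 0 & A w = m%:C *: w]).
  have [Hw' w1] := Hunit w Hw w0; exists ((l2norm w)^-1%:C *: w), m; split => //.
  by rewrite linearZ/= Aw !scalerA mulrC.
exfalso; pose T : {linear l2 R -> l2 R} := shift_op A m.
have TE x : T x = A x - m%:C *: x by [].
have TN : forall x, l2norm (T x) <= (M + `|m|) * l2norm x by exact: shift_op_norm.
have Tform x : ip (T x) x = ip (A x) x - m * ip x x by exact: shift_op_form.
have lm' := lt_trans llam lm.
have [||C C0 hC] := @bounded_preimage _ T _ (m - l) N TN; [by rewrite subr_gt0|exact: shift_coercive|].
clearbody T.
have Tsym x y : ip (T x) y = ip x (T y).
  by rewrite !TE ipDl ipDr ipNl ipNr ipZl ipZr Asym.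
have HT x : H x -> H (T x).
  by move=> Hx; rewrite TE -scaleNr addrC; apply: HZD => //; exact: HA.
(* Otherwise [z - P z] would be an eigenvector in [H]. Each term of [T (P z)] vanishes because (mu i
   - m) cip z (v i) equals cip (T z) (v i), which is 0. *)
have kerP z : T z = 0 -> z = P z.
  move=> Tz; apply/eqP; rewrite -subr_eq0; apply/eqP; apply: contrapT => zP.
  apply: noev; exists (z - P z); split; [exact: HP|exact/eqP|].
  apply/eqP; rewrite -subr_eq0 -TE; apply/eqP.
  rewrite linearB Tz sub0r; apply/eqP; rewrite oppr_eq0; apply/eqP.
  rewrite linear_sum big1// => i _; rewrite linearZZ.
  have [_ Av _ _] := vmu i (ltn_ord i).
  have Tv : T (v i) = (mu i - m)%:C *: v i.
    by rewrite TE Av -scalerBl rmorphB.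
  have : cip (T z) (v i) = 0 by rewrite Tz cip0.
  have -> : cip (T z) (v i) = (mu i - m)%:C * cip z (v i).
    rewrite /cip ![ip (T z) _]Tsym linearZZ Tv scalerA mulrC -scalerA !ipZr.
    by apply/eqP; rewrite eq_complex/=; apply/andP; split; apply/eqP; ring.
  rewrite Tv => /eqP; rewrite mulf_eq0 => /orP[] /eqP ->.
    by rewrite scale0r scaler0.
  by rewrite scale0r.
pose K := M + `|m|.
have K0 : 0 <= K.
  have := TN ((l2norm x0)^-1%:C *: x0).
  have -> : l2norm ((l2norm x0)^-1%:C *: x0) = 1.
    by apply/eqP; rewrite -(@eqrXn2 _ 2) ?l2norm_ge0// l2normE u1 expr1n.
  by rewrite mulr1; apply: le_trans; exact: l2norm_ge0.
(* [x' - x] lies in the kernel, hence in the span of the [v i], which is orthogonal to [x]; so [x]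
   is no longer than [x']. *)
have hb x : H x -> ip x x <= C ^+ 2 * ip (T x) (T x).
  move=> Hx; have [x' Tx' nx'] := hC x.
  have /kerP e : T (x' - x) = 0 by rewrite linearB Tx' subrr.
  rewrite -(l2normE (T x)) -exprMn.
  apply: (@le_trans _ _ (ip x' x')); last by rewrite -l2normE ler_sqr ?nnegrE ?mulr_ge0 ?l2norm_ge0.
  have -> : x' = x + P (x' - x) by rewrite -e addrC subrK.
  rewrite ipDl !ipDr (ipC _ x) ipHP// addr0 add0r lerDl; exact: ip_ge0.
have Tneg x : H x -> ip (T x) x <= 0.
  by move=> Hx; rewrite Tform subr_le0 Hm.
(* [H] is invariant under [T], so the form of [- T] is nonnegative on all combinations of [x] and
   [T x]. *)
have hq x : H x -> ip (T x) (T x) <= K * - ip (T x) x.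
  move=> Hx; have HTx := HT _ Hx; set y := T x in HTx *.
  have /quad_disc : forall t, 0 <= - ip (T x) x * t ^+ 2 + 2 * - ip (T x) y * t + - ip (T y) y.
    move=> t; have : H (t%:C *: x + y) by exact: HZD.
    move/Tneg; rewrite linearD linearZ !(ipDl, ipDr, ipZl, ipZr) -/y (Tsym y x) -/y.
    by move=> h; rewrite -oppr_le0; congr (_ <= _): h; ring.
  rewrite -/y; have -> : (- ip y y) ^+ 2 = ip y y * ip y y by rewrite sqrrN expr2.
  have [y0|y0] := eqVneq (ip y y) 0.
    by move=> _; rewrite y0 mulr_ge0// oppr_ge0 Tneg.
  have {}y0 : 0 < ip y y by rewrite lt_neqAle eq_sym y0 ip_ge0.
  move=> h; rewrite -(ler_pM2r y0); apply: (le_trans h).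
  rewrite (mulrC K) -mulrA ler_wpM2l ?oppr_ge0 ?Tneg//.
  have := ip_le_norm (T y) y; rewrite ler_norml => /andP[h1 _].
  rewrite lerNl; apply: le_trans h1; rewrite lerN2 -l2normE expr2 mulrA.
  by rewrite ler_wpM2r ?l2norm_ge0// TN.
(* With this tolerance below the supremum the two inequalities give |x|^2 < 1 for a unit vector. *)
have e0 : 0 < (C ^+ 2 * K + 1)^-1 by rewrite invr_gt0 ltr_wpDl// mulr_ge0// sqr_ge0.
have [_ [x [Hx x1] <-]] := sup_adherent e0 (conj S0 Sub).
rewrite -/m => hx.
have := hb x Hx; rewrite x1 => h1.
have h2 : C ^+ 2 * ip (T x) (T x) <= C ^+ 2 * (K * - ip (T x) x).
  by rewrite ler_wpM2l ?sqr_ge0// hq.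
have h3 : - ip (T x) x < (C ^+ 2 * K + 1)^-1.
  rewrite Tform x1 mulr1; lra.
have D0 : 0 < C ^+ 2 * K + 1 by rewrite -invr_gt0.
have h4 : (C ^+ 2 * K + 1) * - ip (T x) x < 1 by rewrite mulrC -ltr_pdivlMr// div1r.
have := Tneg x Hx; lra.
Qed.

Lemma eigenfamily_exists J :
  (forall x : l2 R, truncate J x = x -> x != 0 -> lam * ip x x < ip (A x) x) ->
  exists v mu, eigenfamily J v mu.
Proof.
move=> hJ; suff : forall k, (k <= J)%N -> exists v mu, eigenfamily k v mu by exact.
elim=> [_|k ih kJ]; first by exists (fun=> 0), (fun=> 0).
have [v [mu vmu]] := ih (ltnW kJ).
have [w [m [w1 Aw lm wv]]] := eigenfamily_extend vmu kJ hJ.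
exists (fun i => if (i == k)%N then w else v i), (fun i => if (i == k)%N then m else mu i).
move=> i; rewrite ltnS leq_eqVlt => /predU1P[->|ik].
  rewrite eqxx; split => // j; rewrite ltnS leq_eqVlt => /predU1P[->|jk]; first by rewrite eqxx.
  by move=> _; rewrite ltn_eqF// wv.
have [v1 Av lmu vv] := vmu i ik.
rewrite ltn_eqF//; split => // j; rewrite ltnS leq_eqVlt => /predU1P[->|jk ji].
  by rewrite eqxx => _; apply: cip_eq0C; exact: wv.
by rewrite ltn_eqF// vv.
Qed.

(** [D] may be any set containing the half-line above [lam], so that one statement serves both
    counts of the theorem. *)
Lemma count_eigen_ge J (D : set R) : (forall mu, lam < mu -> D mu) ->
  (forall x : l2 R, truncate J x = x -> x != 0 -> lam * ip x x < ip (A x) x) ->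
  (J%:R%:E <= count_eigen A D)%E.
Proof.
move=> lamD /eigenfamily_exists[v [mu vmu]].
have cvv i j : (i < J)%N -> (j < J)%N -> cip (v i) (v j) = (i == j)%:R.
  move=> iJ jJ; have [<-|ij] := eqVneq i j.
    by have [h _ _ _] := vmu i iJ; rewrite cipxx h.
  by have [_ _ _ ->] := vmu i iJ; rewrite 1?eq_sym.
pose t := [seq mu i | i <- iota 0 J]; pose s := undup t.
(* Values may repeat in [t]: the indices with value [m] give that many independent vectors in its
   eigenspace, and [sum_count_undup] adds these counts up to [J]. *)
have mult m : ((count_mem m t)%:R%:E <= multiplicity A m)%E.
  apply: ereal_sup_ubound; exists (count_mem m t) => //=.
  pose f := [seq i <- iota 0 J | mu i == m].
  have sf : size f = count_mem m t by rewrite /f size_filter /t count_map.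
  have fi (i : 'I_(count_mem m t)) : nth 0%N f i \in f by rewrite mem_nth// sf.
  have fJ i : i \in f -> (i < J)%N /\ mu i = m.
    by rewrite mem_filter mem_iota add0n /= => /andP[/eqP].
  exists (fun i => v (nth 0%N f i)) => [i|a].
    have [iJ mi] := fJ _ (fi i); have [_ Av _ _] := vmu _ iJ.
    by rewrite /Defs.kernel/= /shift_op Av mi subrr.
  rewrite /= => a0 i; have [iJ _] := fJ _ (fi i).
  have := cip0 (v (nth 0%N f i)); rewrite -a0 cip_sum (bigD1 i)//= cipZ cvv// eqxx mulr1.
  rewrite big1 ?addr0// => j ji; have [jJ _] := fJ _ (fi j).
  rewrite cipZ cvv// nth_uniq ?sf// ?filter_uniq ?iota_uniq//.
  by rewrite (_ : (j == i :> nat) = false) ?mulr0//; exact: negbTE.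
apply: esum_ge; exists [set` s].
  split; first exact: finite_seq.
  move=> m ms; have /mapP[ i] : m \in t by rewrite -mem_undup.
  rewrite mem_iota add0n => /andP[_ iJ] ->.
  have [v1 Av lmu _] := vmu i iJ; split; last exact: lamD.
  exists (v i) => //.
  by apply/eqP => v0; move: v1; rewrite v0 ip0l => /esym/eqP; rewrite oner_eq0.
rewrite -fsbig_seq ?undup_uniq//.
apply: (@le_trans _ _ (\sum_(m <- s) (count_mem m t)%:R%:E)%E); last exact: lee_sum.
by rewrite sumEFin -natr_sum sum_count_undup size_map size_iota.
Qed.

End spectral.

(** * Bounded operators given by a positive matrix *)

Section kernel_form.
Variables (R : realType) (k : nat -> nat -> R[i]) (C : R).

Definition kapp N (u : nat -> R[i]) n := \sum_(m < N) k n m * u m.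
Definition kform N (u v : nat -> R[i]) : R := \sum_(n < N) dotc (kapp N u n) (v n).
Definition ksq N (u : nat -> R[i]) : R := \sum_(n < N) dotc (u n) (u n).

Hypothesis k_herm : forall n m, k m n = conjc (k n m).

Lemma dotc_suml I (r : seq I) (f : I -> R[i]) z :
  dotc (\sum_(i <- r) f i) z = \sum_(i <- r) dotc (f i) z.
Proof. by elim/big_rec2 : _ => [|i u v _ <-]; rewrite ?dotc0l ?dotcDl. Qed.

Lemma kformC N u v : kform N u v = kform N v u.
Proof.
rewrite /kform /kapp; under eq_bigr do rewrite dotc_suml.
rewrite exchange_big; apply: eq_bigr => m _; rewrite dotc_suml.
by apply: eq_bigr => n _; rewrite dotcMJ -k_herm dotcC.
Qed.

Lemma kapp_lin N (t : R) u v n :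
  kapp N (fun i => t%:C * u i + v i) n = t%:C * kapp N u n + kapp N v n.
Proof.
rewrite /kapp mulr_sumr -big_split; apply: eq_bigr => m _ /=.
by rewrite mulrDr mulrCA.
Qed.

Lemma kform_linl N (t : R) u v w :
  kform N (fun i => t%:C * u i + v i) w = t * kform N u w + kform N v w.
Proof.
rewrite /kform mulr_sumr -big_split; apply: eq_bigr => m _ /=.
by rewrite kapp_lin dotcDl dotcZl.
Qed.

Hypothesis k_ge0 : forall N u, 0 <= kform N u u.
Hypothesis k_le : forall N u, kform N u u <= C * ksq N u.

Lemma ksq_ge0 N u : 0 <= ksq N u.
Proof. by apply: sumr_ge0 => n _; exact: dotcc_ge0. Qed.

Lemma kform_CS N u v : kform N u v ^+ 2 <= kform N u u * kform N v v.
Proof.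
apply: quad_disc => t; set f := fun i => t%:C * u i + v i; have := k_ge0 N f.
rewrite {1}/f kform_linl (kformC N u f) (kformC N v f) /f !kform_linl (kformC N v u).
by congr (_ <= _); ring.
Qed.

(** For a positive form a form bound is a norm bound: Cauchy-Schwarz between u and its image v gives
    |v|^4 <= (C |u|^2) (C |v|^2). *)
Lemma kapp_sq N u : ksq N (kapp N u) <= C ^+ 2 * ksq N u.
Proof.
set s := ksq N (kapp N u); have s0 : 0 <= s by exact: ksq_ge0.
have [->|sn0] := eqVneq s 0; first by rewrite mulr_ge0 ?sqr_ge0// ksq_ge0.
have sp : 0 < s by rewrite lt_neqAle eq_sym sn0.
have : s ^+ 2 <= (C * ksq N u) * (C * s).
  apply: (le_trans (kform_CS N u (kapp N u))).
  by apply: ler_pM => //; exact: k_le.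
by rewrite expr2 mulrA ler_pM2r// (mulrAC C) -expr2.
Qed.

Let delta n := (fun m => (m == n)%:R) : nat -> R[i].

Let kapp_delta N n m : (n < N)%N -> kapp N (delta n) m = k m n.
Proof.
move=> nN; rewrite /kapp (bigD1 (Ordinal nN))//= /delta eqxx mulr1 big1 ?addr0//.
move=> i /eqP ni; case: eqP => [e|]; last by rewrite mulr0.
by case: ni; exact: val_inj.
Qed.

Let ksq_mono N M u : (N <= M)%N -> ksq N u <= ksq M u.
Proof.
move=> NM; rewrite /ksq -!(big_mkord xpredT (fun n => dotc (u n) (u n))).
rewrite [leRHS](big_cat_nat (leq0n N) NM)/= lerDl.
by apply: sumr_ge0 => i _; exact: dotcc_ge0.
Qed.

Let ksq_fin N M (c : nat -> R[i]) : ksq M (truncseq N c) <= ksq N c.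
Proof.
have e : forall P, (N <= P)%N -> ksq P (truncseq N c) = ksq N c.
  move=> P NP; rewrite -[LHS]/(\sum_(n < P) dotc (truncate N c n) (truncate N c n)).
  rewrite -ip_finite_support; last by move=> n Pn; rewrite truncate_ge// (leq_trans NP).
  rewrite ip_truncatel.
  by apply: eq_bigr => n _; rewrite truncateE ltn_ord.
rewrite -(e (maxn N M)) ?leq_maxl//; apply: ksq_mono; exact: leq_maxr.
Qed.

Let kapp_fin N M (c : nat -> R[i]) n : (N <= M)%N -> kapp M (truncseq N c) n = kapp N c n.
Proof.
move=> NM; rewrite /kapp -!(big_mkord xpredT (fun m => k n m * _ m)).
rewrite (big_cat_nat (leq0n N) NM)/= [X in _ + X]big_nat_cond [X in _ + X]big1 ?addr0.
  by apply: eq_big_nat => i /andP[_ iN]; rewrite /truncseq iN.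
by move=> i; rewrite andbT => /andP[Ni _]; rewrite /truncseq ltnNge Ni mulr0.
Qed.

(** Rectangular sections reduce to square ones by padding [c] with zeros up to [maxn N M]. *)
Lemma kapp_ksq_le N M c : ksq M (kapp N c) <= C ^+ 2 * ksq N c.
Proof.
apply: (@le_trans _ _ (ksq (maxn N M) (kapp N c))); first exact/ksq_mono/leq_maxr.
apply: (@le_trans _ _ (C ^+ 2 * ksq (maxn N M) (truncseq N c))); last first.
  by rewrite ler_wpM2l ?sqr_ge0.
apply: le_trans (kapp_sq _ _); rewrite le_eqVlt; apply/orP; left; apply/eqP.
by apply: eq_bigr => n _; rewrite kapp_fin// leq_maxl.
Qed.

Lemma kernel_col_l2 n : (fun m => k m n) \in @l2_pred R.
Proof.
apply: l2_predP; exists (C ^+ 2 * ksq n.+1 (delta n)) => M; rewrite big_mkord.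
apply: le_trans (kapp_ksq_le n.+1 M (delta n)).
by apply: ler_sum => m _; rewrite kapp_delta.
Qed.

Definition kernel_col n : l2 R := L2 (kernel_col_l2 n).

Lemma kernel_col_comb N (c : nat -> R[i]) m : (\sum_(n < N) c n *: kernel_col n) m = kapp N c m.
Proof. by rewrite l2_sumE; apply: eq_bigr => n _; rewrite mulrC. Qed.

(** Duality: the sum s is ip x y for the combination y of columns with coefficients
    [cip x (kernel_col n)], and |y|^2 <= C^2 s. *)
Lemma kernel_op_sq x N : \sum_(0 <= n < N) dotc (cip x (kernel_col n)) (cip x (kernel_col n)) <= C ^+ 2 * ip x x.
Proof.
rewrite big_mkord -/(ksq N (fun n => cip x (kernel_col n))); set c := fun n => _.
set s := ksq N c; pose y := \sum_(n < N) c n *: kernel_col n.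
have yy : ip y y <= C ^+ 2 * s.
  apply: ip_le => M; rewrite big_mkord; apply: le_trans (kapp_ksq_le N M c).
  by apply: ler_sum => m _; rewrite kernel_col_comb.
have xy : ip x y = s.
  rewrite ip_sumr; apply: eq_bigr => n _; rewrite ipC ipMJ ipC.
  have -> : ip (conjc (c n) *: x) (kernel_col n) = Re (cip (conjc (c n) *: x) (kernel_col n)) by [].
  rewrite cipZ -/(c n); case: (c n) => p q; rewrite /dotc /=; ring.
have s0 : 0 <= s by exact: ksq_ge0.
have [->|sn0] := eqVneq s 0; first by rewrite mulr_ge0 ?sqr_ge0// ip_ge0.
have sp : 0 < s by rewrite lt_neqAle eq_sym sn0.
have := ip_CS x y; rewrite xy => h.
rewrite -(ler_pM2r sp) -expr2; apply: (le_trans h).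
by rewrite mulrAC mulrC ler_wpM2r// ip_ge0.
Qed.

Lemma kernel_op_l2 x : (fun n => cip x (kernel_col n)) \in @l2_pred R.
Proof. by apply: l2_predP; eexists => N; exact: kernel_op_sq. Qed.

(* By Hermitian symmetry the n-th coordinate of the image is the inner product
   with the n-th column, which is in l2. *)
Definition kernel_op x : l2 R := L2 (kernel_op_l2 x).

Lemma kernel_op_is_linear : linear kernel_op.
Proof.
by move=> a x y; apply: l2_ext => n; rewrite -[LHS]/(cip (a *: x + y) (kernel_col n)) cipD cipZ.
Qed.
HB.instance Definition _ := GRing.isLinear.Build R[i] (l2 R) (l2 R) _ kernel_op kernel_op_is_linear.

Lemma kernel_op_bounded : bounded_op kernel_op.
Proof.
exists `|C| => x; apply: l2norm_le; first by rewrite mulr_ge0 ?l2norm_ge0.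
rewrite exprMn real_normK ?num_real// l2normE; apply: ip_le => N; exact: kernel_op_sq.
Qed.

Lemma cip_unitv i (y : l2 R) : cip (unitv R i) y = conjc (y i).
Proof.
have h (z : l2 R) : ip (unitv R i) z = Re (z i).
  rewrite /unitv ip_truncatel big_ord_recr/= big1 ?add0r => [|j _].
    by rewrite eqxx /dotc /= mul1r mul0r addr0.
  by rewrite ltn_eqF// dotc0l.
rewrite /cip !h; have -> : (Complex 0 1 *: y) i = Complex 0 1 * y i by [].
by case: (y i) => p q; rewrite /conjc /=; congr (_ +i* _); ring.
Qed.

Lemma kernel_op_finite_support (x : l2 R) N : (forall m, (N <= m)%N -> x m = 0) ->
  forall n, kernel_op x n = \sum_(m < N) k n m * x m.
Proof.
move=> x0 n; rewrite -[LHS]/(cip x (kernel_col n)) -{1}(truncate_id x0) truncate_unitv cip_sum.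
by apply: eq_bigr => m _; rewrite cipZ cip_unitv mulrC k_herm.
Qed.

End kernel_form.

(** * From finite matrix sections to the operator: symmetry and form bounds *)

Section matrix_operator.
Variables (R : realType) (k : nat -> nat -> R[i]) (A : {linear l2 R -> l2 R}) (M : R).
Hypothesis k_herm : forall n m, k m n = conjc (k n m).
Hypothesis AM : forall x, l2norm (A x) <= M * l2norm x.
Hypothesis Ak : forall (x : l2 R) (N : nat), (forall m, (N <= m)%N -> x m = 0) ->
  forall n, A x n = \sum_(m < N) k n m * x m.

Lemma ip_truncate_kform (x y : l2 R) N : truncate N x = x -> truncate N y = y ->
  ip (A x) y = kform k N x y.
Proof.
move=> xN yN; rewrite -yN -ip_truncateC ip_truncatel; apply: eq_bigr => n _.
rewrite yN (@Ak _ N)// => m Nm; by rewrite -xN truncate_ge.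
Qed.

Let eps_le0 (a b : R) : (forall e, 0 < e -> a <= b * e) -> a <= 0.
Proof.
move=> h; rewrite leNgt; apply/negP => a0.
have b1 : 0 < `|b| + 1 by rewrite ltr_wpDl.
have := h (a / (`|b| + 1) / 2); rewrite !divr_gt0// => /(_ isT).
have : b * (a / (`|b| + 1) / 2) <= (`|b| + 1) * (a / (`|b| + 1) / 2).
  by rewrite ler_wpM2r ?divr_ge0 ?(ltW a0) ?(ltW b1)// (le_trans (ler_norm _))// lerDl.
have -> : (`|b| + 1) * (a / (`|b| + 1) / 2) = a / 2 by field; exact: lt0r_neq0.
lra.
Qed.

Lemma ip_truncate_approx (x y : l2 R) N (e : R) :
  l2norm (x - truncate N x) <= e -> l2norm (y - truncate N y) <= e ->
  `|ip (A x) y - ip (A (truncate N x)) (truncate N y)| <= `|M| * (l2norm x + l2norm y) * e.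
Proof.
move=> xe ye.
have -> : ip (A x) y - ip (A (truncate N x)) (truncate N y) =
    ip (A (x - truncate N x)) y + ip (A (truncate N x)) (y - truncate N y).
  by rewrite linearB ipDl ipNl ipDr ipNr; ring.
have AM' (z : l2 R) : l2norm (A z) <= `|M| * l2norm z.
  by apply: (le_trans (AM z)); rewrite ler_wpM2r ?l2norm_ge0// ler_norm.
apply: (le_trans (ler_normD _ _)); rewrite mulrDr mulrDl addrC; apply: lerD.
  apply: (le_trans (ip_le_norm _ _)); apply: ler_pM; rewrite ?l2norm_ge0//.
  by apply: (le_trans (AM' _)); rewrite ler_wpM2l// l2norm_truncate.
apply: (le_trans (ip_le_norm _ _)); rewrite mulrAC ler_wpM2r ?l2norm_ge0//.
by apply: (le_trans (AM' _)); rewrite ler_wpM2l.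
Qed.

Lemma truncate_cvg2 (x y : l2 R) (e : R) : 0 < e ->
  exists N, l2norm (x - truncate N x) <= e /\ l2norm (y - truncate N y) <= e.
Proof.
move=> e0; have [N1 h1] := truncate_cvg x e0; have [N2 h2] := truncate_cvg y e0.
by exists (maxn N1 N2); split; [apply: h1; exact: leq_maxl|apply: h2; exact: leq_maxr].
Qed.

Lemma matrix_op_sym x y : ip (A x) y = ip x (A y).
Proof.
apply/eqP; rewrite -subr_eq0 -normr_le0; apply/eps_le0 => e e0.
have [N [xe ye]] := truncate_cvg2 x y e0.
have h1 := ip_truncate_approx xe ye; have h2 := ip_truncate_approx ye xe.
have e1 : ip (A (truncate N x)) (truncate N y) = ip (A (truncate N y)) (truncate N x).
  by rewrite !(@ip_truncate_kform _ _ N) ?truncateK// kformC.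
rewrite (ipC x) (_ : ip (A x) y - ip (A y) x =
  (ip (A x) y - ip (A (truncate N x)) (truncate N y)) - (ip (A y) x - ip (A (truncate N y)) (truncate N x))); last first.
  by rewrite e1; ring.
apply: (le_trans (ler_normB _ _)); apply: (le_trans (lerD h1 h2)).
by rewrite (addrC (l2norm y)) -mulrDl.
Qed.

Lemma matrix_op_form_le (l : R) N0 : 0 <= l ->
  (forall N u, (forall n, (n < N0)%N -> u n = 0) -> kform k N u u <= l * ksq N u) ->
  forall w : l2 R, truncate N0 w = 0 -> ip (A w) w <= l * ip w w.
Proof.
move=> l0 hk w w0; rewrite -subr_le0; apply/eps_le0 => e e0.
have [N [we _]] := truncate_cvg2 w w e0.
have := ip_truncate_approx we we; rewrite ler_norml => /andP[_]; apply: le_trans.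
rewrite lerB// (@ip_truncate_kform _ _ N) ?truncateK//.
apply: (@le_trans _ _ (l * ksq N (truncate N w))).
  apply: hk => n nN0; rewrite truncateE; case: ifP => // _.
  by have := congr1 (fun z : l2 R => z n) w0; rewrite truncateE nN0.
rewrite ler_wpM2l// (ip_decomp N w) ip_truncatel.
rewrite (_ : ksq _ _ = \sum_(n < N) dotc (w n) (truncate N w n)) ?lerDl ?ip_ge0//.
by apply: eq_bigr => n _; rewrite !truncateE ltn_ord.
Qed.

End matrix_operator.

(** * Affine change of variables and the Fourier transform of a dilation *)

Section affine_change.
Variable R : realType.
Local Notation mu := (@lebesgue_measure R).

Definition affine (c h x : R) : measurableTypeR R := c * x + h.

Lemma measurable_affine (c h : R) : measurable_fun [set: R] (affine c h).
Proof. by apply: measurable_funD => //; apply: measurable_funM. Qed.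

Definition affine_lebesgue (c h : R) (c0 : 0 < c) : {measure set (measurableTypeR R) -> \bar R}.
Proof.
exact: (mscale (NngNum (ltW c0))
  (measure_function_pushforward__canonical__measure_function_Measure mu (measurable_affine c h))).
Defined.

(** Lebesgue measure is determined by its values on half-open intervals, where the two measures are
    compared. *)
Lemma affine_lebesgueE (c h : R) (c0 : 0 < c) (A : set R) : measurable A ->
  affine_lebesgue h c0 A = mu A.
Proof.
move=> mA; apply/esym; move: A mA.
apply: (lebesgue_measure_unique (mu := affine_lebesgue h c0)) => _ [[a b]] _ <-.
change (mu `]a, b]%classic = c%:E * mu (affine c h @^-1` `]a, b]%classic))%E.
rewrite (_ : affine c h @^-1` _ = `](a - h) / c, (b - h) / c]%classic); last first.
  by apply/seteqP; split=> x /=; rewrite /affine !in_itv/= ltr_pdivrMr// ler_pdivlMr// mulrC ltrBlDr lerBrDr.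
rewrite !lebesgue_measure_itv/= !lte_fin ltr_pM2r ?invr_gt0// ltrD2r.
case: ifPn => ab; last by rewrite mule0.
rewrite -!EFinB -EFinM; congr EFin; field; exact: lt0r_neq0.
Qed.

Lemma ge0_integral_affine (c h : R) (f : R -> R) : 0 < c -> measurable_fun [set: R] f ->
  (forall x, 0 <= f x) ->
  (\int[mu]_t (c * f (c * t + h))%:E = \int[mu]_t (f t)%:E)%E.
Proof.
move=> c0 mf f0.
transitivity (\int[affine_lebesgue h c0]_t (f t)%:E)%E; last first.
  by apply: eq_measure_integral => A mA _; exact: affine_lebesgueE.
rewrite [RHS]ge0_integral_mscale//=; last 2 first.
  exact/measurable_EFinP.
  by move=> x _; rewrite lee_fin.
rewrite ge0_integral_pushforward//=; last 3 first.
  exact: measurable_affine.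
  exact/measurable_EFinP.
  by move=> x _; rewrite lee_fin.
rewrite preimage_setT; under eq_integral do rewrite EFinM.
rewrite ge0_integralZl//.
- apply/measurable_EFinP/measurableT_comp => //; exact: measurable_affine.
- by move=> x _; rewrite lee_fin.
- by rewrite lee_fin ltW.
Qed.

Lemma integral_affine (c h : R) (f : R -> R) : 0 < c -> measurable_fun [set: R] f ->
  (\int[mu]_t (c * f (c * t + h))%:E = \int[mu]_t (f t)%:E)%E.
Proof.
move=> c0 mf; rewrite integralE [RHS]integralE; congr (_ - _)%E.
- under eq_integral do rewrite funeposE/= -EFin_max -[X in Num.max _ X](mulr0 c) -maxr_pMr ?(ltW c0)//.
  rewrite (@ge0_integral_affine c h (fun t => Num.max (f t) 0))//.
  + by apply: eq_integral => t _; rewrite funeposE/= -EFin_max.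
  + exact: measurable_maxr.
  + by move=> x; rewrite le_max lexx orbT.
- under eq_integral do rewrite funenegE/= -EFin_max -mulrN -[X in Num.max _ X](mulr0 c) -maxr_pMr ?(ltW c0)//.
  rewrite (@ge0_integral_affine c h (fun t => Num.max (- f t) 0))//.
  + by apply: eq_integral => t _; rewrite funenegE/= -EFin_max.
  + by apply: measurable_maxr => //; exact: measurableT_comp.
  + by move=> x; rewrite le_max lexx orbT.
Qed.

(** From here on alpha can act on the frequencies while the symbol stays fixed. *)
Lemma fourier_dilation (phi : R -> R) (a u : R) : 0 < a -> measurable_fun [set: R] phi ->
  fourier (dilation phi a) u = fourier phi (a * u).
Proof.
move=> a0 mphi; have ai : 0 < a^-1 by rewrite invr_gt0.
have E (f : R -> R) : measurable_fun [set: R] f ->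
    \int[mu]_t (dilation phi a t * f (t * u)) = \int[mu]_t (phi t * f (t * (a * u))).
  move=> mf; congr fine.
  rewrite -(@integral_affine _ 0 (fun t => phi t * f (t * (a * u))) ai).
    apply: eq_integral => t _; congr EFin.
    rewrite addr0 /dilation -[LHS]mulrA (mulrC t a^-1); congr (_ * (_ * f _)).
    by field; exact: lt0r_neq0.
  apply: measurable_funM => //; apply: measurableT_comp => //.
  by apply: measurable_funM.
rewrite /fourier (E cos) ?(E sin)//; apply: continuous_measurable_fun.
  exact: continuous_sin.
exact: continuous_cos.
Qed.

End affine_change.

(** * The Riemann-Lebesgue lemma *)

Section riemann_lebesgue.
Variable R : realType.
Local Notation mu := (@lebesgue_measure R).
Local Notation L1 f := (mu.-integrable [set: R] (EFin \o f)).
Implicit Types (f g k : R -> R) (h : R).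

Lemma L1_mul f k : L1 f -> measurable_fun [set: R] k -> (exists C, forall x, `|k x| <= C) ->
  L1 (fun t => f t * k t).
Proof.
move=> fi mk [C kC].
rewrite (_ : EFin \o _ = (EFin \o f) \* (EFin \o k))%E; last by apply/funext => t /=; rewrite EFinM.
apply: integrableMl => //.
exists `|C|; split; first exact: num_real.
move=> M CM x _ /=; apply: le_trans (kC x) _; apply: le_trans (ler_norm C) (ltW CM).
Qed.

Lemma L1_abs f : L1 f -> L1 (fun t => `|f t|).
Proof.
by move=> fi; rewrite (_ : EFin \o _ = (abse \o (EFin \o f))%E) //; exact: integrable_abse.
Qed.

Lemma L1_sub f g : L1 f -> L1 g -> L1 (fun t => f t - g t).
Proof. by move=> fi gi; have := integrableB measurableT fi gi. Qed.

Lemma L1_add f g : L1 f -> L1 g -> L1 (fun t => f t + g t).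
Proof. by move=> fi gi; have := integrableD measurableT fi gi. Qed.

Lemma cvge0_small (u : nat -> \bar R) (e : R) : (u @ \oo --> 0)%E -> 0 < e ->
  exists n, u n \is a fin_num /\ `|fine (u n)| <= e.
Proof.
move=> /fine_cvgP[fu /cvgrPdist_le hu] e0; have {}hu := hu _ e0.
near \oo => n; exists n; split; first by near: n.
by rewrite -normrN -sub0r; near: n.
Unshelve. all: by end_near. Qed.

Lemma L1_tail f (e : R) : L1 f -> 0 < e ->
  exists2 M : R, 0 < M & \int[mu]_t `|f t - (f \_ `[- M, M]) t| <= e.
Proof.
move=> fi e0.
have mf : measurable_fun [set: R] f by case/integrableP : fi => /measurable_EFinP.
pose F (n : nat) (t : R) : \bar R := ((f \_ `[- n.+1%:R, n.+1%:R]) t)%:E.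
have mF n : measurable_fun [set: R] (F n).
  apply/measurable_EFinP; apply/measurable_restrict => //.
  exact: measurable_funTS.
have [] := @dominated_convergence _ _ _ mu _ measurableT F (EFin \o f) (abse \o (EFin \o f))%E.
- exact: mF.
- by case/integrableP : fi.
- apply: aeW => t _; apply: (@cvg_near_cst _ _ _ _ _); near=> n.
  rewrite /F patchE ifT// inE/= in_itv/= -ler_norml.
  apply: (@le_trans _ _ n%:R); last by rewrite ler_nat.
  by near: n; exact: nbhs_infty_ger.
- exact: integrable_abse.
- apply: aeW => t n _; rewrite /F patchE; case: ifPn => //= _.
  by rewrite normr0 lee_fin.
move=> _ h _; have [n [_ hn]] := cvge0_small h e0.
exists n.+1%:R => //; apply: le_trans hn; rewrite ler_normr; apply/orP; left.
rewrite le_eqVlt; apply/orP; left; apply/eqP; congr fine; apply: eq_integral => t _.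
by rewrite /F/= distrC.
Unshelve. all: by end_near. Qed.

(** One good [n] is enough for the argument by contradiction along a sequence of frequencies. *)
Lemma L1_translate_cont g M : 0 < M -> continuous g ->
  forall h : nat -> R, h @ \oo --> 0 -> (forall n, `|h n| <= 1) ->
  forall e : R, 0 < e -> exists n,
  \int[mu]_t `|(g \_ `[- M, M]) (t + h n) - (g \_ `[- M, M]) t| <= e.
Proof.
move=> M0 cg h h0 h1 e e0; set G := g \_ _.
have mg : measurable_fun [set: R] g by exact: continuous_measurable_fun.
have mG : measurable_fun [set: R] G.
  by apply/measurable_restrict => //; exact: measurable_funTS.
have [C C0 GC] : exists2 C, 0 <= C & forall t, `|G t| <= C.
  have MM : - M <= M by rewrite ge0_cp// ltW.
  have cag : {within `[- M, M], continuous (fun t => `|g t|)}.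
    apply: continuous_subspaceT => x; apply: continuous_comp; first exact: cg.
    exact: norm_continuous.
  have [c cM hc] := EVT_max MM cag.
  exists `|g c| => // t; rewrite /G patchE; case: ifPn; last by rewrite normr0.
  by rewrite inE/=; exact: hc.
pose F (n : nat) (t : R) : \bar R := (G (t + h n))%:E.
(* As |h n| <= 1, all translates are supported in the interval widened by 1. *)
have [] := @dominated_convergence _ _ _ mu _ measurableT F (EFin \o G)
  (EFin \o (fun t => C * \1_(`[- (M + 1), M + 1]%classic) t)).
- move=> n; apply/measurable_EFinP; apply: measurableT_comp => //.
  exact: measurable_funD.
- exact/measurable_EFinP.
(* The truncated function may jump at M and - M, so convergence is claimed off these two points. *)
- exists ([set M] `|` [set - M]); split.
  + by apply: measurableU.
  + by rewrite measureU0//; exact: lebesgue_measure_set1.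
  + move=> t /= /not_implyP[_ ht]; apply: contrapT => tM; apply: ht.
    apply/cvg_EFin; first exact: nearW.
    have [tM'|Mt] := ltP `|t| M.
      have tE : t \in `[- M, M]%classic by rewrite inE/= in_itv/= -ler_norml ltW.
      rewrite [G t]patchE tE.
      apply: (@cvg_trans _ (g (t + h n) @[n --> \oo])).
        apply: near_eq_cvg; near=> n; rewrite /= [G _]patchE ifT// inE/= in_itv/= -ler_norml.
        apply: (le_trans (ler_normD _ _)); rewrite -lerBrDl.
        near: n; move/cvgrPdist_le : h0 => /(_ (M - `|t|)); rewrite subr_gt0 => /(_ tM').
        by apply: filterS => n; rewrite sub0r normrN.
      have th : (fun n => t + h n) @ \oo --> t + 0 by apply: cvgD => //; exact: cvg_cst.
      by rewrite addr0 in th; apply: (cvg_comp _ _ th); exact: cg.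
    have {}Mt : M < `|t|.
      rewrite lt_neqAle Mt andbT; apply/eqP => e1; apply: tM.
      by have := normr_idP; case: (ger0P t) e1 => _ ->; [left|right]; rewrite /= ?opprK.
    have tE : t \notin `[- M, M]%classic by rewrite notin_setE/= in_itv/= -ler_norml leNgt Mt.
    rewrite [G t]patchE (negbTE tE).
    apply: (@cvg_near_cst _ _ _ _ _); near=> n.
    rewrite /F/= [G _]patchE ifN// notin_setE/= in_itv/= -ler_norml; apply/negP; rewrite -ltNge.
    have := ler_normB (t + h n) (h n); rewrite addrK => h2.
    suff : `|h n| < `|t| - M by lra.
    near: n; move/cvgrPdist_lt : h0 => /(_ (`|t| - M)); rewrite subr_gt0 => /(_ Mt).
    by apply: filterS => n; rewrite sub0r normrN.
- exact: integrableZl (integrable_indic_itv _ _ _ _).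
- apply: aeW => t n _ /=; rewrite lee_fin indicE.
  have [tn|tn] := boolP (t \in _); first by rewrite mulr1.
  rewrite mulr0 normr_le0 [G _]patchE ifN//; move: tn; rewrite !notin_setE/= !in_itv/= -!ler_norml.
  move=> /negP; rewrite -ltNge => tn; apply/negP; rewrite -ltNge.
  have := ler_normB (t + h n) (h n); rewrite addrK => h2; have := h1 n; lra.
move=> _ hh _; have [n [_ hn]] := cvge0_small hh e0.
exists n; apply: le_trans hn; rewrite ler_normr; apply/orP; left.
by rewrite /F /Rintegral.
Unshelve. all: by end_near. Qed.

Lemma L1_approx f (e : R) : L1 f -> 0 < e -> exists M g,
  [/\ 0 < M, continuous g, L1 (g \_ `[- M, M]) & \int[mu]_t `|f t - (g \_ `[- M, M]) t| <= e].
Proof.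
move=> fi e0; have e2 : 0 < e / 2 by rewrite divr_gt0.
have [M M0 hM] := L1_tail fi e2.
have mE : measurable (`[- M, M]%classic : set (measurableTypeR R)) by exact: measurable_itv.
have fE : mu.-integrable `[- M, M] (EFin \o f) by apply: integrableS fi.
have muE : (mu `[(- M)%R, M]%classic < +oo)%E.
  by rewrite lebesgue_measure_itv/=; case: ifP => _; rewrite ?ltry// -EFinB ltry.
have [g_ [cg gi h]] := approximation_continuous_integrable mE muE fE.
have [n [_ hn]] := cvge0_small h e2.
have Li k : mu.-integrable `[- M, M] (EFin \o k) -> L1 (k \_ `[- M, M]).
  by move=> ki; have := (@integrable_mkcond _ _ _ mu _ (EFin \o k) mE).1 ki; rewrite restrict_EFin.
exists M, (g_ n); split => //; first exact: Li.
have e1 : e = e / 2 + e / 2 by lra.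
rewrite e1; apply: le_trans (lerD hM (le_trans (ler_norm _) hn)).
have -> : fine (\int[mu]_(z in `[(- M)%R, M]) `|(f z - g_ n z)%:E|)%E =
    \int[mu]_t `|(f \_ `[- M, M]) t - (g_ n \_ `[- M, M]) t|.
  rewrite -[LHS]/(\int[mu]_(z in `[- M, M]) `|f z - g_ n z|) Rintegral_mkcond.
  apply: eq_Rintegral => t _; rewrite !patchE; case: ifPn => // _.
  by rewrite subrr normr0.
have i1 : L1 (fun t => `|f t - (f \_ `[- M, M]) t|) by apply/L1_abs/L1_sub => //; exact: Li.
have i2 : L1 (fun t => `|(f \_ `[- M, M]) t - (g_ n \_ `[- M, M]) t|).
  by apply/L1_abs/L1_sub; exact: Li.
rewrite -RintegralD//; apply: le_Rintegral => //.
- by apply/L1_abs/L1_sub => //; exact: Li.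
- exact: (L1_add i1 i2).
- by move=> t _; rewrite -[leLHS]/(`|f t - (g_ n \_ `[- M, M]) t|) (le_trans _ (ler_normD _ _))// addrA subrK.
Qed.

Lemma Rintegral_le_abs f k : L1 f -> measurable_fun [set: R] k -> (forall x, `|k x| <= 1) ->
  `|\int[mu]_t (f t * k t)| <= \int[mu]_t `|f t|.
Proof.
move=> fi mk k1; have fk : L1 (fun t => f t * k t) by apply: L1_mul => //; exists 1.
apply: (le_trans (le_normr_Rintegral _ _)) => //; apply: le_Rintegral => //.
- exact: L1_abs.
- exact: L1_abs.
- by move=> x _; rewrite normrM -[leRHS]mulr1 ler_wpM2l.
Qed.

Lemma Rintegral_translate f h : measurable_fun [set: R] f ->
  \int[mu]_t f t = \int[mu]_t f (t + h).
Proof.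
move=> mf; congr fine; rewrite -(@integral_affine R 1 h f ltr01 mf).
by apply: eq_integral => t _; rewrite !mul1r.
Qed.

Lemma L1_translate f h : L1 f -> L1 (fun t => f (t + h)).
Proof.
move=> /integrableP[/measurable_EFinP mf foo]; apply/integrableP; split.
  by apply/measurable_EFinP; apply: measurableT_comp => //; exact: measurable_funD.
apply: le_lt_trans foo; rewrite le_eqVlt; apply/orP; left; apply/eqP.
rewrite -[RHS](@integral_affine R 1 h (fun t => `|f t|) ltr01); last exact: measurableT_comp.
by apply: eq_integral => t _; rewrite /= !mul1r.
Qed.

(* Translating by the half period pi / w changes the sign of k (t * w) and
   hardly changes f in L1. *)
Lemma riemann_lebesgue_antiperiodic f k (e : R) : L1 f -> continuous k ->
  (forall x, `|k x| <= 1) -> (forall x, k (x + pi) = - k x) -> 0 < e ->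
  exists W : R, forall w, W <= w -> `|\int[mu]_t (f t * k (t * w))| <= e.
Proof.
move=> fi ck k1 kpi e0; have e2 : 0 < e / 2 by rewrite divr_gt0.
have [M [g [M0 cg Gi hG]]] := L1_approx fi e2; set G := g \_ _ in Gi hG.
have mk w : measurable_fun [set: R] (fun t => k (t * w)).
  apply: measurableT_comp; first exact: continuous_measurable_fun.
  exact: measurable_funM.
have kw w t : `|k (t * w)| <= 1 by [].
suff [W hW] : exists W : R, forall w, W <= w -> `|\int[mu]_t (G t * k (t * w))| <= e / 2.
  exists W => w Ww.
  have -> : \int[mu]_t (f t * k (t * w)) =
      \int[mu]_t ((f t - G t) * k (t * w)) + \int[mu]_t (G t * k (t * w)).
    rewrite -RintegralD//.
    - by apply: eq_Rintegral => t _; rewrite -mulrDl subrK.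
    - by apply: (@L1_mul (fun t => f t - G t)) => //; [exact: L1_sub|exists 1].
    - by apply: L1_mul => //; exists 1.
  have -> : e = e / 2 + e / 2 by lra.
  apply: (le_trans (ler_normD _ _)); apply: lerD; last exact: hW.
  by apply: le_trans hG; apply: (@Rintegral_le_abs (fun t => f t - G t)) => //; exact: L1_sub.
apply: contrapT => hno.
(* Since pi <= 4, the shift makes the half period pi / w n at most 1, as [L1_translate_cont]
   demands. *)
have /choice[w hw] : forall n : nat, exists w : R, n%:R + 4 <= w /\ e / 2 < `|\int[mu]_t (G t * k (t * w))|.
  move=> n; apply: contrapT => hn; apply: hno; exists (n%:R + 4) => w nw.
  by rewrite leNgt; apply/negP => h; apply: hn; exists w.
have w0 n : 0 < w n by have [h _] := hw n; apply: lt_le_trans h; rewrite ltr_wpDl.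
pose h n : R := pi / w n.
have pi4 : (pi : R) <= 4 by have := @pihalf_lt2 R; lra.
have h0 n : 0 <= h n by rewrite divr_ge0 ?pi_ge0// ltW.
have h1 n : `|h n| <= 1.
  rewrite ger0_norm// ler_pdivrMr// mul1r (le_trans pi4)//.
  by have [hn _] := hw n; apply: le_trans hn; rewrite lerDr.
have hlim : h @ \oo --> 0.
  apply: (@squeeze_cvgr _ _ _ _ (cst 0) (fun n => 4 * harmonic n)).
  - apply: nearW => n; rewrite /cst h0 /h /harmonic/=.
    have [hn _] := hw n; rewrite ler_pM ?pi_ge0// ?invr_ge0 ?(ltW (w0 n))//.
    by rewrite lef_pV2 ?posrE//; apply: le_trans hn; rewrite -natr1; lra.
  - exact: cvg_cst.
  - by rewrite -[X in _ --> X](mulr0 4); apply: cvgM; [exact: cvg_cst|exact: cvg_harmonic].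
have [n hn] := L1_translate_cont M0 cg hlim h1 e2.
have [_ ] := hw n; rewrite ltNge => /negP; apply.
set I := \int[mu]_t _.
have Gh : L1 (fun t => G (t + h n)) by exact: L1_translate.
have IE : I = - \int[mu]_t (G (t + h n) * k (t * w n)).
  have mG : measurable_fun [set: R] G by case/integrableP : Gi => /measurable_EFinP.
  rewrite /I (@Rintegral_translate (fun t => G t * k (t * w n)) (h n)); last exact: measurable_funM.
  rewrite -mulN1r -RintegralZl//; last by apply: L1_mul => //; exists 1.
  apply: eq_Rintegral => t _; rewrite mulrDl.
  have -> : h n * w n = pi by rewrite /h divfK// lt0r_neq0.
  by rewrite kpi mulrN mulN1r.
have I2 : \int[mu]_t ((G (t + h n) - G t) * k (t * w n)) = - I - I.
  rewrite [X in _ = - X - _]IE opprK /I -RintegralB//.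
  - by apply: eq_Rintegral => t _; rewrite mulrBl.
  - by apply: L1_mul => //; exists 1.
  - by apply: L1_mul => //; exists 1.
have := @Rintegral_le_abs (fun t => G (t + h n) - G t) _ (L1_sub Gh Gi) (mk (w n)) (kw (w n)).
move=> /le_trans/(_ hn); rewrite I2 !ler_norml => /andP[? ?]; apply/andP; split; lra.
Qed.

Lemma riemann_lebesgue f (e : R) : L1 f -> 0 < e -> exists W : R, forall w, W <= `|w| ->
  `|\int[mu]_t (f t * cos (t * w))| <= e /\ `|\int[mu]_t (f t * sin (t * w))| <= e.
Proof.
move=> fi e0.
have [W1 h1] := riemann_lebesgue_antiperiodic fi (@continuous_cos R) (@cos_max R) (@cosDpi R) e0.
have [W2 h2] := riemann_lebesgue_antiperiodic fi (@continuous_sin R) (@sin_max R) (@sinDpi R) e0.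
exists (Num.max W1 W2) => w; rewrite ge_max => /andP[w1 w2].
case: (ger0P w) w1 w2 => w0 w1 w2; first by split; [exact: h1|exact: h2].
split.
  by under eq_Rintegral do rewrite -cosN -mulrN; exact: h1.
have -> : \int[mu]_t (f t * sin (t * w)) = \int[mu]_t (-1 * (f t * sin (t * - w))).
  by apply: eq_Rintegral => t _; rewrite [t * - w]mulrN sinN mulrN mulN1r opprK.
rewrite RintegralZl ?mulN1r ?normrN//; first exact: h2.
apply: L1_mul => //; last by exists 1 => x; exact: sin_max.
apply: measurableT_comp; first by apply: continuous_measurable_fun; exact: continuous_sin.
exact: measurable_funM.
Qed.

End riemann_lebesgue.

(** * Schur's test for the Gram matrix of the damped oscillations *)

Section schur_test.
Variable R : realType.
Implicit Types (p q a x y d l : R).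

Lemma sum_le_telescope (t F : nat -> R) N :
  (forall m, t m <= F m.+1 - F m) -> \sum_(m < N) t m <= F N - F 0.
Proof.
move=> h; elim: N => [|N ih]; first by rewrite big_ord0 subrr.
by rewrite big_ord_recr/=; have := h N; lra.
Qed.

Lemma ln_le_sub1 x : 0 < x -> ln x <= x - 1.
Proof. by move=> x0; have := expR_ge1Dx (ln x); rewrite lnK ?posrE//; lra. Qed.

Lemma ln_sub_ge p q : 0 < p -> 0 < q -> (q - p) / q <= ln q - ln p.
Proof.
move=> p0 q0; have := ln_le_sub1 (divr_gt0 p0 q0); rewrite ln_div ?posrE// => h.
have -> : (q - p) / q = 1 - p / q by field; exact: lt0r_neq0.
lra.
Qed.

(* As in l2, the index n stands for the integer n.+1 of the paper. *)
Definition damp (n : nat) : R := n.+1%:R^-1.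
Definition freq (n : nat) : R := ln n.+1%:R.
Definition gram (n m : nat) : R :=
  2 * (damp n + damp m) / ((damp n + damp m) ^+ 2 + (freq n - freq m) ^+ 2).

(* The comparison functions for Schur's test: for q <= 2 p the terms are
   dominated by summable functions of q and of p - q; for larger q they are
   dominated by the telescoping differences of 1 / ln (q / p). *)
Let kap (d : R) : R := 16 / (4 + d ^+ 2).

Let kap_pos d : 0 < 4 + d ^+ 2.
Proof. by rewrite ltr_wpDr// sqr_ge0. Qed.

Let kap_ge0 d : 0 <= kap d.
Proof. by rewrite divr_ge0// ltW. Qed.

Let schur_term_le y a l k : 0 < a -> 0 <= k -> 2 * y * a * (4 + k ^+ 2) <= 16 * (a ^+ 2 + l ^+ 2) ->
  y * (2 * a / (a ^+ 2 + l ^+ 2)) <= kap k.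
Proof.
move=> a0 k0 h; have D0 : 0 < a ^+ 2 + l ^+ 2 by rewrite ltr_wpDr ?sqr_ge0// exprn_gt0.
by rewrite /kap mulrA ler_pdivrMr// mulrAC ler_pdivlMr//; lra.
Qed.

(** [ln_sub_ge] bounds |ln p - ln q| below by |p - q| over the larger of the two. When p and q are
    within a factor 2 of each other this gives decay in |p - q|. When p >= 2 q the logarithm is at
    least 1/2, and the decay q^-2 comes from the weight and the damping. *)
Lemma schur_near p q : 1 <= p -> 1 <= q -> q <= 2 * p ->
  q^-1 * (2 * (p^-1 + q^-1) / ((p^-1 + q^-1) ^+ 2 + (ln p - ln q) ^+ 2)) <=
  kap q + kap `|p - q|.
Proof.
move=> p1 q1 q2p.
have p0 : 0 < p by lra. have q0 : 0 < q by lra.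
have x0 : 0 < p^-1 by rewrite invr_gt0. have y0 : 0 < q^-1 by rewrite invr_gt0.
have xp : p^-1 * p = 1 by rewrite mulVf// lt0r_neq0.
have yq : q^-1 * q = 1 by rewrite mulVf// lt0r_neq0.
have l1 := ln_sub_ge p0 q0; have l2 := ln_sub_ge q0 p0.
set x := p^-1 in x0 xp l2 *; set y := q^-1 in y0 yq l1 *; set l := ln p - ln q.
have a0 : 0 < x + y by lra.
have [pq|qp] := leP p q.
  rewrite (@le_trans _ _ (kap `|p - q|)) ?lerDr//; apply: schur_term_le => //.
  have d0 : 0 <= q - p by lra.
  rewrite ler0_norm ?subr_le0// opprB.
  have yx : y <= x by rewrite lef_pV2 ?posrE.
  have xy : x <= 2 * y.
    have : x * (q * y) <= x * (2 * p * y) by rewrite ler_wpM2l ?(ltW x0)// ler_wpM2r ?(ltW y0).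
    by rewrite (mulrC q) yq mulr1 -mulrA mulrCA (mulrA x) xp mul1r.
  have l3 : ((q - p) * y) ^+ 2 <= l ^+ 2.
    rewrite -(sqrrN l) /l opprB ler_sqr ?nnegrE//; first by rewrite mulr_ge0// ltW.
    by apply: le_trans l1; rewrite mulr_ge0// ltW.
  have h1 : y * (x + y) <= (x + y) ^+ 2 by rewrite expr2 ler_wpM2r; lra.
  have h2 : y * (x + y) <= 3 * y ^+ 2.
    by rewrite expr2 [leRHS]mulrCA ler_wpM2l; lra.
  have h3 : y * (x + y) * (q - p) ^+ 2 <= 3 * y ^+ 2 * (q - p) ^+ 2.
    by rewrite ler_wpM2r// sqr_ge0.
  have h4 : ((q - p) * y) ^+ 2 = y ^+ 2 * (q - p) ^+ 2 by rewrite exprMn mulrC.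
  have h5 := sqr_ge0 (x + y); have h6 : 0 <= y ^+ 2 * (q - p) ^+ 2 by rewrite mulr_ge0 ?sqr_ge0.
  rewrite h4 in l3.
  have -> : 2 * y * (x + y) * (4 + (q - p) ^+ 2) = 8 * (y * (x + y)) + 2 * (y * (x + y) * (q - p) ^+ 2) by ring.
  lra.
have d0 : 0 < p - q by lra.
rewrite (gtr0_norm d0).
have xy : x <= y by rewrite lef_pV2 ?posrE// ltW.
have h1 : y * (x + y) <= (x + y) ^+ 2 by rewrite expr2 ler_wpM2r; lra.
have l3 : ((p - q) * x) ^+ 2 <= l ^+ 2.
  rewrite ler_sqr ?nnegrE//; first by rewrite mulr_ge0// ltW.
  by apply: le_trans l2; rewrite mulr_ge0// ltW.
have h5 := sqr_ge0 (x + y).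
have [qd|dq] := leP q (p - q).
  rewrite (@le_trans _ _ (kap q)) ?lerDl//; apply: schur_term_le => //; first exact: ltW.
  have h6 : 2^-1 <= (p - q) * x.
    have : p * x <= 2 * (p - q) * x by rewrite ler_wpM2r ?(ltW x0)//; lra.
    by rewrite (mulrC p) xp; lra.
  have h7 : (2^-1) ^+ 2 <= ((p - q) * x) ^+ 2 by rewrite ler_sqr ?nnegrE// mulr_ge0// ltW.
  have h8 : y * (x + y) * q ^+ 2 = x * q + 1.
    have -> : y * (x + y) * q ^+ 2 = (y * q) * (x * q + y * q) by ring.
    by rewrite yq mul1r.
  have h9 : x * q <= 1 by rewrite -yq ler_wpM2r ?(ltW q0).
  have -> : 2 * y * (x + y) * (4 + q ^+ 2) = 8 * (y * (x + y)) + 2 * (y * (x + y) * q ^+ 2) by ring.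
  have h10 : (2^-1 : R) ^+ 2 = 4^-1 by field.
  rewrite h8; lra.
rewrite (@le_trans _ _ (kap (p - q))) ?lerDr//; apply: schur_term_le => //; first exact: ltW.
have yx : y <= 2 * x.
  have : y * (p * x) <= y * (2 * q * x) by rewrite ler_wpM2l ?(ltW y0)// ler_wpM2r ?(ltW x0)//; lra.
  by rewrite (mulrC p) xp mulr1 -mulrA mulrCA (mulrA y) yq mul1r.
have h2 : y * (x + y) <= 6 * x ^+ 2.
  have : y * (x + y) <= (2 * x) * (3 * x) by apply: ler_pM; lra.
  by congr (_ <= _); ring.
have h3 : y * (x + y) * (p - q) ^+ 2 <= 6 * x ^+ 2 * (p - q) ^+ 2.
  by rewrite ler_wpM2r// sqr_ge0.
have h4 : ((p - q) * x) ^+ 2 = x ^+ 2 * (p - q) ^+ 2 by rewrite exprMn mulrC.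
have h6 : 0 <= x ^+ 2 * (p - q) ^+ 2 by rewrite mulr_ge0 ?sqr_ge0.
rewrite h4 in l3.
have -> : 2 * y * (x + y) * (4 + (p - q) ^+ 2) = 8 * (y * (x + y)) + 2 * (y * (x + y) * (p - q) ^+ 2) by ring.
lra.
Qed.

(** With A and L the logarithms of (q - 1) / p and q / p, the weight 1 / q is at most L - A and the
    other factor at most 4 / L^2 <= 4 / (A L); the product is 4 (1/A - 1/L). *)
Lemma schur_far p q : 1 <= p -> 2 * p <= q - 1 ->
  q^-1 * (2 * (p^-1 + q^-1) / ((p^-1 + q^-1) ^+ 2 + (ln p - ln q) ^+ 2)) <=
  4 * ((ln ((q - 1) / p))^-1 - (ln (q / p))^-1).
Proof.
move=> p1 qp; have p0 : 0 < p by lra. have q0 : 0 < q by lra. have q10 : 0 < q - 1 by lra.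
set A := ln ((q - 1) / p); set L := ln (q / p).
have A0 : 0 < A by rewrite ln_gt0// ltr_pdivlMr//; lra.
have LA : q^-1 <= L - A.
  rewrite /L /A !ln_div ?posrE//; have := ln_sub_ge q10 q0.
  by rewrite opprB addrCA subrr addr0 mul1r; lra.
have iq : 0 < q^-1 by rewrite invr_gt0.
have L0 : 0 < L by lra.
have ip : 0 < p^-1 <= 1 by rewrite invr_gt0 p0 invf_le1.
have iq1 : q^-1 <= 1 by rewrite invf_le1//; lra.
have -> : (ln p - ln q) ^+ 2 = L ^+ 2 by rewrite -sqrrN opprB /L ln_div ?posrE.
set a := p^-1 + q^-1; have a0 : 0 < a <= 2 by rewrite /a; lra.
have L20 : 0 < L ^+ 2 by rewrite exprn_gt0.
have h1 : 2 * a / (a ^+ 2 + L ^+ 2) <= 4 / L ^+ 2.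
  apply: ler_pM; [lra| |lra|].
    by rewrite invr_ge0 addr_ge0 ?sqr_ge0// ltW.
  by rewrite lef_pV2 ?posrE ?ltr_wpDl ?sqr_ge0// lerDr sqr_ge0.
apply: (@le_trans _ _ ((L - A) * (4 / L ^+ 2))).
  apply: ler_pM => //; first exact: ltW.
  by rewrite divr_ge0 ?addr_ge0 ?sqr_ge0//; lra.
have -> : 4 * (A^-1 - L^-1) = (L - A) * (4 / (A * L)) by field; rewrite !lt0r_neq0.
rewrite ler_wpM2l//; first lra.
rewrite ler_wpM2l// lef_pV2 ?posrE ?mulr_gt0//.
by rewrite expr2 ler_wpM2r//; lra.
Qed.

Let kap_telescope d : 0 <= d -> kap d <= 32 * ((d + 1)^-1 - (d + 2)^-1).
Proof.
move=> d0; have -> : 32 * ((d + 1)^-1 - (d + 2)^-1) = 32 / ((d + 1) * (d + 2)).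
  by field; apply/andP; split; apply: lt0r_neq0; lra.
rewrite /kap ler_pdivrMr// mulrAC ler_pdivlMr; last by rewrite mulr_gt0; lra.
by have := sqr_ge0 (d - 3 / 2); nra.
Qed.

(** A bounded primitive in [m] for the decay in |n - m|: it increases to 1 at m = n and tends to
    2. *)
Let near_primitive (n m : nat) : R :=
  if (m <= n)%N then (n - m).+1%:R^-1 else 2 - (m - n).+1%:R^-1.

Let near_primitiveP n m :
  kap `|n%:R - m%:R| <= 32 * (near_primitive n m.+1 - near_primitive n m).
Proof.
rewrite /near_primitive; case: (ltngtP m n) => mn.
- rewrite -natrB ?(ltnW mn)// ger0_norm//; apply: (le_trans (kap_telescope _)) => //.
  rewrite ler_wpM2l//.
  have -> : (n - m.+1).+1 = (n - m)%N by rewrite subnS prednK// subn_gt0.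
  have : (0 : R) < (n - m)%:R by rewrite ltr0n subn_gt0.
  rewrite -[in leRHS]natr1; set d := (n - m)%:R => d0.
  have -> : (d + 1)^-1 - (d + 2)^-1 = ((d + 1) * (d + 2))^-1.
    by field; apply/andP; split; apply: lt0r_neq0; lra.
  have -> : d^-1 - (d + 1)^-1 = (d * (d + 1))^-1.
    by field; apply/andP; split; apply: lt0r_neq0; lra.
  rewrite lef_pV2 ?posrE ?mulr_gt0//; [nra|lra..].
- rewrite distrC -natrB ?(ltnW mn)// ger0_norm//; apply: (le_trans (kap_telescope _)) => //.
  rewrite ler_wpM2l// subSn ?(ltnW mn)//.
  rewrite -[(m - n).+2%:R]natr1 -[(m - n).+1%:R]natr1; set d := (m - n)%:R.
  have -> : d + 1 + 1 = d + 2 by ring.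
  lra.
- rewrite mn subrr normr0 subnn subSn// subnn /kap expr0n/=.
  by rewrite invr1 addr0; have e : (16 : R) / 4 = 4; [field|lra].
Qed.

(** Here 80 = 16 + 64: decay in q sums to 32 / 2, decay in |p - q| to 32 times the bound 2 of
    [near_primitive]. The last term is the far range. *)
Definition schur_const : R := 80 + 4 / ln 2.

Lemma schur_sum n N : \sum_(m < N) damp m * gram n m <= schur_const.
Proof.
(* The term of index m has q = m + 1, so [schur_far] applies exactly when 2 * n.+1 <= m; the
   constant 1 / ln 2 makes [H] start from 0 there. *)
pose H (m : nat) : R := if (2 * n.+1 <= m)%N then 4 * ((ln 2)^-1 - (ln (m%:R / n.+1%:R))^-1) else 0.
pose F (m : nat) : R := - 32 / m.+2%:R + 32 * near_primitive n m + H m.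
have ln2 : 0 < ln 2 :> R by rewrite ln_gt0//; lra.
have n0 : (0 : R) < n.+1%:R by [].
have n1 : (1 : R) <= n.+1%:R by rewrite ler1n.
have Hge m : (2 * n.+1 <= m)%N -> ln 2 <= ln (m%:R / n.+1%:R) :> R.
  move=> h; rewrite ler_ln ?posrE//; last first.
    rewrite divr_gt0// ltr0n; exact: leq_trans h.
  by rewrite ler_pdivlMr// -natrM ler_nat.
have H0 m : 0 <= H m.
  rewrite /H; case: ifPn => // h; rewrite mulr_ge0// subr_ge0 lef_pV2 ?posrE//; first exact: Hge.
  exact: lt_le_trans (Hge _ h).
have FN : F N - F 0 <= schur_const.
  have -> : F 0 = - 16 + 32 * n.+1%:R^-1.
    have -> : F 0 = - 32 / 2 + 32 * n.+1%:R^-1 + H 0 by rewrite /F /near_primitive leq0n subn0.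
    rewrite (_ : H 0 = 0) ?addr0; last by rewrite /H leqn0 muln_eq0.
    by congr (_ + _); field.
  have h1 : - 32 / N.+2%:R <= 0 :> R by rewrite mulNr oppr_le0 divr_ge0.
  have h2 : near_primitive n N <= 2.
    rewrite /near_primitive; case: ifP => _; last by rewrite gerBl invr_ge0.
    by rewrite (@le_trans _ _ 1)// ?invf_le1 ?ler1n//; lra.
  have h3 : H N <= 4 / ln 2.
    rewrite /H; case: ifPn => h; last by rewrite divr_ge0// ltW.
    rewrite ler_wpM2l// gerBl invr_ge0 ltW//; exact: lt_le_trans (Hge _ h).
  have h4 : 0 <= 32 * n.+1%:R^-1 :> R by [].
  rewrite /F /schur_const; move: h1 h2 h3 h4.
  by move: (_ / N.+2%:R) (near_primitive n N) (H N) (4 / ln 2) (32 / _) => ? ? ? ? ?; lra.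
apply: le_trans FN; apply: (sum_le_telescope (t := fun m => damp m * gram n m)) => m.
have [mn|nm] := leqP m.+1 (2 * n.+1).
  have mR : m.+1%:R <= 2 * n.+1%:R :> R by rewrite -natrM ler_nat.
  have m1 : 1 <= m.+1%:R :> R by rewrite ler1n.
  have := schur_near n1 m1 mR.
  rewrite -!/(damp _) -!/(freq _) -/(gram n m) => /le_trans; apply.
  have h1 : kap m.+1%:R <= 32 * (m.+2%:R^-1 - m.+3%:R^-1).
    have := @kap_telescope m.+1%:R (ler0n _ _).
    by rewrite natr1 (_ : m.+1%:R + 2 = m.+3%:R) // -natrD addn2.
  have h2 : kap `|n.+1%:R - m.+1%:R| <= 32 * (near_primitive n m.+1 - near_primitive n m).
    by have := near_primitiveP n m; rewrite -!natr1 opprD addrACA subrr addr0.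
  have h3 : H m = 0 by rewrite /H ifN// -ltnNge.
  have := H0 m.+1; rewrite /F h3; move: h1 h2; move: (m.+2%:R^-1) (m.+3%:R^-1) => x y.
  by move: (kap _) (kap _) (near_primitive _ _) (near_primitive _ _) (H _) => ? ? ? ? ? ? ? ?; lra.
have qp : 2 * n.+1%:R <= m.+1%:R - 1 :> R by rewrite -[m.+1%:R]natr1 addrK -natrM ler_nat.
have := @schur_far n.+1%:R m.+1%:R n1 qp.
rewrite -!/(damp _) -!/(freq _) -/(gram n m) => /le_trans; apply.
have nm1 : (2 * n.+1 <= m)%N by [].
rewrite /F /H nm1 (leqW nm1).
have -> : m.+1%:R - 1 = m%:R :> R by rewrite -natr1 addrK.
have h1 := le_trans (kap_ge0 _) (near_primitiveP n m).
have h2 : m.+3%:R^-1 <= m.+2%:R^-1 :> R by rewrite lef_pV2 ?posrE// ler_nat.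
move: h1 h2; move: (m.+2%:R^-1) (m.+3%:R^-1) ((ln _)^-1) ((ln _)^-1) ((ln _)^-1) => ? ? ? ? ?.
by move: (near_primitive _ _) (near_primitive _ _) => ? ? ? ?; lra.
Qed.

Lemma gramC n m : gram n m = gram m n.
Proof. by rewrite /gram (addrC (damp n)) -[(freq n - freq m) ^+ 2]sqrrN opprB. Qed.

Lemma gram_ge0 n m : 0 <= gram n m.
Proof. by rewrite /gram divr_ge0 ?addr_ge0 ?sqr_ge0// mulr_ge0// addr_ge0// invr_ge0. Qed.

Definition wgt (n : nat) : R := Num.sqrt (damp n).

Lemma wgt_sq n : wgt n ^+ 2 = damp n.
Proof. by rewrite sqr_sqrtr// invr_ge0. Qed.

(** Applying 2 x y <= x^2 + y^2 to x = b n * wgt m and y = b m * wgt n puts the weight damp m on the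
    inner sum, where [schur_sum] is uniform in n. *)
Lemma schur_bound (b : nat -> R) N :
  \sum_(n < N) \sum_(m < N) b n * b m * (wgt n * wgt m) * gram n m <=
  schur_const * \sum_(n < N) b n ^+ 2.
Proof.
have h n m : b n * b m * (wgt n * wgt m) * gram n m <=
    2^-1 * (b n ^+ 2 * (damp m * gram n m)) + 2^-1 * (b m ^+ 2 * (damp n * gram m n)).
  rewrite (gramC m n) -!wgt_sq; have := sqr_ge0 (b n * wgt m - b m * wgt n) => h.
  have : b n * b m * (wgt n * wgt m) <= 2^-1 * (b n ^+ 2 * wgt m ^+ 2 + b m ^+ 2 * wgt n ^+ 2).
    move: h; rewrite sqrrB !exprMn => h.
    have -> : b n * b m * (wgt n * wgt m) = b n * wgt m * (b m * wgt n) by ring.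
    lra.
  move/(ler_wpM2r (gram_ge0 n m)) => /le_trans; apply.
  by rewrite le_eqVlt; apply/orP; left; apply/eqP; ring.
apply: (@le_trans _ _ (\sum_(n < N) b n ^+ 2 * \sum_(m < N) damp m * gram n m)); last first.
  rewrite mulr_sumr; apply: ler_sum => n _; rewrite mulrC ler_wpM2r ?sqr_ge0//.
  exact: schur_sum.
pose S := \sum_(n < N) \sum_(m < N) 2^-1 * (b n ^+ 2 * (damp m * gram n m)).
have -> : \sum_(n < N) b n ^+ 2 * \sum_(m < N) damp m * gram n m = S + S.
  rewrite /S -big_split; apply: eq_bigr => n _; rewrite mulr_sumr -big_split.
  by apply: eq_bigr => m _ /=; field.
have S2 : S = \sum_(n < N) \sum_(m < N) 2^-1 * (b m ^+ 2 * (damp n * gram m n)).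
  by rewrite /S exchange_big.
rewrite {2}S2 /S -big_split; apply: ler_sum => n _.
by rewrite -big_split; apply: ler_sum => m _; exact: h.
Qed.

End schur_test.

(** * The logarithmic cost of the damping *)

Section telescope_log.
Variable R : realType.
Implicit Types (T : R).

Lemma ln1D_telescope T (n : nat) : 0 <= T -> (0 < n)%N ->
  T / (n.+1%:R * (n.+1%:R + T)) <= ln (1 + T / n%:R) - ln (1 + T / n.+1%:R).
Proof.
move=> T0 n0; have nR : (0 : R) < n%:R by rewrite ltr0n.
rewrite -[n.+1%:R]natr1; set x := n%:R in nR *.
have x1 : 0 < x + 1 by lra.
have h1 : 0 < 1 + T / x by rewrite ltr_wpDr// divr_ge0// ltW.
have h2 : 0 < 1 + T / (x + 1) by rewrite ltr_wpDr// divr_ge0// ltW.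
apply: le_trans (ln_sub_ge h2 h1).
have xT : 0 < x + T by lra.
have xT1 : 0 < x + 1 + T by lra.
have -> : (1 + T / x - (1 + T / (x + 1))) / (1 + T / x) = T / ((x + 1) * (x + T)).
  by field; rewrite !lt0r_neq0.
by rewrite ler_wpM2l// lef_pV2 ?posrE ?mulr_gt0// ler_pM2l//; lra.
Qed.

Lemma one_sub_expN_sq (s : R) : 0 <= s -> (1 - expR (- s)) ^+ 2 <= 2 * s / (1 + s).
Proof.
move=> s0; have e1 : expR (- s) <= 1 by rewrite -expR0 ler_expR oppr_le0.
have e2 := expR_ge1Dx (- s); have e3 := expR_gt0 (- s).
rewrite ler_pdivlMr; last lra.
move: e1 e2 e3; set u := 1 - expR (- s) => e1 e2 e3; have u1 : 0 <= u <= 1 by rewrite /u; lra.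
have u2 : u ^+ 2 <= u by rewrite expr2; nra.
have : u ^+ 2 * s <= 1 * s by rewrite ler_wpM2r//; lra.
by rewrite /u in u2 *; lra.
Qed.

(* (1 - e^-s)^2 <= 2 s / (1 + s), which makes the sum telescope in ln (1 + T / n). *)
Lemma damping_error_sum (T : R) N0 N : 0 <= T -> (0 < N0)%N ->
  \sum_(n < N | (N0 <= n)%N) damp R n * (1 - expR (- (T * damp R n))) ^+ 2 <=
  2 * ln (1 + T / N0%:R).
Proof.
move=> T0 N00; have N0R : (0 : R) < N0%:R by rewrite ltr0n.
(* [maxn] keeps the primitive constant up to [N0], where the sum has no terms. *)
pose F (n : nat) : R := 2 * (ln (1 + T / N0%:R) - ln (1 + T / (maxn N0 n)%:R)).
have FN : F N - F 0 <= 2 * ln (1 + T / N0%:R).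
  rewrite /F maxn0 subrr mulr0 subr0 ler_wpM2l// gerBl ln_ge0// lerDl divr_ge0//.
apply: le_trans FN; rewrite big_mkcond.
apply: (sum_le_telescope (F := F)
  (t := fun n => if (N0 <= n)%N then damp R n * (1 - expR (- (T * damp R n))) ^+ 2 else 0)) => n.
case: ifPn => [Nn|]; last by rewrite -ltnNge => nN; rewrite /F (maxn_idPl nN) (maxn_idPl (ltnW nN)) subrr.
rewrite /F (maxn_idPr Nn) (maxn_idPr (leqW Nn)).
have n0 := leq_trans N00 Nn.
have h := ln1D_telescope T0 n0.
have Td : 0 <= T * damp R n by rewrite mulr_ge0// invr_ge0.
have : damp R n * (1 - expR (- (T * damp R n))) ^+ 2 <= 2 * (T / (n.+1%:R * (n.+1%:R + T))).
  apply: (@le_trans _ _ (damp R n * (2 * (T * damp R n) / (1 + T * damp R n)))).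
    by rewrite ler_wpM2l ?invr_ge0// one_sub_expN_sq.
  rewrite le_eqVlt; apply/orP; left; apply/eqP; rewrite /damp.
  have : (0 : R) < n.+1%:R by []. move: (n.+1%:R) => x x0.
  by field; rewrite !lt0r_neq0//; apply: ltr_pwDl.
move=> /le_trans; apply; move: h.
by move: (ln _) (ln _) (ln _) (T / _) => ? ? ? ? ?; lra.
Qed.

End telescope_log.

(** * Damped trigonometric sums *)

Section damped_integral.
Variable R : realType.
Local Notation mu := (@lebesgue_measure R).

Definition damped_cos (a l x : R) : R := expR (- (a * x)) * cos (x * l).
(** The real part of e^((-a + i l) x) / (-a + i l). *)
Definition damped_prim (a l x : R) : R :=
  expR (- (a * x)) * (l * sin (x * l) - a * cos (x * l)) / (a ^+ 2 + l ^+ 2).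

Lemma is_derive_damped_prim (a l x : R) : 0 < a ->
  is_derive x 1 (damped_prim a l) (damped_cos a l x).
Proof.
move=> a0; have D0 : a ^+ 2 + l ^+ 2 != 0 by rewrite lt0r_neq0// ltr_wpDr ?sqr_ge0// exprn_gt0.
have lin (c : R) : is_derive x 1 (fun y : R => c * y) c.
  by have := is_deriveZ c (is_derive_id x (1 : R)); rewrite /GRing.scale/= mulr1.
have dE : is_derive x 1 (expR \o (fun y => - a * y)) (expR (- a * x) * - a).
  exact: is_derive1_comp.
have dS : is_derive x 1 (sin \o (fun y => l * y)) (cos (l * x) * l) by exact: is_derive1_comp.
have dC : is_derive x 1 (cos \o (fun y => l * y)) (- sin (l * x) * l) by exact: is_derive1_comp.
have -> : damped_prim a l = ((a ^+ 2 + l ^+ 2)^-1) \*: ((expR \o (fun y => - a * y)) *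
    ((l \*: (sin \o (fun y => l * y))) - (a \*: (cos \o (fun y => l * y))))).
  by apply/funext => y; rewrite /damped_prim mulrC (mulrC y) -mulNr.
have h := is_deriveZ (a ^+ 2 + l ^+ 2)^-1
  (is_deriveM dE (is_deriveB (is_deriveZ l dS) (is_deriveZ a dC))).
apply: (is_derive_eq h); rewrite /damped_cos -mulNr (mulrC x l) /GRing.scale/=.
rewrite -[((l \*: _) - _) x]/(l * sin (l * x) - a * cos (l * x)).
by rewrite -(mulNr a x); field.
Qed.

Lemma continuous_damped_cos a l : continuous (damped_cos a l).
Proof.
move=> x; rewrite /damped_cos; apply: cvgM.
  apply: (@cvg_comp _ _ _ (fun x => - (a * x)) expR); last exact: continuous_expR.
  by apply: cvgN; apply: cvgM; [exact: cvg_cst|exact: cvg_id].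
apply: (@cvg_comp _ _ _ (fun x => x * l) cos); last exact: continuous_cos.
by apply: cvgM; [exact: cvg_id|exact: cvg_cst].
Qed.

Lemma damped_prim_cvg a l : 0 < a -> damped_prim a l x @[x --> +oo] --> 0.
Proof.
move=> a0; have D0 : 0 < a ^+ 2 + l ^+ 2 by rewrite ltr_wpDr ?sqr_ge0// exprn_gt0.
pose K := (`|l| + a) / (a ^+ 2 + l ^+ 2).
have hE : K * expR (- (a * x)) @[x --> +oo] --> 0.
  rewrite -[X in _ --> X](mulr0 K); apply: cvgM; first exact: cvg_cst.
  apply: (cvg_comp (fun x => a * x) (fun x => expR (- x))); last exact: cvgr_expR.
  by apply: gt0_cvgMry.
have hP x : `|damped_prim a l x| <= K * expR (- (a * x)).
  rewrite /damped_prim /K [leRHS]mulrAC [leRHS]mulrC [leRHS]mulrC ler_pdivlMr//.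
  rewrite !normrM normfV (gtr0_norm D0) divfK ?lt0r_neq0// ger0_norm ?expR_ge0//.
  rewrite mulrC ler_wpM2r ?expR_ge0//.
  apply: (le_trans (ler_normB _ _)); rewrite !normrM (gtr0_norm a0).
  apply: lerD; first by rewrite ler_piMr// sin_max.
  by rewrite ler_piMr ?cos_max// ltW.
apply/cvgrPdist_le => e e0; move/cvgrPdist_le : hE => /(_ _ e0); apply: filterS => x.
by rewrite !sub0r !normrN => /(le_trans (ler_norm _)); apply: le_trans.
Qed.

(** The double sum is integrated as a whole: single terms change sign, whereas the fundamental
    theorem on the half-line is applied to a nonnegative function. Evenness accounts for the factor
    2. *)
Lemma integral_damped_sum N (c a l : 'I_N -> 'I_N -> R) (g : R -> R) :
  (forall n m, 0 < a n m) -> (forall x, 0 <= g x) -> continuous g -> g =1 g \o -%R ->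
  (forall x, 0 <= x -> g x = \sum_n \sum_m c n m * damped_cos (a n m) (l n m) x) ->
  (\int[mu]_x (g x)%:E =
    (\sum_n \sum_m c n m * (2 * a n m / (a n m ^+ 2 + l n m ^+ 2)))%:E)%E.
Proof.
move=> a0 g0 cg gN gE; rewrite ge0_symfun_integralT//.
pose P (x : R) : R := \sum_n \sum_m c n m * damped_prim (a n m) (l n m) x.
have dP (x : R) : is_derive x 1 P (\sum_n \sum_m c n m * damped_cos (a n m) (l n m) x).
  have -> : P = \sum_n \sum_m (c n m \*: damped_prim (a n m) (l n m)).
    by apply/funext => y; rewrite fct_sumE; apply: eq_bigr => n _; rewrite fct_sumE.
  apply: is_derive_sum => n; apply: is_derive_sum => m.
  exact: is_deriveZ (is_derive_damped_prim _ _ _).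
have -> : [set x : R | 0 <= x] = `[0, +oo[%classic.
  by apply/seteqP; split => x /=; rewrite in_itv/= andbT.
rewrite (@ge0_continuous_FTC2y _ g P 0 0) //.
- rewrite sub0e -EFinN -EFinM; congr EFin; rewrite /P -sumrN mulr_sumr; apply: eq_bigr => n _.
  rewrite -sumrN mulr_sumr; apply: eq_bigr => m _.
  by rewrite /damped_prim mulr0 mul0r oppr0 expR0 sin0 cos0; ring.
- exact: continuous_subspaceT.
- rewrite [X in _ --> X](_ : _ = \sum_(n < N) \sum_(m < N) (c n m * 0)); last first.
    by rewrite big1// => n _; rewrite big1// => m _; rewrite mulr0.
  apply: cvg_sumr => n; apply: cvg_sumr => m; apply: cvgM; first exact: cvg_cst.
  exact: damped_prim_cvg.
- by apply: cvg_at_right_filter; apply: differentiable_continuous; apply/derivable1_diffP.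
- move=> x; rewrite in_itv/= andbT => x0; rewrite derive1E derive_val gE// ltW//.
Qed.

End damped_integral.

Section trig_sums.
Variable R : realType.
Implicit Types (p q u : nat -> R) (t : R).

Definition cos_sum N p u t := \sum_(n < N) p n * cos (t * u n).
Definition sin_sum N p u t := \sum_(n < N) p n * sin (t * u n).

Lemma sqr_sum N (x : 'I_N -> R) : (\sum_n x n) ^+ 2 = \sum_n \sum_m x n * x m.
Proof. by rewrite expr2 mulr_suml; apply: eq_bigr => n _; rewrite mulr_sumr. Qed.

(** The squared modulus of the sum of (p n + i q n) e^(i t u n), expanded. *)
Lemma trig_sum_sq N p q u t :
  (cos_sum N p u t - sin_sum N q u t) ^+ 2 + (cos_sum N q u t + sin_sum N p u t) ^+ 2 =
  \sum_(n < N) \sum_(m < N) ((p n * p m + q n * q m) * cos (t * (u n - u m)) +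
                             (p n * q m - q n * p m) * sin (t * (u n - u m))).
Proof.
rewrite /cos_sum /sin_sum -sumrB -big_split !sqr_sum -big_split; apply: eq_bigr => n _.
rewrite -big_split; apply: eq_bigr => m _ /=.
by rewrite [t * (_ - _)]mulrBr cosB sinB; ring.
Qed.

Lemma trig_sum_sq_real N p u t :
  cos_sum N p u t ^+ 2 + sin_sum N p u t ^+ 2 =
  \sum_(n < N) \sum_(m < N) p n * p m * cos (t * (u n - u m)).
Proof.
have s0 : sin_sum N (fun=> 0) u t = 0 by apply: big1 => n _; rewrite mul0r.
have c0 : cos_sum N (fun=> 0) u t = 0 by apply: big1 => n _; rewrite mul0r.
have := trig_sum_sq N p (fun=> 0) u t; rewrite s0 c0 subr0 add0r => ->.
by apply: eq_bigr => n _; apply: eq_bigr => m _; ring.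
Qed.

Lemma sum_CS N (P : pred 'I_N) (x y : 'I_N -> R) :
  (\sum_(n | P n) x n * y n) ^+ 2 <= (\sum_(n | P n) x n ^+ 2) * (\sum_(n | P n) y n ^+ 2).
Proof.
apply: quad_disc => t.
have -> : (\sum_(n | P n) x n ^+ 2) * t ^+ 2 + 2 * (\sum_(n | P n) x n * y n) * t +
    \sum_(n | P n) y n ^+ 2 = \sum_(n | P n) (t * x n + y n) ^+ 2.
  rewrite mulr_suml -mulrA mulr_suml mulr_sumr -!big_split.
  by apply: eq_bigr => n _ /=; ring.
by apply: sumr_ge0 => n _; exact: sqr_ge0.
Qed.

Lemma trig_sum_le N p u t : `|cos_sum N p u t| <= \sum_(n < N) `|p n| /\
  `|sin_sum N p u t| <= \sum_(n < N) `|p n|.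
Proof.
split; apply: (le_trans (ler_norm_sum _ _ _)); apply: ler_sum => n _; rewrite normrM ler_piMr//.
  exact: cos_max.
exact: sin_max.
Qed.

End trig_sums.

Section form_bound.
Variables (R : realType) (alpha : R).
Hypothesis alpha_gt0 : 0 < alpha.
Implicit Types (b : nat -> R) (t : R).

Local Notation mu := (@lebesgue_measure R).
Local Notation L1 f := (mu.-integrable [set: R] (EFin \o f)).
Local Notation damp := (@damp R).
Local Notation freq := (@freq R).
Local Notation wgt := (@wgt R).

Definition scaled_freq n := alpha * freq n.
Definition damping t n := expR (- (alpha * `|t| * damp n)).
(** The squared modulus from the integral representation, for real coefficients; complex vectors are
    split into real and imaginary parts by [complex_trig_form_le]. *)
Definition trig_form N b t := cos_sum N (fun n => b n * wgt n) scaled_freq t ^+ 2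
  + sin_sum N (fun n => b n * wgt n) scaled_freq t ^+ 2.
Definition damped_form N b t := cos_sum N (fun n => b n * wgt n * damping t n) scaled_freq t ^+ 2
  + sin_sum N (fun n => b n * wgt n * damping t n) scaled_freq t ^+ 2.
Definition log_tail N0 t := ln (1 + alpha * `|t| / N0%:R).

(** Cauchy-Schwarz is applied to cosines and sines separately, and cos^2 + sin^2 = 1 recombines the
    errors. The 4 is the 2 of x^2 <= 2 x'^2 + 2 (x - x')^2 times the 2 of [damping_error_sum]. *)
Lemma trig_form_le N N0 b t : (0 < N0)%N -> (forall n, (n < N0)%N -> b n = 0) ->
  trig_form N b t <= 2 * damped_form N b t + 4 * (\sum_(n < N) b n ^+ 2) * log_tail N0 t.
Proof.
move=> N00 b0.
pose y n := wgt n * (1 - damping t n).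
have cs (k : nat -> R) : (\sum_(n < N) b n * wgt n * k n - \sum_(n < N) b n * wgt n * damping t n * k n) ^+ 2
    <= (\sum_(n < N) b n ^+ 2) * \sum_(n < N | (N0 <= n)%N) (y n * k n) ^+ 2.
  rewrite -sumrB (eq_bigr (fun n : 'I_N => b n * (y n * k n))); last first.
    by move=> n _; rewrite /y; ring.
  rewrite (bigID (fun n : 'I_N => N0 <= n)%N)/= [X in _ + X]big1 ?addr0; last first.
    by move=> n; rewrite -ltnNge => nN; rewrite b0// mul0r.
  apply: (le_trans (sum_CS _ _ _)); rewrite ler_wpM2r ?sumr_ge0//.
    by move=> n _; exact: sqr_ge0.
  by rewrite [leRHS](bigID (fun n : 'I_N => N0 <= n)%N)/= lerDl sumr_ge0// => n _; exact: sqr_ge0.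
have hc := cs (fun n => cos (t * scaled_freq n)); have hs := cs (fun n => sin (t * scaled_freq n)).
have hy : \sum_(n < N | (N0 <= n)%N) (y n * cos (t * scaled_freq n)) ^+ 2 +
    \sum_(n < N | (N0 <= n)%N) (y n * sin (t * scaled_freq n)) ^+ 2 <= 2 * log_tail N0 t.
  rewrite -big_split/=; have T0 : 0 <= alpha * `|t| by rewrite mulr_ge0// ltW.
  apply: le_trans (damping_error_sum N T0 N00).
  apply: ler_sum => n _; rewrite !exprMn -mulrDr cos2Dsin2 mulr1 wgt_sq.
  by rewrite /damping.
have B0 : 0 <= \sum_(n < N) b n ^+ 2 by apply: sumr_ge0 => n _; exact: sqr_ge0.
have := ler_wpM2l B0 hy; rewrite mulrDr.
move: hc hs; rewrite -/(cos_sum N (fun n => b n * wgt n) scaled_freq t)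
  -/(cos_sum N (fun n => b n * wgt n * damping t n) scaled_freq t)
  -/(sin_sum N (fun n => b n * wgt n) scaled_freq t)
  -/(sin_sum N (fun n => b n * wgt n * damping t n) scaled_freq t) /trig_form /damped_form.
have sq2 (x x' : R) : x ^+ 2 <= 2 * x' ^+ 2 + 2 * (x - x') ^+ 2.
  by rewrite -subr_ge0; have := sqr_ge0 (x - 2 * x'); congr (_ <= _); ring.
move: (cos_sum N _ _ _) (cos_sum N _ _ _) (sin_sum N _ _ _) (sin_sum N _ _ _) => x' x z' z hx hz.
have := sq2 x x'; have := sq2 z z'.
move=> h1 h2; rewrite [X in _ <= X -> _]mulrCA -(mulrA 4) => h5; move: hx hz h5.
by move: (_ * log_tail _ _) (_ * \sum_(_ < _ | _) _) (_ * \sum_(_ < _ | _) _) => ? ? ? ? ? ?; lra.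
Qed.

Lemma damped_formE N b t : damped_form N b t = \sum_(n < N) \sum_(m < N)
  b n * b m * (wgt n * wgt m) * damped_cos (alpha * (damp n + damp m)) (alpha * (freq n - freq m)) `|t|.
Proof.
rewrite /damped_form trig_sum_sq_real; apply: eq_bigr => n _; apply: eq_bigr => m _.
rewrite /damped_cos /scaled_freq -mulrBr.
have -> : cos (`|t| * (alpha * (freq n - freq m))) = cos (t * (alpha * (freq n - freq m))).
  by case: (ger0P t) => // _; rewrite mulNr cosN.
have -> : expR (- (alpha * (damp n + damp m) * `|t|)) = damping t n * damping t m.
  by rewrite /damping -expRD; congr expR; ring.
by ring.
Qed.

Lemma damped_form_ge0 N b t : 0 <= damped_form N b t.
Proof. by rewrite /damped_form addr_ge0 ?sqr_ge0. Qed.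

Lemma continuous_damped_form N b : continuous (damped_form N b).
Proof.
rewrite (_ : damped_form N b = fun t => \sum_(n < N) \sum_(m < N)
  b n * b m * (wgt n * wgt m) * damped_cos (alpha * (damp n + damp m)) (alpha * (freq n - freq m)) `|t|); last first.
  by apply/funext => t; exact: damped_formE.
move=> t; apply: cvg_sumr => n; apply: cvg_sumr => m; apply: cvgM; first exact: cvg_cst.
apply: (@cvg_comp _ _ _ (fun x : R => `|x|)); last exact: continuous_damped_cos.
exact: norm_continuous.
Qed.

(** Rates and frequencies all carry the factor alpha, and 2 a / (a^2 + l^2) is homogeneous of degree
    -1. *)
Lemma integral_damped_form_le N b : (\int[mu]_t (damped_form N b t)%:E <=
  (alpha^-1 * (schur_const R * \sum_(n < N) b n ^+ 2))%:E)%E.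
Proof.
rewrite (@integral_damped_sum _ N (fun n m => b n * b m * (wgt n * wgt m))
  (fun n m => alpha * (damp n + damp m)) (fun n m => alpha * (freq n - freq m))).
- rewrite lee_fin; apply: (@le_trans _ _ (alpha^-1 * \sum_(n < N) \sum_(m < N)
      b n * b m * (wgt n * wgt m) * gram R n m)); last first.
    by rewrite ler_wpM2l ?invr_ge0 ?(ltW alpha_gt0)//; exact: schur_bound.
  rewrite mulr_sumr le_eqVlt; apply/orP; left; apply/eqP; apply: eq_bigr => n _.
  rewrite mulr_sumr; apply: eq_bigr => m _; rewrite /gram.
  have h : 0 < (damp n + damp m) ^+ 2 + (freq n - freq m) ^+ 2.
    by rewrite ltr_wpDr ?sqr_ge0// exprn_gt0// addr_gt0// /damp invr_gt0.
  move: (damp n + damp m) (freq n - freq m) h => x y h.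
  field; rewrite (lt0r_neq0 alpha_gt0) (lt0r_neq0 h) /=.
  by rewrite lt0r_neq0// !exprMn -mulrDr mulr_gt0// exprn_gt0.
- by move=> n m; rewrite mulr_gt0// addr_gt0// /damp invr_gt0.
- exact: damped_form_ge0.
- exact: continuous_damped_form.
- by move=> t; rewrite /= !damped_formE normrN.
- by move=> t t0; rewrite damped_formE ger0_norm.
Qed.

End form_bound.

Section Rintegral_sum.
Variable R : realType.
Local Notation mu := (@lebesgue_measure R).
Local Notation L1 f := (mu.-integrable [set: R] (EFin \o f)).

Lemma L1_cst_mul (c : R) (f : R -> R) : L1 f -> L1 (fun t => c * f t).
Proof. by move=> fi; have := integrableZl measurableT c fi. Qed.

Lemma L1_Rintegral_sum I (s : seq I) (f : I -> R -> R) : (forall i, L1 (f i)) ->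
  L1 (fun t => \sum_(i <- s) f i t) /\
  \int[mu]_t (\sum_(i <- s) f i t) = \sum_(i <- s) \int[mu]_t f i t.
Proof.
move=> fi; elim: s => [|i s [ih1 ih2]].
  split; first by under eq_fun do rewrite big_nil; exact: integrable0.
  by rewrite big_nil; under eq_Rintegral do rewrite big_nil; rewrite Rintegral_cst// mul0r.
split; first by under eq_fun do rewrite big_cons; exact: L1_add.
rewrite big_cons; under eq_Rintegral do rewrite big_cons.
by rewrite RintegralD// ih2.
Qed.

End Rintegral_sum.

(** * The form of the arithmetic kernel *)

Section symbol.
Variables (R : realType) (f : R -> R) (B alpha : R).
Local Notation mu := (@lebesgue_measure R).
Local Notation L1 f := (mu.-integrable [set: R] (EFin \o f)).
Hypothesis alpha_gt0 : 0 < alpha.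
Hypothesis fL1 : L1 f.
Hypothesis f0B : forall t, 0 <= f t <= B.
Hypothesis flog : L1 (fun t => f t * ln (2 + `|t|)).

Let mf : measurable_fun [set: R] f.
Proof. by case/integrableP : fL1 => /measurable_EFinP. Qed.

Let f0 t : 0 <= f t. Proof. by case/andP: (f0B t). Qed.

Let measurable_log_tail N0 : measurable_fun [set: R] (log_tail alpha N0).
Proof.
apply: measurableT_comp; first exact: measurable_ln.
apply: measurable_funD => //; apply: measurable_funM => //; apply: measurable_funM => //.
Qed.

Lemma log_tail_ge0 N0 t : 0 <= log_tail alpha N0 t.
Proof. by rewrite /log_tail ln_ge0// lerDl divr_ge0// mulr_ge0// ltW. Qed.

Let log_tail_le1 N0 t : (0 < N0)%N -> log_tail alpha N0 t <= log_tail alpha 1 t.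
Proof.
move=> N00; have at0 : 0 <= alpha * `|t| by rewrite mulr_ge0// ltW.
rewrite /log_tail ler_ln ?posrE ?ltr_wpDr ?divr_ge0//.
by rewrite lerD2l ler_wpM2l// lef_pV2 ?posrE ?ltr0n// ler_nat.
Qed.

Let log_tail_le t : log_tail alpha 1 t <= ln (1 + alpha) + ln (2 + `|t|).
Proof.
have at0 : 0 <= alpha * `|t| by rewrite mulr_ge0// ltW.
rewrite /log_tail divr1 -lnM ?posrE; [|by rewrite addr_gt0|by rewrite ltr_wpDr].
have h1 : 0 < 1 + alpha * `|t| by rewrite ltr_wpDr.
have h2 : 0 < (1 + alpha) * (2 + `|t|) by apply: mulr_gt0; [exact: addr_gt0|exact: ltr_wpDr].
rewrite ler_ln ?posrE//.
move: (normr_ge0 t); move: (`|t|) => T T0; rewrite -subr_ge0.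
have -> : (1 + alpha) * (2 + T) - (1 + alpha * T) = 1 + T + 2 * alpha by ring.
by rewrite addr_ge0 ?addr_ge0// mulr_ge0// ltW.
Qed.

Lemma L1_log_tail N0 : (0 < N0)%N -> L1 (fun t => f t * log_tail alpha N0 t).
Proof.
move=> N00.
apply: (@le_integrable _ _ _ mu _ measurableT _ (EFin \o (fun t => ln (1 + alpha) * f t + f t * ln (2 + `|t|)))).
- by apply/measurable_EFinP; apply: measurable_funM => //; exact: measurable_log_tail.
- move=> t _ /=; rewrite lee_fin ger0_norm ?mulr_ge0 ?log_tail_ge0//.
  apply: le_trans (ler_norm _); rewrite (mulrC (ln _)) -mulrDr ler_wpM2l//.
  exact: le_trans (log_tail_le1 _ N00) (log_tail_le t).
- by apply: L1_add => //; exact: L1_cst_mul.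
Qed.

(** Dominated convergence at fixed alpha, with the case [N0 = 1] as dominating function; [N0]
    depends on alpha. *)
Lemma log_tail_small (e : R) : 0 < e -> exists2 N0, (0 < N0)%N & \int[mu]_t (f t * log_tail alpha N0 t) <= e.
Proof.
move=> e0.
pose F n (t : R) : \bar R := (f t * log_tail alpha n.+1 t)%:E.
have [] := @dominated_convergence _ _ _ mu _ measurableT F (cst 0) (F 0).
- by move=> n; apply/measurable_EFinP; apply: measurable_funM => //; exact: measurable_log_tail.
- exact: measurable_cst.
- apply: aeW => t _; apply/cvg_EFin; first exact: nearW.
  rewrite (_ : 0 = f t * 0); last by rewrite mulr0.
  apply: cvgM; first exact: cvg_cst.
  apply: (@squeeze_cvgr _ _ _ _ (cst 0) (fun n => alpha * `|t| * harmonic n)).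
  + apply: nearW => n; rewrite log_tail_ge0/= /log_tail.
    have at0 : 0 <= alpha * `|t| / n.+1%:R by rewrite divr_ge0// mulr_ge0// ltW.
    by apply: le_trans (ln_le_sub1 _) _; [rewrite ltr_wpDr|rewrite addrAC subrr add0r].
  + exact: cvg_cst.
  + by rewrite -[X in _ --> X](mulr0 (alpha * `|t|)); apply: cvgM; [exact: cvg_cst|exact: cvg_harmonic].
- exact: (@L1_log_tail 1).
- apply: aeW => t n _; rewrite /F /= lee_fin ger0_norm ?mulr_ge0 ?log_tail_ge0// ler_wpM2l//.
  exact: log_tail_le1.
move=> _ _ h; rewrite integral_cst// mul0e in h.
have [n [_ hn]] := cvge0_small h e0; exists n.+1 => //.
exact: le_trans (ler_norm _) hn.
Qed.

Let measurable_trig (h : R -> R) (c : R) : continuous h -> measurable_fun [set: R] (fun t => h (t * c)).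
Proof.
move=> ch; apply: measurableT_comp; first exact: continuous_measurable_fun.
exact: measurable_funM.
Qed.

Lemma L1_cos c : L1 (fun t => f t * cos (t * c)).
Proof.
apply: L1_mul => //; first by apply: measurable_trig; exact: continuous_cos.
by exists 1 => x; exact: cos_max.
Qed.

Lemma L1_sin c : L1 (fun t => f t * sin (t * c)).
Proof.
apply: L1_mul => //; first by apply: measurable_trig; exact: continuous_sin.
by exists 1 => x; exact: sin_max.
Qed.

Lemma L1_trig_form N b : L1 (fun t => f t * trig_form alpha N b t).
Proof.
rewrite (_ : (fun t => _) = fun t => \sum_(n < N) \sum_(m < N)
    (b n * wgt R n * (b m * wgt R m)) * (f t * cos (t * (scaled_freq alpha n - scaled_freq alpha m)))).
  apply: (L1_Rintegral_sum _ _).1 => n; apply: (L1_Rintegral_sum _ _).1 => m.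
  exact/L1_cst_mul/L1_cos.
apply/funext => t; rewrite /trig_form trig_sum_sq_real mulr_sumr; apply: eq_bigr => n _.
by rewrite mulr_sumr; apply: eq_bigr => m _; ring.
Qed.

(** The first coefficient is made small by alpha, the second by [N0] once alpha is fixed. *)
Lemma integral_trig_form_le N N0 b : (0 < N0)%N -> (forall n, (n < N0)%N -> b n = 0) ->
  \int[mu]_t (f t * trig_form alpha N b t) <=
  (2 * B * alpha^-1 * schur_const R + 4 * \int[mu]_t (f t * log_tail alpha N0 t)) * \sum_(n < N) b n ^+ 2.
Proof.
move=> N00 b0.
have mD : measurable_fun [set: R] (damped_form alpha N b).
  by apply: continuous_measurable_fun; exact: continuous_damped_form.
have Dbnd : exists C, forall t, `|damped_form alpha N b t| <= C.
  pose S := \sum_(n < N) `|b n * wgt R n|.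
  exists (S ^+ 2 + S ^+ 2) => t; rewrite ger0_norm ?damped_form_ge0// /damped_form.
  have [h1 h2] := @trig_sum_le R N (fun n => b n * wgt R n * damping alpha t n) (scaled_freq alpha) t.
  have hS : \sum_(n < N) `|b n * wgt R n * damping alpha t n| <= S.
    apply: ler_sum => n _; rewrite normrM ler_piMr// ger0_norm ?expR_ge0//.
    rewrite /damping -expR0 ler_expR oppr_le0 mulr_ge0//; first by rewrite mulr_ge0// ltW.
    by rewrite invr_ge0.
  have sq (x : R) : `|x| <= S -> x ^+ 2 <= S ^+ 2.
    by move=> xS; rewrite -(real_normK (num_real x)) ler_sqr ?nnegrE ?(le_trans _ xS).
  by apply: lerD; apply: sq; [exact: le_trans h1 hS|exact: le_trans h2 hS].
have fD : L1 (fun t => f t * damped_form alpha N b t) by exact: L1_mul.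
have B0 : 0 <= B by case/andP: (f0B 0) => h1 h2; exact: le_trans h1 h2.
have hD : \int[mu]_t (f t * damped_form alpha N b t) <= B * (alpha^-1 * (schur_const R * \sum_(n < N) b n ^+ 2)).
  rewrite -lee_fin EFinM; apply: (@le_trans _ _ (B%:E * \int[mu]_t (damped_form alpha N b t)%:E)%E); last first.
    by rewrite lee_wpmul2l ?lee_fin//; exact: integral_damped_form_le.
  rewrite /Rintegral fineK; last exact: integrable_fin_num.
  rewrite -ge0_integralZl//; last 2 first.
  - exact/measurable_EFinP.
  - by move=> t _; rewrite lee_fin damped_form_ge0.
  apply: ge0_le_integral => //.
  - by move=> t _; rewrite lee_fin mulr_ge0// damped_form_ge0.
  - by apply/measurable_EFinP; exact: measurable_funM.
  - by apply/measurable_EFinP; exact: measurable_funM.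
  - by move=> t _; rewrite -EFinM lee_fin ler_wpM2r ?damped_form_ge0//; case/andP: (f0B t).
have fl := L1_log_tail N00.
set S := \sum_(n < N) b n ^+ 2 in hD *.
have : \int[mu]_t (f t * trig_form alpha N b t) <=
    \int[mu]_t (2 * (f t * damped_form alpha N b t) + 4 * S * (f t * log_tail alpha N0 t)).
  apply: le_Rintegral => //.
  - exact: L1_trig_form.
  - by apply: L1_add; exact: L1_cst_mul.
  - move=> t _; apply: (@le_trans _ _ (f t * (2 * damped_form alpha N b t + 4 * S * log_tail alpha N0 t))).
      by rewrite ler_wpM2l//; exact: trig_form_le.
    by rewrite le_eqVlt; apply/orP; left; apply/eqP; ring.
rewrite RintegralD//; [|exact: L1_cst_mul|exact: L1_cst_mul].
rewrite !RintegralZl// => /le_trans; apply.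
rewrite [leRHS]mulrDl; apply: lerD; last by rewrite mulrAC.
by have := ler_wpM2l (ler0n R 2) hD; congr (_ <= _); ring.
Qed.

(** Covers the coordinate of index 0, which the damped estimate with [0 < N0] leaves out. *)
Lemma integral_trig_form_head N b : (forall n, (0 < n)%N -> b n = 0) ->
  \int[mu]_t (f t * trig_form alpha N b t) <= 2 * (\int[mu]_t f t) * \sum_(n < N) b n ^+ 2.
Proof.
move=> b0; set S := \sum_(n < N) b n ^+ 2.
have p2 t : trig_form alpha N b t <= 2 * S.
  have [h1 h2] := @trig_sum_le R N (fun n => b n * wgt R n) (scaled_freq alpha) t.
  have hS' M : (\sum_(n < M) `|b n * wgt R n|) ^+ 2 <= \sum_(n < M) b n ^+ 2.
    case: M => [|M]; first by rewrite !big_ord0 expr0n.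
    rewrite !big_ord_recl !big1 ?addr0; last 2 first.
    - by move=> i _; rewrite b0// expr0n.
    - by move=> i _; rewrite b0// mul0r normr0.
    by rewrite /wgt /damp invr1 sqrtr1 mulr1 real_normK ?num_real.
  have hS := hS' N; rewrite -/S in hS.
  have sq (x y : R) : `|x| <= y -> x ^+ 2 <= y ^+ 2.
    by move=> xy; rewrite -(real_normK (num_real x)) ler_sqr ?nnegrE ?(le_trans _ xy).
  have := sq _ _ h1; have := sq _ _ h2; rewrite /trig_form; lra.
apply: (@le_trans _ _ (\int[mu]_t (2 * S * f t))).
  apply: le_Rintegral => //; [exact: L1_trig_form|exact: L1_cst_mul|].
  by move=> t _; rewrite mulrC ler_wpM2r.
by rewrite RintegralZl// mulrAC.
Qed.

End symbol.

Section symbol_kernel.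
Variables (R : realType) (f : R -> R) (B alpha : R).
Local Notation mu := (@lebesgue_measure R).
Local Notation L1 f := (mu.-integrable [set: R] (EFin \o f)).
Hypothesis alpha_gt0 : 0 < alpha.
Hypothesis fL1 : L1 f.
Hypothesis f0B : forall t, 0 <= f t <= B.
Hypothesis flog : L1 (fun t => f t * ln (2 + `|t|)).

Definition dilated_kernel (n m : nat) : R[i] :=
  ((Num.sqrt (n.+1%:R * m.+1%:R))^-1)%:C * fourier f (alpha * ln (n.+1%:R / m.+1%:R)).

(* The squared modulus of the sum over n < N of
   u n * wgt n * e^(i t scaled_freq n). *)
Definition complex_trig_form N (u : nat -> R[i]) t : R :=
  (cos_sum N (fun n => Re (u n) * wgt R n) (scaled_freq alpha) t -
   sin_sum N (fun n => Im (u n) * wgt R n) (scaled_freq alpha) t) ^+ 2 +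
  (cos_sum N (fun n => Im (u n) * wgt R n) (scaled_freq alpha) t +
   sin_sum N (fun n => Re (u n) * wgt R n) (scaled_freq alpha) t) ^+ 2.

Lemma dilated_kernelE n m : dilated_kernel n m = (wgt R n * wgt R m * (2 * pi)^-1)%:C *
  ((\int[mu]_t (f t * cos (t * (scaled_freq alpha n - scaled_freq alpha m)))) -i*
   (\int[mu]_t (f t * sin (t * (scaled_freq alpha n - scaled_freq alpha m))))).
Proof.
rewrite /dilated_kernel /fourier mulrA; congr (_ * _).
  rewrite -rmorphM; congr (_%:C); congr (_ * _).
  by rewrite /wgt /damp !sqrtrV// -invfM sqrtrM// mulrC.
have -> : alpha * ln (n.+1%:R / m.+1%:R) = scaled_freq alpha n - scaled_freq alpha m.
  by rewrite /scaled_freq /freq -mulrBr ln_div ?posrE.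
by [].
Qed.

Lemma dilated_kernel_herm n m : dilated_kernel m n = conjc (dilated_kernel n m).
Proof.
have conjM (r : R) (z : R[i]) : conjc (r%:C * z) = r%:C * conjc z.
  by case: z => x y; apply/eqP; rewrite eq_complex /=; apply/andP; split; apply/eqP; ring.
rewrite !dilated_kernelE conjM (mulrC (wgt R m)); congr (_ * _).
rewrite /conjc opprK; congr (_ +i* _).
  by apply: eq_Rintegral => t _; rewrite -(opprB (scaled_freq alpha n)) mulrN cosN.
rewrite -mulN1r -RintegralZl//; last exact: L1_sin.
apply: eq_Rintegral => t _; rewrite -(opprB (scaled_freq alpha n)) mulrN sinN; ring.
Qed.

Lemma complex_trig_form_ge0 N u t : 0 <= complex_trig_form N u t.
Proof. by rewrite addr_ge0 ?sqr_ge0. Qed.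

Lemma complex_trig_form_le N u t : complex_trig_form N u t <=
  2 * trig_form alpha N (fun n => Re (u n)) t + 2 * trig_form alpha N (fun n => Im (u n)) t.
Proof.
rewrite /complex_trig_form /trig_form.
set a := cos_sum _ _ _ _; set b := sin_sum _ _ _ _; set c := cos_sum _ _ _ _; set d := sin_sum _ _ _ _.
have := sqr_ge0 (a + b); have := sqr_ge0 (c - d); rewrite !(sqrrB, sqrrD); lra.
Qed.

Let zterm (u : nat -> R[i]) n m t :=
  (Re (u n) * wgt R n * (Re (u m) * wgt R m) + Im (u n) * wgt R n * (Im (u m) * wgt R m)) *
    (f t * cos (t * (scaled_freq alpha n - scaled_freq alpha m))) +
  (Re (u n) * wgt R n * (Im (u m) * wgt R m) - Im (u n) * wgt R n * (Re (u m) * wgt R m)) *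
    (f t * sin (t * (scaled_freq alpha n - scaled_freq alpha m))).

Let complex_trig_formE N u t : f t * complex_trig_form N u t = \sum_(n < N) \sum_(m < N) zterm u n m t.
Proof.
rewrite /complex_trig_form trig_sum_sq mulr_sumr; apply: eq_bigr => n _; rewrite mulr_sumr.
by apply: eq_bigr => m _; rewrite /zterm; ring.
Qed.

Let L1_zterm u n m : L1 (zterm u n m).
Proof. by apply: L1_add; apply: L1_cst_mul; [exact: L1_cos|exact: L1_sin]. Qed.

Lemma L1_complex_trig_form N u : L1 (fun t => f t * complex_trig_form N u t).
Proof.
rewrite (_ : (fun t => _) = fun t => \sum_(n < N) \sum_(m < N) zterm u n m t); last first.
  by apply/funext => t; exact: complex_trig_formE.
by apply: (L1_Rintegral_sum _ _).1 => n; apply: (L1_Rintegral_sum _ _).1 => m.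
Qed.

Lemma kform_dilated N u : kform dilated_kernel N u u = (2 * pi)^-1 * \int[mu]_t (f t * complex_trig_form N u t).
Proof.
under eq_Rintegral do rewrite complex_trig_formE.
rewrite (L1_Rintegral_sum _ _).2 => [|n]; last first.
  by apply: (L1_Rintegral_sum _ _).1 => m.
rewrite mulr_sumr; apply: eq_bigr => n _; rewrite (L1_Rintegral_sum _ _).2//.
rewrite dotc_suml mulr_sumr; apply: eq_bigr => m _.
rewrite dilated_kernelE /zterm RintegralD//; [|exact/L1_cst_mul/L1_cos|exact/L1_cst_mul/L1_sin].
rewrite !RintegralZl//; [|exact: L1_sin|exact: L1_cos].
move: (\int[mu]_t _) (\int[mu]_t _) => C S; rewrite -mulrA dotcZl.
case: (u n) (u m) => a b [c d]; rewrite /dotc /=; ring.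
Qed.

Lemma kform_dilated_ge0 N u : 0 <= kform dilated_kernel N u u.
Proof.
rewrite kform_dilated mulr_ge0 ?invr_ge0 ?mulr_ge0 ?pi_ge0//; apply: Rintegral_ge0 => t _.
by rewrite mulr_ge0 ?complex_trig_form_ge0//; case/andP: (f0B t).
Qed.

Let ksqE N (u : nat -> R[i]) :
  ksq N u = \sum_(n < N) Re (u n) ^+ 2 + \sum_(n < N) Im (u n) ^+ 2.
Proof. by rewrite -big_split; apply: eq_bigr => n _; rewrite /dotc -!expr2. Qed.

Let kform_trig_form_le N (u : nat -> R[i]) (D : R) :
  \int[mu]_t (f t * trig_form alpha N (fun n => Re (u n)) t) <= D * \sum_(n < N) Re (u n) ^+ 2 ->
  \int[mu]_t (f t * trig_form alpha N (fun n => Im (u n)) t) <= D * \sum_(n < N) Im (u n) ^+ 2 ->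
  kform dilated_kernel N u u <= (2 * pi)^-1 * (2 * D) * ksq N u.
Proof.
move=> h1 h2; rewrite kform_dilated -mulrA ler_wpM2l ?invr_ge0 ?mulr_ge0 ?pi_ge0//.
have i1 := L1_trig_form alpha fL1 N (fun n => Re (u n)).
have i2 := L1_trig_form alpha fL1 N (fun n => Im (u n)).
apply: (@le_trans _ _ (\int[mu]_t (2 * (f t * trig_form alpha N (fun n => Re (u n)) t) +
    2 * (f t * trig_form alpha N (fun n => Im (u n)) t)))).
  apply: le_Rintegral => //; first exact: L1_complex_trig_form.
    by apply: L1_add; exact: L1_cst_mul.
  move=> t _; rewrite -!(mulrCA (f t)) -mulrDr ler_wpM2l//; last exact: complex_trig_form_le.
  by case/andP: (f0B t).
rewrite RintegralD//; [|exact: L1_cst_mul|exact: L1_cst_mul].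
rewrite !RintegralZl// ksqE; lra.
Qed.

Lemma kform_dilated_tail N N0 u : (0 < N0)%N -> (forall n, (n < N0)%N -> u n = 0) ->
  kform dilated_kernel N u u <= (2 * pi)^-1 * (2 * (2 * B * alpha^-1 * schur_const R +
    4 * \int[mu]_t (f t * log_tail alpha N0 t))) * ksq N u.
Proof.
by move=> N00 u0; apply: kform_trig_form_le; apply: integral_trig_form_le => // n nN0; rewrite u0.
Qed.

Lemma kform_dilated_bounded : exists C, forall N u, kform dilated_kernel N u u <= C * ksq N u.
Proof.
pose C1 := (2 * pi)^-1 * (2 * (2 * \int[mu]_t f t)).
pose C2 := (2 * pi)^-1 * (2 * (2 * B * alpha^-1 * schur_const R +
    4 * \int[mu]_t (f t * log_tail alpha 1 t))).
have kt N u C : kform dilated_kernel N u u <= C * ksq N u -> 0 <= ksq N u ->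
    kform dilated_kernel N u u <= `|C| * ksq N u.
  by move=> h k0; apply: (le_trans h); rewrite ler_wpM2r// ler_norm.
exists (2 * `|C1| + 2 * `|C2|) => N u.
pose v n : R[i] := if (n == 0)%N then u n else 0.
pose w n : R[i] := if (n == 0)%N then 0 else u n.
have kv : kform dilated_kernel N v v <= `|C1| * ksq N v.
  apply: kt; last exact: ksq_ge0.
  by apply: kform_trig_form_le; apply: integral_trig_form_head => // n; rewrite /v lt0n => /negbTE ->.
have kw : kform dilated_kernel N w w <= `|C2| * ksq N w.
  apply: kt; last exact: ksq_ge0.
  by apply: kform_dilated_tail => // n; rewrite ltnS leqn0 /w => ->.
have vu : ksq N v <= ksq N u.
  by apply: ler_sum => n _; rewrite /v; case: ifP => // _; rewrite dotc0l dotcc_ge0.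
have wu : ksq N w <= ksq N u.
  by apply: ler_sum => n _; rewrite /w; case: ifP => // _; rewrite dotc0l dotcc_ge0.
have e (s : R) : kform dilated_kernel N (fun i => s%:C * v i + w i) (fun i => s%:C * v i + w i) =
    s ^+ 2 * kform dilated_kernel N v v + 2 * s * kform dilated_kernel N v w + kform dilated_kernel N w w.
  set g := fun i => _; rewrite {1}/g kform_linl.
  rewrite (kformC dilated_kernel_herm N v g) (kformC dilated_kernel_herm N w g) /g !kform_linl.
  by rewrite (kformC dilated_kernel_herm N w v); ring.
have eu : u = fun i => 1%:C * v i + w i.
  by apply/funext => i; rewrite /v /w mul1r; case: ifP; rewrite ?addr0 ?add0r.
have h1 := e 1; rewrite -eu in h1.
(* Positivity at w - v bounds the cross term, so the form at u = v + w is at most twice the sum of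
   the forms at v and w. *)
have := kform_dilated_ge0 N (fun i => (-1)%:C * v i + w i); rewrite e => h2.
have h3 := ler_wpM2l (normr_ge0 C1) vu; have h4 := ler_wpM2l (normr_ge0 C2) wu.
have -> : (2 * `|C1| + 2 * `|C2|) * ksq N u = 2 * (`|C1| * ksq N u) + 2 * (`|C2| * ksq N u) by ring.
rewrite h1; move: h2 kv kw h3 h4.
move: (kform _ _ _ _) (kform _ _ _ _) (kform _ _ _ _) (`|_| * _) (`|_| * _) (`|_| * _) (`|_| * _) => *; lra.
Qed.

End symbol_kernel.

(** * A bounded nonnegative representative of the symbol *)

Section representative.
Variables (R : realType) (phi : R -> R) (delta : R).
Local Notation mu := (@lebesgue_measure R).
Local Notation L1 f := (mu.-integrable [set: R] (EFin \o f)).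
Hypothesis phi_Loo : phi \in Lfun lebesgue_measure +oo%E.
Hypothesis phi_ge0 : {ae lebesgue_measure, forall t, 0 <= phi t}.
Hypothesis phi_neq0 : ~ {ae lebesgue_measure, forall t, phi t = 0}.
Hypothesis delta_ge1 : 1 <= delta.
Hypothesis phi_log : (\int[lebesgue_measure]_t
                (phi t * (ln (2 + `|t|)) `^ delta)%:E < +oo)%E.

Lemma Loo_measurable : measurable_fun [set: R] phi.
Proof. by have := sub_Lfun_mfun phi_Loo; rewrite inE. Qed.

Lemma Loo_bounded : exists2 B, 0 <= B & {ae mu, forall t, `|phi t| <= B}.
Proof.
have := sub_Lfun_finLfun phi_Loo; rewrite inE/= /finite_norm unlock/=.
rewrite ifT; last by rewrite -set_itvNyy lebesgue_measure_itv/= ltry.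
set E := ess_sup _ _ => Eoo; exists (Num.max 0 (fine E)); first by rewrite le_max lexx.
have := @ess_sup_ge _ _ _ mu (abse \o (EFin \o phi))%E; rewrite -/E; apply: filterS => t /=.
case: E Eoo => [r| |]//= _; first by rewrite lee_fin => h; rewrite le_max h orbT.
Qed.

Lemma log_ge_ln2 (t : R) : ln 2 <= ln (2 + `|t|).
Proof. by rewrite ler_ln ?posrE ?ltr_wpDr// lerDl. Qed.

(** The hypotheses on [phi] hold almost everywhere; clipping it to [0, B] makes them hold pointwise.
    The matrix sees only Fourier transforms, which do not change. *)
Lemma bounded_representative : exists f B, [/\ L1 f, (forall t, 0 <= f t <= B),
  L1 (fun t => f t * ln (2 + `|t|)), (forall u, fourier phi u = fourier f u) & 0 < \int[mu]_t f t].
Proof.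
have mphi := Loo_measurable; have [B B0 hB] := Loo_bounded.
pose f t := Num.max 0 (Num.min (phi t) B).
have mf : measurable_fun [set: R] f.
  by apply: measurable_maxr => //; exact: measurable_minr.
have f0 t : 0 <= f t by rewrite /f le_max lexx.
have fB t : f t <= B by rewrite /f ge_max B0 ge_min lexx orbT.
have fphi : {ae mu, forall t, phi t = f t}.
  apply: (@filterS2 _ (almost_everywhere mu) _ _ _ _ _ phi_ge0 hB) => t p0 pB; rewrite /f min_l ?max_r//.
  exact: le_trans (ler_norm _) pB.
have ln2 : 0 < ln 2 :> R by rewrite ln_gt0// ltr1n.
have lg0 (t : R) : 0 < ln (2 + `|t|) :> R by exact: lt_le_trans ln2 (log_ge_ln2 t).
have mlog : measurable_fun [set: R] (fun t : R => ln (2 + `|t|)).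
  by apply: measurableT_comp; [exact: measurable_ln|exact: measurable_funD].
have mpow : measurable_fun [set: R] (fun t : R => ln (2 + `|t|) `^ delta).
  by apply: (measurableT_comp (measurable_powR delta)).
have ipow : L1 (fun t => f t * ln (2 + `|t|) `^ delta).
  apply/integrableP; split; first by apply/measurable_EFinP; exact: measurable_funM.
  apply: le_lt_trans phi_log; rewrite le_eqVlt; apply/orP; left; apply/eqP.
  apply: ae_eq_integral => //.
  - by apply: measurableT_comp => //; apply/measurable_EFinP; exact: measurable_funM.
  - by apply/measurable_EFinP; exact: measurable_funM.
  - apply: (@filterS _ (almost_everywhere mu) _ _ _ _ fphi) => t e _ /=.
    have p1 : 0 <= f t * ln (2 + `|t|) `^ delta by rewrite mulr_ge0// powR_ge0.
    by rewrite e (ger0_norm p1).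
(* As ln (2 + |t|) >= ln 2, the power [delta] times this constant dominates the logarithm itself. *)
pose k := (ln 2 `^ (delta - 1))^-1 : R.
have k0 : 0 < k by rewrite invr_gt0 powR_gt0.
have ilog : L1 (fun t => f t * ln (2 + `|t|)).
  apply: (@le_integrable _ _ _ mu _ measurableT _ (EFin \o (fun t => k * (f t * ln (2 + `|t|) `^ delta)))).
  - by apply/measurable_EFinP; exact: measurable_funM.
  - move=> s _ /=; have p1 : 0 <= f s * ln (2 + `|s|) by rewrite mulr_ge0// ltW.
    have p2 : 0 <= k * (f s * ln (2 + `|s|) `^ delta).
      by rewrite mulr_ge0 ?(ltW k0)// mulr_ge0// powR_ge0.
    rewrite lee_fin (ger0_norm p1) (ger0_norm p2).
    rewrite mulrCA ler_wpM2l//.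
    move: (ln (2 + `|s|)) (lg0 s) (log_ge_ln2 s) => l l0 ll.
    have -> : l `^ delta = l * l `^ (delta - 1).
      have h : l `^ (1 + (delta - 1)) = l `^ 1 * l `^ (delta - 1).
        by apply: powRD; have -> : (l != 0) = true; [exact: lt0r_neq0|exact: implybT].
      by rewrite powRr1 ?(ltW l0)// (_ : 1 + (delta - 1) = delta) in h; last ring.
    rewrite mulrCA ler_peMr ?(ltW l0)// /k mulrC ler_pdivlMr ?powR_gt0// mul1r.
    by apply: ge0_ler_powR; rewrite ?nnegrE ?subr_ge0 ?(ltW ln2) ?(ltW l0).
  - exact: L1_cst_mul.
have if1 : L1 f.
  apply: (@le_integrable _ _ _ mu _ measurableT _ (EFin \o (fun t => (ln 2)^-1 * (f t * ln (2 + `|t|))))).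
  - exact/measurable_EFinP.
  - move=> s _ /=; have p1 : 0 <= (ln 2)^-1 * (f s * ln (2 + `|s|)).
      by rewrite mulr_ge0 ?invr_ge0 ?(ltW ln2)// mulr_ge0// ltW.
    rewrite lee_fin (ger0_norm (f0 s)) (ger0_norm p1).
    by rewrite mulrCA ler_peMr// mulrC ler_pdivlMr// mul1r log_ge_ln2.
  - exact: L1_cst_mul.
exists f, B; split => //.
- by move=> t; rewrite f0 fB.
- move=> u; have E (g : R -> R) : measurable_fun [set: R] g ->
      \int[mu]_t (phi t * g t) = \int[mu]_t (f t * g t).
    move=> mg; congr fine; apply: ae_eq_integral => //.
    + by apply/measurable_EFinP; exact: measurable_funM.
    + by apply/measurable_EFinP; exact: measurable_funM.
    + by apply: (@filterS _ (almost_everywhere mu) _ _ _ _ fphi) => t e _; rewrite e.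
  have mt (h : R -> R) : continuous h -> measurable_fun [set: R] (fun t => h (t * u)).
    move=> ch; apply: measurableT_comp; first exact: continuous_measurable_fun.
    exact: measurable_funM.
  rewrite /fourier (E (fun t => cos (t * u))); last by apply: mt; exact: continuous_cos.
  by rewrite (E (fun t => sin (t * u)))//; apply: mt; exact: continuous_sin.
- rewrite lt_neqAle Rintegral_ge0// andbT eq_sym; apply/eqP => f00; apply: phi_neq0.
  have : (\int[mu]_t `|(f t)%:E| = 0)%E.
    under eq_integral do rewrite gee0_abs ?lee_fin//.
    rewrite -[LHS]fineK; last exact: integrable_fin_num.
    by rewrite -[fine _]/(\int[mu]_t f t) f00.
  have mEf : measurable_fun [set: R] (EFin \o f) by exact/measurable_EFinP.
  move=> h0; have /= h := (@ae_eq_integral_abs _ _ _ mu _ measurableT _ mEf).1 h0.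
  apply: (@filterS2 _ (almost_everywhere mu) _ _ _ _ _ fphi h) => t -> /= ft.
  by have [] := ft I.
Qed.

End representative.

(** * The operators K(phi_alpha) *)

Section arithmetic_operator.
Variables (R : realType) (phi f : R -> R) (B : R).
Local Notation mu := (@lebesgue_measure R).
Local Notation L1 f := (mu.-integrable [set: R] (EFin \o f)).
Hypothesis mphi : measurable_fun [set: R] phi.
Hypothesis fL1 : L1 f.
Hypothesis f0B : forall t, 0 <= f t <= B.
Hypothesis flog : L1 (fun t => f t * ln (2 + `|t|)).
Hypothesis phi_f : forall u, fourier phi u = fourier f u.

(** The real number whose embedding is the Fourier transform at 0 ([fourier0]). *)
Definition mean : R := (2 * pi)^-1 * \int[mu]_t f t.

Lemma kmat_dilation alpha n m : 0 < alpha -> kmat (dilation phi alpha) n.+1 m.+1 = dilated_kernel f alpha n m.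
Proof. by move=> alpha_gt0; rewrite /kmat /dilated_kernel fourier_dilation// phi_f. Qed.

(** [kernel_op] witnesses that a bounded extension exists, which rules out the default value of
    [K]. *)
Lemma is_K_K alpha : 0 < alpha -> is_K (dilation phi alpha) (K (dilation phi alpha)).
Proof.
move=> alpha_gt0; have [C hC] := kform_dilated_bounded alpha_gt0 fL1 f0B flog.
rewrite /K; case: pselect => [h|[]]; first exact: projT2 (cid h).
exists (kernel_op (dilated_kernel_herm alpha fL1) (kform_dilated_ge0 alpha fL1 f0B) hC); split; first exact: kernel_op_bounded.
move=> x N x0 n; rewrite (kernel_op_finite_support _ _ _ x0); apply: eq_bigr => m _.
by rewrite kmat_dilation.
Qed.

Lemma K_form_small (l : R) : 0 < l -> exists2 al1, 0 < al1 & forall alpha, al1 <= alpha ->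
  exists N0, forall w : l2 R, truncate N0 w = 0 -> ip (K (dilation phi alpha) w) w <= l * ip w w.
Proof.
move=> l0; have pi0 := @pi_gt0 R.
have B0 : 0 <= B by case/andP: (f0B 0) => h1 h2; exact: le_trans h1 h2.
have S0 : 0 <= schur_const R by rewrite /schur_const addr_ge0// divr_ge0// ln_ge0// ler1n.
(* The tail bound of the form is (2 B S / alpha + 4 I) / pi, with S the Schur constant and I the
   logarithmic integral. This threshold keeps the first term below l / 2, and I <= pi l / 8 does the
   same for the second. *)
exists (4 * B * schur_const R / (pi * l) + 1).
  by rewrite ltr_wpDl// divr_ge0 ?mulr_ge0// ltW// mulr_gt0.
move=> alpha hal; have alpha_gt0 : 0 < alpha.
  by apply: lt_le_trans hal; rewrite ltr_wpDl// divr_ge0 ?mulr_ge0// ltW// mulr_gt0.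
have [[M AM] Ak] := is_K_K alpha_gt0.
have e0 : 0 < pi * l / 8 by rewrite divr_gt0// mulr_gt0.
have [N0 N00 hN0] := log_tail_small alpha_gt0 fL1 f0B flog e0.
exists N0; apply: (matrix_op_form_le AM _ (ltW l0)) => [x N x0 n|N u u0].
  by rewrite (Ak x N x0 n); apply: eq_bigr => m _; rewrite kmat_dilation.
apply: (le_trans (kform_dilated_tail alpha_gt0 fL1 f0B flog N N00 u0)).
rewrite ler_wpM2r ?ksq_ge0//.
set I := \int[mu]_t _ in hN0 *; set S := schur_const R in S0 hal *.
have h1 : 4 * B * S / (pi * l) <= alpha by apply: le_trans hal; rewrite lerDl.
rewrite ler_pdivrMr ?mulr_gt0// in h1.
have h2 : B * alpha^-1 * S <= pi * l / 4.
  rewrite mulrAC ler_pdivrMr//; lra.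
rewrite ler_pdivrMl ?mulr_gt0//.
have -> : 2 * B * alpha^-1 * S = 2 * (B * alpha^-1 * S) by ring.
move: h2; move: (B * alpha^-1 * S) => X h2; lra.
Qed.

Lemma dilated_kernel_diag alpha n : dilated_kernel f alpha n n = (damp R n * mean)%:C.
Proof.
rewrite dilated_kernelE subrr -expr2 wgt_sq.
have -> : \int[mu]_t (f t * cos (t * 0)) = \int[mu]_t f t.
  by apply: eq_Rintegral => t _; rewrite mulr0 cos0 mulr1.
have -> : \int[mu]_t (f t * sin (t * 0)) = 0.
  rewrite (_ : (fun t => _) = cst 0) ?Rintegral_cst ?mul0r//.
  by apply/funext => t; rewrite mulr0 sin0 mulr0.
by rewrite oppr0 -[_ +i* 0]/((\int[mu]_t f t)%:C) -rmorphM /mean mulrA.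
Qed.

Lemma fourier0 : fourier phi 0 = mean%:C.
Proof.
have := dilated_kernel_diag 1 0; rewrite /dilated_kernel divr1 ln1 mulr0 mulr1 sqrtr1 invr1 phi_f /damp invr1 !mul1r.
by [].
Qed.

Lemma dotcM_le (z x y : R[i]) (e : R) : `|Re z| <= e -> `|Im z| <= e ->
  `|dotc (z * x) y| <= 2 * e * (dotc x x + dotc y y).
Proof.
move=> h1 h2; have e0 : 0 <= e by exact: le_trans h1.
have -> : dotc (z * x) y = Re z * dotc x y + Im z * dotc (Complex 0 1 * x) y.
  by case: z x y {h1 h2} => a b [c d] [g h]; rewrite /dotc/=; ring.
have d1 := dotc_le x y; have d2 := dotc_le (Complex 0 1 * x) y.
rewrite dotcM in d2.
have i1 : dotc (Complex 0 1 : R[i]) (Complex 0 1) = 1 by rewrite /dotc/= mulr0 add0r mulr1.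
rewrite i1 mul1r in d2.
apply: (le_trans (ler_normD _ _)); rewrite !normrM -mulrA mulr2n mulrDl mul1r.
by apply: lerD; apply: ler_pM.
Qed.

(** The first [J] logarithmic frequencies are 1 / J apart, so alpha >= J |W| pushes all their scaled
    differences past the Riemann-Lebesgue threshold W. *)
Lemma dilated_kernel_offdiag_small (J : nat) (e : R) : 0 < e -> exists2 al1, 0 < al1 & forall alpha, al1 <= alpha ->
  forall n m, (n < J)%N -> (m < J)%N -> n != m ->
  `|Re (dilated_kernel f alpha n m)| <= e /\ `|Im (dilated_kernel f alpha n m)| <= e.
Proof.
move=> e0; have [W hW] := riemann_lebesgue fL1 e0.
exists (J%:R * `|W| + 1); first by rewrite ltr_wpDl// mulr_ge0.
move=> alpha hal n m nJ mJ nm.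
have alpha_gt0 : 0 < alpha by apply: lt_le_trans hal; rewrite ltr_wpDl// mulr_ge0.
have J0 : (0 : R) < J%:R by rewrite ltr0n (leq_ltn_trans _ nJ).
have gap p q : (p < q)%N -> (q < J)%N -> J%:R^-1 <= freq R q - freq R p.
  move=> pq qJ; apply: le_trans (ln_sub_ge _ _) => //.
  have q0 : (0 : R) < q.+1%:R by [].
  rewrite ler_pdivlMr// mulrC ler_pdivrMr//.
  have h1 : (q.+1%:R : R) <= J%:R by rewrite ler_nat.
  have h2 : (1 : R) <= q.+1%:R - p.+1%:R by rewrite -natrB ?ler1n ?subn_gt0// ltnW.
  by apply: (le_trans h1); rewrite ler_peMl// ltW.
have Ww : W <= `|scaled_freq alpha n - scaled_freq alpha m|.
  rewrite /scaled_freq -mulrBr normrM (gtr0_norm alpha_gt0).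
  have hg : J%:R^-1 <= `|freq R n - freq R m|.
    case: (ltngtP n m) nm => // h _.
      by rewrite distrC; apply: le_trans (ler_norm _); exact: gap.
    by apply: le_trans (ler_norm _); exact: gap.
  apply: (le_trans (ler_norm W)).
  apply: (@le_trans _ _ (alpha * J%:R^-1)); last by rewrite ler_wpM2l// ltW.
  rewrite ler_pdivlMr// mulrC; apply: le_trans hal; by rewrite lerDl.
have [hc hs] := hW _ Ww.
have c1 : 0 <= wgt R n * wgt R m * (2 * pi)^-1 <= 1.
  have w1 k : 0 <= wgt R k <= 1.
    by rewrite sqrtr_ge0 -[leRHS]sqrtr1 ler_wsqrtr// invf_le1// ler1n.
  have p1 : 0 <= ((2 * pi)^-1 : R) <= 1.
    rewrite invr_ge0 mulr_ge0 ?pi_ge0//= invf_le1 ?mulr_gt0 ?pi_gt0//.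
    by have := @pi_ge2 R; lra.
  case/andP: (w1 n) (w1 m) p1 => a1 a2 /andP[b1 b2] /andP[d1 d2].
  by rewrite !mulr_ge0//= mulr_ile1 ?mulr_ge0// mulr_ile1.
case/andP: c1 => c1 c2; rewrite dilated_kernelE.
set c := wgt R n * wgt R m * (2 * pi)^-1 in c1 c2 *; clearbody c.
set x := \int[mu]_t _ in hc *; set y := \int[mu]_t _ in hs *.
have -> : Re (c%:C * (x -i* y)) = c * x by rewrite /=; ring.
have -> : Im (c%:C * (x -i* y)) = - (c * y) by rewrite /=; ring.
rewrite normrN !normrM (ger0_norm c1).
by split; [apply: le_trans hc|apply: le_trans hs]; rewrite ler_piMl.
Qed.

Lemma K_form_large (J : nat) (lam : R) : J = 0%N \/ lam < J%:R^-1 * mean ->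
  exists2 al1, 0 < al1 & forall alpha, al1 <= alpha ->
  forall x : l2 R, truncate J x = x -> x != 0 -> lam * ip x x < ip (K (dilation phi alpha) x) x.
Proof.
case: J => [_|J [//|hJ]].
  exists 1 => // alpha _ x fx; case/eqP; rewrite -fx.
  by apply: l2_ext => n; rewrite truncateE ltn0.
set J1 := J.+1 in hJ *; have J0 : (0 : R) < J1%:R by [].
(* The smallest diagonal entry is mean / J1, and the off-diagonal part costs 4 e J1 |x|^2, which is
   half of the available margin. *)
pose e := (J1%:R^-1 * mean - lam) / (8 * J1%:R).
have e0 : 0 < e by rewrite divr_gt0 ?subr_gt0// mulr_gt0.
have [al1 al10 hal1] := dilated_kernel_offdiag_small J1 e0.
exists al1 => // alpha hal x fx x0.
have alpha_gt0 : 0 < alpha by exact: lt_le_trans hal.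
have [[M AM] Ak] := is_K_K alpha_gt0.
have Ak' : forall (x : l2 R) (N : nat), (forall m, (N <= m)%N -> x m = 0) ->
    forall n, K (dilation phi alpha) x n = \sum_(m < N) dilated_kernel f alpha n m * x m.
  by move=> z N z0 n; rewrite (Ak z N z0 n); apply: eq_bigr => m _; rewrite kmat_dilation.
rewrite (ip_truncate_kform Ak' fx fx).
have ipx : ip x x = ksq J1 x.
  by rewrite -{1}fx ip_truncatel.
have S0 : 0 < ksq J1 x.
  rewrite -ipx lt_neqAle ip_ge0 andbT eq_sym; apply: contra_neq x0; exact: ip_eq0.
rewrite ipx.
have mean0 : 0 <= mean.
  rewrite /mean mulr_ge0 ?invr_ge0 ?mulr_ge0 ?pi_ge0//; apply: Rintegral_ge0 => t _.
  by case/andP: (f0B t).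
pose s : R := ksq J1 x.
have hrow (n : 'I_J1) : J1%:R^-1 * mean * dotc (x n) (x n) - 2 * e * (s + J1%:R * dotc (x n) (x n))
    <= dotc (kapp (dilated_kernel f alpha) J1 x n) (x n).
  rewrite /kapp dotc_suml (bigD1 n)//= dilated_kernel_diag dotcZl; apply: lerD.
    rewrite ler_wpM2r ?dotcc_ge0// ler_wpM2r// lef_pV2 ?posrE// ler_nat.
    exact: ltn_ord.
  rewrite lerNl -sumrN.
  have -> : 2 * e * (s + J1%:R * dotc (x n) (x n)) =
      \sum_(m < J1) 2 * e * (dotc (x m) (x m) + dotc (x n) (x n)).
    rewrite -mulr_sumr big_split/=; congr (_ * (_ + _)).
    by rewrite sumr_const card_ord mulr_natl.
  rewrite [leRHS](bigD1 n)//= -[leLHS]add0r; apply: lerD.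
    apply: mulr_ge0; first by rewrite mulr_ge0// ltW.
    by rewrite addr_ge0 ?dotcc_ge0.
  apply: ler_sum => m mn.
  have nm : n != m :> nat by rewrite eq_sym.
  have [h1 h2] := hal1 alpha hal n m (ltn_ord n) (ltn_ord m) nm.
  by apply: le_trans (dotcM_le _ _ h1 h2); rewrite -normrN ler_norm.
apply: (@lt_le_trans _ _ (\sum_(n < J1) (J1%:R^-1 * mean * dotc (x n) (x n) -
    2 * e * (s + J1%:R * dotc (x n) (x n))))); last by apply: ler_sum => n _; exact: hrow.
rewrite sumrB -mulr_sumr -/(ksq J1 x) -mulr_sumr big_split/= sumr_const card_ord -mulr_sumr.
rewrite -/(ksq J1 x) -/s -[s *+ J1]mulr_natl.
have eE : 2 * e * (J1%:R * s + J1%:R * s) = (J1%:R^-1 * mean - lam) / 2 * s.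
  by rewrite /e; field; exact: lt0r_neq0.
rewrite eE -/s in S0 *; have : 0 < (J1%:R^-1 * mean - lam) * s by rewrite mulr_gt0// subr_gt0.
move: (J1%:R^-1 * mean) => q; nra.
Qed.

End arithmetic_operator.

(** * Essential spectrum and eigenvalue count for large alpha *)

Section main.
Variables (R : realType) (phi f : R -> R) (B : R).
Local Notation mu := (@lebesgue_measure R).
Local Notation L1 f := (mu.-integrable [set: R] (EFin \o f)).
Hypothesis mphi : measurable_fun [set: R] phi.
Hypothesis fL1 : L1 f.
Hypothesis f0B : forall t, 0 <= f t <= B.
Hypothesis flog : L1 (fun t => f t * ln (2 + `|t|)).
Hypothesis phi_f : forall u, fourier phi u = fourier f u.

(** The form is pushed below lam / 2 on the tail, which leaves the strict gap under [lam] that the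
    variational argument requires. *)
Lemma K_spectrum (J : nat) (lam : R) : 0 < lam -> J = 0%N \/ lam < J%:R^-1 * mean f ->
  exists2 alpha0, 0 < alpha0 & forall alpha, alpha0 <= alpha ->
    (forall mu, ess_spectrum (K (dilation phi alpha)) mu -> mu < lam) /\
    (forall D : set R, (forall mu, lam < mu -> D mu) ->
      (J%:R%:E <= count_eigen (K (dilation phi alpha)) D)%E).
Proof.
move=> lam0 hJ; have l0 : 0 < lam / 2 by rewrite divr_gt0.
have [a1 a10 h1] := K_form_small mphi fL1 f0B flog phi_f l0.
have [a2 a20 h2] := K_form_large mphi fL1 f0B flog phi_f hJ.
exists (Num.max a1 a2); first by rewrite lt_max a10.
move=> alpha; rewrite ge_max => /andP[al1 al2].
have [N0 hN0] := h1 alpha al1; have hlow := h2 alpha al2.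
have alpha_gt0 : 0 < alpha by exact: lt_le_trans al1.
have [[M AM] Ak] := is_K_K mphi fL1 f0B flog phi_f alpha_gt0.
have llam : lam / 2 < lam by rewrite ltr_pdivrMr// mulr_natr mulr2n ltrDl.
have Asym : forall x y, ip (K (dilation phi alpha) x) y = ip x (K (dilation phi alpha) y).
  apply: (matrix_op_sym (dilated_kernel_herm alpha fL1) AM) => x N x0 n.
  by rewrite (Ak x N x0 n); apply: eq_bigr => m _; rewrite (kmat_dilation mphi phi_f).
split=> [mu /(ess_spectrum_le AM hN0)|D lamD]; first by move/le_lt_trans; apply.
exact: (count_eigen_ge AM hN0 Asym llam lamD hlow).
Qed.

End main.

Theorem theorem2p3 (R : realType) (phi : R -> R) (delta : R)
  (phi_Loo : phi \in Lfun lebesgue_measure +oo%E)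
  (phi_ge0 : {ae lebesgue_measure, forall t, 0 <= phi t})
  (phi_neq0 : ~ {ae lebesgue_measure, forall t, phi t = 0})
  (delta_gt2 : 2 < delta)
  (phi_log : (\int[lebesgue_measure]_t
                (phi t * (ln (2 + `|t|)) `^ delta)%:E < +oo)%E) :
  (forall lam : R, 0 < lam ->
     exists2 alpha0 : R, 0 < alpha0 &
       forall alpha : R, alpha0 <= alpha ->
         (counting [set j : nat | (0 < j)%N
                        /\ (lam%:C < j%:R^-1 * fourier phi 0)%R]
          <= nfun (K (dilation phi alpha)) lam)%E)
  /\ count_eigen (K (dilation phi alpha)) (above_ess (K (dilation phi alpha)))
       @[alpha --> +oo] --> +oo%E.
Proof.
have delta1 : 1 <= delta by apply: le_trans (ltW delta_gt2); rewrite ler1n.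
have mphi := Loo_measurable phi_Loo.
have [f [B [fL1 f0B flog phi_f f_gt0]]] :=
  bounded_representative phi_Loo phi_ge0 phi_neq0 delta1 phi_log.
have q0 : 0 < mean f by rewrite /mean mulr_gt0// invr_gt0 mulr_gt0// pi_gt0.
have spec := K_spectrum mphi fL1 f0B flog phi_f.
split=> [lam lam0|].
(* [J] will be the largest index counted in the statement; admitting 0 covers the case where none
   is. *)
- pose P j := (j == 0)%N || (lam < j%:R^-1 * mean f).
  have P0 : exists j, P j by exists 0%N; rewrite /P eqxx.
  have Pb j : P j -> (j <= Num.truncn (mean f / lam) )%N.
    case: j => // j; rewrite /P /= ltr_pdivlMl// => /ltW hj.
    by rewrite truncn_ge_nat ?divr_ge0 ?(ltW q0) ?(ltW lam0)// ler_pdivlMr.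
  pose J := ex_maxn P0 Pb.
  have [JP Jmax] : P J /\ forall j, P j -> (j <= J)%N.
    by rewrite /J; case: ex_maxnP.
  have [|a0 a00 ha] := spec J lam lam0.
    by move: JP; rewrite /P => /orP[/eqP ->|]; [left|right].
  exists a0 => // al /ha[ess cnt].
  apply: (@le_trans _ _ (J%:R%:E)); last first.
    rewrite /nfun; case: ifPn => _; first exact: leey.
    exact: cnt.
  have sub : [set j : nat | (0 < j)%N /\ (lam%:C < j%:R^-1 * fourier phi 0)%R]
      `<=` [set` iota 1 J].
    move=> j /= [j0]; rewrite (fourier0 phi_f).
    (* The statement compares complex numbers; both sides are real, so the comparison descends to
       [R]. *)
    rewrite (_ : j%:R^-1 * _ = (j%:R^-1 * mean f)%:C) ?ltcR => [hj|]; last first.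
      by rewrite -[j%:R in LHS](rmorph_nat (real_complex R)) -fmorphV -rmorphM.
    by rewrite mem_iota j0 add1n ltnS Jmax// /P hj orbT.
  have finS := sub_finite_set sub (finite_seq _).
  rewrite /counting; case: asboolP => // _; rewrite lee_fin ler_nat.
  rewrite -[leqRHS](size_iota 1); apply: uniq_leq_size; first exact: finmap.fset_uniq.
  by move=> j; rewrite in_fset_set// inE => /sub.
(* To exceed [M], aim at [J] > |M| eigenvalues, with the level mean / (J + 1) strictly below mean /
   J. *)
- apply/cvgeyPge => M; pose J := (Num.truncn `|M|).+1.
  pose lam := J.+1%:R^-1 * mean f.
  have lam0 : 0 < lam by rewrite mulr_gt0// invr_gt0.
  have lamJ : lam < J%:R^-1 * mean f.
    by rewrite ltr_pM2r// ltf_pV2 ?posrE// ltr_nat.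
  have [a0 a00 ha] := spec J lam lam0 (or_intror lamJ).
  near=> al; have /ha[ess cnt] : a0 <= al by near: al; apply: nbhs_pinfty_ge; exact: num_real.
  apply: (@le_trans _ _ J%:R%:E).
    rewrite lee_fin (le_trans (ler_norm M))// ltW//; exact: truncnS_gt.
  (* The essential spectrum lies below [lam], so every number above [lam] belongs to [above_ess]. *)
  by apply: cnt => m lm s /ess sl; exact: lt_trans lm.
Unshelve. all: by end_near. Qed.
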